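(* Let $A\in\mathcal M_{m,n}(K_v)$ be a matrix. The following assertions are equivalent: (1) there exists $\epsilon>0$ such that the set $\mathbf{Bad}_A(\epsilon)$ has full Hausdorff dimension, that is, $\dim_{\rm Haus}\mathbf{Bad}_A(\epsilon)=m$; (2) the matrix $A$ is $(\mathbf r,\mathbf s)$-singular on average.
   Context: Let $\mathbb F_q$ be a finite field with $q$ elements, and let $K$ be the function field of a geometrically connected smooth projective curve $\mathbf C$ over $\mathbb F_q$. Let $v$ be a closed point of $\mathbf C$, identified with the corresponding normalized discrete valuation of $K$. Let $K_v$ be the completion of $K$ for $v$, let $q_v$ be the cardinality of its residue field, and $|x|=q_v^{-v(x)}$ the absolute value on $K_v$. Let $R_v$ be the affine algebra of $\mathbf C-\{v\}$, i.e. the ring of elements of $K$ whose only poles are at $v$. Let $m,n\ge 1$ be integers and let $\mathbf r=(r_1,\dots,r_m)$, $\mathbf s=(s_1,\dots,s_n)$ be fixed tuples of positive integers with $\sum_i r_i=\sum_j s_j$. For $\boldsymbol\xi\in K_v^m$ and $\boldsymbol\theta\in K_v^n$ put $\|\boldsymbol\xi\|_{\mathbf r}=\max_i|\xi_i|^{1/r_i}$, $\|\boldsymbol\theta\|_{\mathbf s}=\max_j|\theta_j|^{1/s_j}$, and $\langle\boldsymbol\xi\rangle_{\mathbf r}=\inf_{\mathbf x\in R_v^m}\|\boldsymbol\xi-\mathbf x\|_{\mathbf r}$. For $\epsilon>0$, $\mathbf{Bad}_A(\epsilon)$ is the set of $\boldsymbol\theta\in K_v^m$ such that $$\liminf_{\mathbf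 x\in R_v^n,\ \|\mathbf x\|_{\mathbf s}\to\infty}\|\mathbf x\|_{\mathbf s}\,\langle A\mathbf x-\boldsymbol\theta\rangle_{\mathbf r}\ge\epsilon .$$ Hausdorff dimension of subsets of $K_v^m$ is with respect to the distance defined by the norm $\|\boldsymbol\xi\|=\max_i|\xi_i|$ (for which $K_v^m$ has dimension $m$). $A$ is $(\mathbf r,\mathbf s)$-singular on average if for every $\epsilon>0$, $$\lim_{N\to\infty}\frac1N\,\mathrm{Card}\{\ell\in\{1,\dots,N\}:\exists\,\mathbf y\in R_v^n-\{0\},\ \langle A\mathbf y\rangle_{\mathbf r}\le\epsilon q_v^{-\ell},\ \|\mathbf y\|_{\mathbf s}\le q_v^{\ell}\}=1.$$ *)

(* Defs.v *)
From HB Require Import structures.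
From mathcomp Require Import all_boot all_order all_algebra.
From mathcomp Require Import all_classical all_reals all_analysis.

Set Implicit Arguments.
Unset Strict Implicit.
Unset Printing Implicit Defensive.

Import Order.TTheory GRing.Theory Num.Theory.
Import numFieldNormedType.Exports.

Local Open Scope classical_set_scope.
Local Open Scope ring_scope.

(* Geometrically connected smooth projective curves over the finite (hence
   perfect) field k correspond to their function fields: the field extensions
   K of k that are finite over k(t) for some t transcendental over k, and in
   which k is algebraically closed (this is the geometric connectedness).
   Finiteness over k(t) is written with denominators cleared: every x in K is
   a combination of the b i with coefficients (c i)(t) / d(t). *)
Definition function_field (k : finFieldType) (K : fieldType)
    (iota : {rmorphism k -> K}) : Prop :=
  (exists t : K, ~ algebraicOver iota t /\
     exists (e : nat) (b : 'I_e -> K), forall x : K,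
       exists (d : {poly k}) (c : 'I_e -> {poly k}),
         d != 0 /\
         (map_poly iota d).[t] * x =
           \sum_(i < e) (map_poly iota (c i)).[t] * b i)
  /\ (forall x : K, algebraicOver iota x -> exists a : k, x = iota a).

(* The value v 0 = 0 is a placeholder for +oo; it is fixed so that equal
   valuations are equal as functions.  On a function field over a finite field
   k, triviality on k^* is automatic, its elements being roots of unity. *)
Record normalized_valuation (F : fieldType) (v : F -> int) : Prop := {
  nval0 : v 0 = 0;
  nvalM : forall x y, x != 0 -> y != 0 -> v (x * y) = v x + v y;
  nvalD : forall x y, x != 0 -> y != 0 -> x + y != 0 ->
    Num.min (v x) (v y) <= v (x + y);
  nval_onto : forall z : int, exists2 x, x != 0 & v x = z }.

(* [set x | N <= v x], with v 0 = +oo. *)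
Definition val_ge (F : fieldType) (v : F -> int) (N : int) : set F :=
  [set x | x = 0 \/ N <= v x].

(* The quotient of the valuation ring by its maximal ideal, as a set of
   cosets. *)
Definition residue_field (F : fieldType) (v : F -> int) : set (set F) :=
  [set [set y | val_ge v 1 (y - x)] | x in val_ge v 0].

Definition complete_valuation (F : fieldType) (v : F -> int) : Prop :=
  forall u : nat -> F,
    (forall N : int, exists n0 : nat, forall p q : nat,
       (n0 <= p)%N -> (n0 <= q)%N -> val_ge v N (u p - u q)) ->
    exists l : F, forall N : int, exists n0 : nat, forall p : nat,
      (n0 <= p)%N -> val_ge v N (u p - l).

Record is_completion (K : fieldType) (v : K -> int)
    (Kv : fieldType) (j : {rmorphism K -> Kv}) (vh : Kv -> int) : Prop := {
  compl_val : normalized_valuation vh;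
  compl_ext : forall x, vh (j x) = v x;
  compl_dense : forall (x : Kv) (N : int), exists y : K, val_ge vh N (x - j y);
  compl_complete : complete_valuation vh }.

(* The closed points of the curve are the normalized valuations of K. *)
Definition Rv (K : fieldType) (v : K -> int) : set K :=
  [set x | forall w : K -> int,
     normalized_valuation w -> w <> v -> val_ge w 0 x].

Definition Rv_vect (K : fieldType) (v : K -> int) (n : nat) : set 'cV[K]_n :=
  [set x | forall i, Rv v (x i 0)].

Definition absv (R : realType) (F : fieldType) (v : F -> int) (qv : nat)
    (x : F) : R :=
  if x == 0 then 0 else (qv%:R : R) ^ (- v x).

Definition max_norm (R : realType) (F : fieldType) (v : F -> int) (qv : nat)
    (m : nat) (xi : 'cV[F]_m) : R :=
  \big[Num.max/0]_(i < m) absv R v qv (xi i 0).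

Definition wnorm (R : realType) (F : fieldType) (v : F -> int) (qv : nat)
    (m : nat) (r : 'I_m -> nat) (xi : 'cV[F]_m) : R :=
  \big[Num.max/0]_(i < m) (absv R v qv (xi i 0) `^ ((r i)%:R^-1)).

Section Diophantine.
Variables (R : realType) (K : fieldType) (v : K -> int).
Variables (Kv : fieldType) (j : {rmorphism K -> Kv}) (vh : Kv -> int).
Variable qv : nat.

Definition wdist (m : nat) (r : 'I_m -> nat) (xi : 'cV[Kv]_m) : R :=
  inf [set wnorm R vh qv r (xi - map_mx j x) | x in Rv_vect v (n := m)].

(* The liminf, along x in Rv^n with ||x||_s tending to infinity, of
   ||x||_s <A x - theta>_r. *)
Definition bad_liminf (m n : nat) (r : 'I_m -> nat) (s : 'I_n -> nat)
    (A : 'M[Kv]_(m, n)) (theta : 'cV[Kv]_m) : \bar R :=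
  ereal_sup [set
    ereal_inf [set (wnorm R vh qv s (map_mx j x)
                      * wdist r (A *m map_mx j x - theta))%:E
              | x in [set x : 'cV[K]_n | Rv_vect v x
                        /\ T <= wnorm R vh qv s (map_mx j x)]]
  | T in [set: R]].

Definition Bad (m n : nat) (r : 'I_m -> nat) (s : 'I_n -> nat)
    (A : 'M[Kv]_(m, n)) (eps : R) : set 'cV[Kv]_m :=
  [set theta | (eps%:E <= bad_liminf r s A theta)%E].

Definition singular_on_average (m n : nat) (r : 'I_m -> nat) (s : 'I_n -> nat)
    (A : 'M[Kv]_(m, n)) : Prop :=
  forall eps : R, 0 < eps ->
    (fun N : nat => N%:R^-1 *
       (count (fun l : nat => `[< exists y : 'cV[K]_n,
          [/\ Rv_vect v y, y != 0,
              wdist r (A *m map_mx j y) <= eps * (qv%:R ^- l)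
            & wnorm R vh qv s (map_mx j y) <= qv%:R ^+ l] >])
         (iota 1 N))%:R : R) @ \oo --> (1 : R).

End Diophantine.

Section Hausdorff.
Variables (R : realType) (T : Type) (d : T -> T -> R).
Local Open Scope ereal_scope.

(* 0 is added so that the empty set has diameter 0. *)
Definition diameter (U : set T) : \bar R :=
  ereal_sup (0 |` [set z | exists x y, [/\ U x, U y & z = (d x y)%:E]]).

Definition hausdorff_premeasure (s delta : R) (S : set T) : \bar R :=
  ereal_inf [set z | exists U : nat -> set T,
    [/\ S `<=` \bigcup_i U i,
        forall i, diameter (U i) <= delta%:E
      & z = \sum_(0 <= i <oo) (diameter (U i) `^ s)]].

Definition hausdorff_measure (s : R) (S : set T) : \bar R :=
  ereal_sup [set hausdorff_premeasure s delta S
            | delta in [set delta : R | (0 < delta)%R]].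

(* Restricting to s > 0 does not change the infimum and avoids the convention
   for 0 to the power 0. *)
Definition hausdorff_dim (S : set T) : \bar R :=
  ereal_inf [set s%:E | s in [set s : R | (0 < s)%R
                                          /\ hausdorff_measure s S = 0]].

End Hausdorff.

(* Main.v *)
Require Import Defs.
From HB Require Import structures.
From mathcomp Require Import all_boot all_order all_algebra.
From mathcomp Require Import all_classical all_reals all_analysis.
From mathcomp Require finfield.
From mathcomp Require Import zify ring lra.

Set Implicit Arguments.
Unset Strict Implicit.
Unset Printing Implicit Defensive.

Import Order.TTheory GRing.Theory Num.Theory.
Import numFieldNormedType.Exports.

Local Open Scope classical_set_scope.
Local Open Scope ring_scope.

(** For [a, l], call [x != 0] in Rv^n short if [|x|_s <= q^l] and [A x] is within
   [q^-(l+a)] of Rv^m for the r-norm.  Singularity on average says that, for every [a],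
   the times [l] without short vector have density zero.

   If A is singular on average, transference (a pigeonhole argument) provides short
   vectors [z] for the transpose of A.  Keeping each time the vector that stays short
   longest, one changes it only o(N) times before time N.  A target theta such that
   no [z . theta] is close to Rv is badly approximable: compare [z . (A x - theta - p)]
   with [x . (transpose A) z].  Such theta are chosen digit by digit, each change of [z]
   forbidding at most one digit in boundedly many steps, so a Cantor set of dimension m
   is left; a potential function (the measure of the part of the current box that is
   covered, with weights) shows that no economical cover contains it.

   Conversely, at a time [l] without short vector the vectors [(x, A x - p)] of bounded
   weighted size span the whole space, hence every box of level [l - kap] contains a box
   of level [l + kap] around some [A x - p] with [|x|_s] about [q^l], and this smaller box
   misses the targets that are uniformly bad.  If such times do not have density zero,
   counting boxes bounds the dimension by some t < m.

   The arithmetic input is Riemann's inequality for Rv and the fact that a function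
   without poles outside v which vanishes at v is zero.  Both rest on counting the
   combinations of a basis over k(t) with coefficients in k[t] of bounded degree. *)

(** The curve is known only through its field and the set of all normalized valuations, so places
    must be produced and counted without a model. Dimension counts are therefore comparisons of
    cardinalities over finite residue fields: linear relations, finiteness of residue fields and
    Minkowski's theorem all come from the pigeonhole principle. The price is bounded losses such as
    [c0], harmless because only densities and exponents matter. As the weights [r] and [s] have
    equal sums, the boxes of the diagonal flow have constant volume, so the same constants serve at
    all times. In the construction of theta, one vector [z] may burden a whole round of digits, and
    nothing but the rarity of the changes is known. At a step that may forbid a digit, a full factor
    [q] is given up; over [N] rounds the loss is [q ^ o(N)], invisible to any exponent below m. No
    measure on the Cantor set is built: for each given cover with small sum, a path of digits
    escaping it is followed. *)

Lemma widen_ord_lift n (i : 'I_n) : widen_ord (leqnSn n) i = lift ord_max i.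
Proof. by apply: val_inj; rewrite /= /bump leqNgt ltn_ord. Qed.

(** * Elementary properties of normalized valuations *)

Section Valuation.
Variables (F : fieldType) (u : F -> int).
Hypothesis hu : normalized_valuation u.

Lemma val_ge_nz x N : x != 0 -> val_ge u N x <-> N <= u x.
Proof.
move=> x0; split=> [[xE|//]|]; last by right.
by rewrite xE eqxx in x0.
Qed.

Lemma val_ge0 N : val_ge u N 0. Proof. by left. Qed.

Lemma val_ge_le M N x : M <= N -> val_ge u N x -> val_ge u M x.
Proof. by move=> MN [->|Nx]; [left|right; apply: le_trans Nx]. Qed.

Lemma val_geM M N x y : val_ge u M x -> val_ge u N y -> val_ge u (M + N) (x * y).
Proof.
case: (eqVneq x 0) => [->|x0]; first by rewrite mul0r; left.
case: (eqVneq y 0) => [->|y0]; first by rewrite mulr0; left.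
move=> /(val_ge_nz _ x0) ? /(val_ge_nz _ y0) ?; right.
by rewrite (nvalM hu) //; lia.
Qed.

Lemma val_geD N x y : val_ge u N x -> val_ge u N y -> val_ge u N (x + y).
Proof.
case: (eqVneq x 0) => [->|x0]; first by rewrite add0r.
case: (eqVneq y 0) => [->|y0]; first by rewrite addr0.
case: (eqVneq (x + y) 0) => [->|xy0]; first by left.
move=> /(val_ge_nz _ x0) ? /(val_ge_nz _ y0) ?; right.
by apply: le_trans (nvalD hu x0 y0 xy0); lia.
Qed.

Lemma val_ge_sum (I : Type) (s : seq I) (P : pred I) (f : I -> F) N :
  (forall i, P i -> val_ge u N (f i)) -> val_ge u N (\sum_(i <- s | P i) f i).
Proof.
move=> fN; elim/big_ind: _ => [|x y|//]; [exact: val_ge0 | exact: val_geD].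
Qed.

Lemma nval1 : u 1 = 0.
Proof.
by have := nvalM hu (oner_neq0 F) (oner_neq0 F); rewrite mulr1; move: (u 1) => z; lia.
Qed.

Lemma nvalN1 : u (-1) = 0.
Proof.
have N1 : (-1 : F) != 0 by rewrite oppr_eq0 oner_eq0.
by have := nvalM hu N1 N1; rewrite mulrNN mulr1 nval1; move: (u (-1)) => z; lia.
Qed.

Lemma nvalN x : u (- x) = u x.
Proof.
case: (eqVneq x 0) => [->|x0]; first by rewrite oppr0.
by rewrite -mulN1r (nvalM hu) ?oppr_eq0 ?oner_eq0 // nvalN1 add0r.
Qed.

Lemma val_geN N x : val_ge u N (- x) <-> val_ge u N x.
Proof.
have H y : val_ge u N y -> val_ge u N (- y).
  by case=> [->|?]; [left; rewrite oppr0 | right; rewrite nvalN].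
by split=> [/H|/H //]; rewrite opprK.
Qed.

Lemma val_geB N x y : val_ge u N x -> val_ge u N y -> val_ge u N (x - y).
Proof. by move=> ? ?; apply: val_geD => //; apply/val_geN. Qed.

Lemma val_geBC N x y : val_ge u N (x - y) -> val_ge u N (y - x).
Proof. by move/val_geN; rewrite opprB. Qed.

Lemma val_ge_trans N x y z :
  val_ge u N (x - y) -> val_ge u N (y - z) -> val_ge u N (x - z).
Proof. by move=> a b; have := val_geD a b; rewrite addrA subrK. Qed.

Lemma nvalV x : u x^-1 = - u x.
Proof.
case: (eqVneq x 0) => [->|x0]; first by rewrite invr0 (nval0 hu) oppr0.
have := nvalM hu x0 (_ : x^-1 != 0); rewrite invr_eq0 => /(_ x0).
by rewrite mulfV // nval1; move: (u x) (u x^-1) => y z; lia.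
Qed.

Lemma nvalX x n : u (x ^+ n) = u x *+ n.
Proof.
case: (eqVneq x 0) => [->|x0].
  by rewrite (nval0 hu) mul0rn expr0n; case: (n == 0%N); rewrite ?nval1 ?(nval0 hu).
elim: n => [|n IH]; first by rewrite expr0 nval1.
by rewrite exprS (nvalM hu) ?expf_neq0 // IH mulrS.
Qed.

Lemma nvalXz x (n : int) : u (x ^ n) = u x * n.
Proof.
case: n => n; first by rewrite -exprnP nvalX -mulr_natr; lia.
by rewrite NegzE -exprnN nvalV nvalX -mulr_natr; lia.
Qed.

Lemma val_ge1 : val_ge u 0 1.
Proof. by right; rewrite nval1. Qed.

Lemma val_geX x n : val_ge u 0 x -> val_ge u 0 (x ^+ n).
Proof.
move=> x0; elim: n => [|n IH]; first exact: val_ge1.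
by rewrite exprS -[0]addr0; apply: val_geM.
Qed.

Lemma nval_add_lt x y N : x != 0 -> u x < N -> val_ge u N y ->
  x + y != 0 /\ u (x + y) = u x.
Proof.
move=> x0 xN yN.
have xy0 : x + y != 0.
  apply/eqP => /eqP; rewrite addr_eq0 => /eqP xE.
  by move: yN => /val_geN; rewrite -xE => /(val_ge_nz _ x0); lia.
split=> //; apply/eqP; rewrite eq_le; apply/andP; split.
  rewrite leNgt; apply/negP => lt.
  have : val_ge u (Num.min N (u (x + y))) (x + y - y).
    by apply: val_geB; [right; lia | apply: val_ge_le yN; lia].
  by rewrite addrK => /(val_ge_nz _ x0); lia.
have : val_ge u (u x) (x + y) by apply: val_geD; [right | apply: val_ge_le yN; lia].
by move/(val_ge_nz _ xy0).
Qed.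

Lemma val_geNP N x : ~ val_ge u N x -> x != 0 /\ u x < N.
Proof.
move=> h; split; first by apply/eqP => x0; apply: h; left.
by rewrite ltNge; apply/negP => ?; apply: h; right.
Qed.

Lemma nval_unif : exists2 p, p != 0 & u p = 1.
Proof. exact: nval_onto hu 1. Qed.

End Valuation.

Lemma bounded_below (f : nat -> nat) g : exists B, forall i, (i < g)%N -> (f i <= B)%N.
Proof.
exists (\max_(i < g) f i) => i ig.
exact: (leq_bigmax (Ordinal ig) (F := fun i : 'I_g => f i)).
Qed.

(** * Independence of distinct normalized valuations *)

Section WeakApproximation.
Variable K : fieldType.
Implicit Types u w : K -> int.

(** If the valuation ring of [u] lay in that of [w], then [w] would vanish on the units of [u], so
    [w = w p * u] for a uniformizer [p] of [u], and surjectivity would force [w p = 1]. *)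
Lemma val_incomparable u w :
  normalized_valuation u -> normalized_valuation w -> w <> u ->
  exists a, [/\ a != 0, 0 <= u a & w a < 0].
Proof.
move=> hu hw ne; apply: contrapT => H; apply: ne.
have pos a : a != 0 -> 0 <= u a -> 0 <= w a.
  by move=> a0 ua; rewrite leNgt; apply/negP => wa; apply: H; exists a.
have [p p0 up] := nval_unif hu.
have wE a : w a = w p * u a.
  have [->|a0] := eqVneq a 0; first by rewrite (nval0 hu) (nval0 hw) mulr0.
  set b := a / p ^ u a.
  have pz : p ^ u a != 0 by rewrite expfz_neq0.
  have b0 : b != 0 by rewrite mulf_neq0 ?invr_eq0.
  have ub : u b = 0.
    by rewrite (nvalM hu) ?invr_eq0 // (nvalV hu) (nvalXz hu) up mul1r subrr.
  have := pos b b0; have := pos b^-1; rewrite invr_eq0 (nvalV hu) (nvalV hw) ub.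
  move=> /(_ b0 (lexx _)) wb1 /(_ (lexx _)) wb2.
  have wb : w b = 0 by lia.
  have -> : a = b * p ^ u a by rewrite divfK.
  rewrite (nvalM hw) // (nvalM hu) // ub wb !add0r.
  by rewrite (nvalXz hw) (nvalXz hu) up mul1r.
have wp := pos p p0; rewrite up in wp.
have [a a0 wa] := nval_onto hw 1.
rewrite wE in wa.
have w1 : w p = 1.
  move: (wp isT) wa; move: (w p) (u a) => c d c0 cd.
  have [d0|d0] := lerP d 0; first by have : c * d <= 0; [nia | lia].
  have [//|c1] := eqVneq c 1.
  have [c2|c2] := lerP c 0; first by have c00 : c = 0; [lia | rewrite c00 in cd; lia].
  by have : 2 <= c * d; [nia | lia].
by apply/funext => x; rewrite wE w1 mul1r.
Qed.

Lemma val_separate u w :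
  normalized_valuation u -> normalized_valuation w -> w <> u ->
  exists a, [/\ a != 0, u a < 0 & 0 < w a].
Proof.
move=> hu hw ne.
have [a [a0 ua wa]] := val_incomparable hu hw ne.
have [b [b0 wb ub]] := val_incomparable hw hu (not_eq_sym ne).
exists (b / a); split; first by rewrite mulf_neq0 ?invr_eq0.
  by rewrite (nvalM hu) ?invr_eq0 // (nvalV hu); lia.
by rewrite (nvalM hw) ?invr_eq0 // (nvalV hw); lia.
Qed.

Lemma nval_add1 u z : normalized_valuation u -> z != 0 -> u z < 0 ->
  1 + z != 0 /\ u (1 + z) = u z.
Proof.
move=> hu z0 uz; rewrite addrC.
by apply: (@nval_add_lt _ _ hu _ _ 0) => //; exact: val_ge1.
Qed.

Lemma nval_add1' u z : normalized_valuation u -> z != 0 -> 0 < u z ->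
  1 + z != 0 /\ u (1 + z) = 0.
Proof.
move=> hu z0 uz; rewrite -[in RHS](nval1 hu).
apply: (@nval_add_lt _ _ hu _ _ 1); rewrite ?oner_neq0 ?(nval1 hu) //.
by right; lia.
Qed.

(* Artin-Whaples: the two cases of the induction are their [z^r a] and
   [a z^r / (1 + z^r)]. *)
Lemma val_separate_family u (w : nat -> K -> int) (P : pred nat) g :
  normalized_valuation u ->
  (forall i, (i < g)%N -> P i -> normalized_valuation (w i) /\ w i <> u) ->
  exists z, [/\ z != 0, u z < 0 & forall i, (i < g)%N -> P i -> 0 < w i z].
Proof.
move=> hu; elim: g => [|g IH] hw.
  by have [z z0 uz] := nval_onto hu (-1); exists z; split=> //; rewrite uz.
have [z [z0 uz wz]] := IH (fun i ig => hw i (ltnW ig)).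
have [Pg|nPg] := boolP (P g); last first.
  exists z; split=> // i; rewrite ltnS leq_eqVlt => /orP[/eqP->|]; last exact: wz.
  by rewrite (negPf nPg).
have [hwg neg] := hw g (ltnSn g) Pg.
have [a [a0 ua wa]] := val_separate hu hwg neg.
have [B HB] := bounded_below (fun i => `|w i a|%N) g.
have zB : z ^+ B.+1 != 0 by rewrite expf_neq0.
have big i : (i < g)%N -> P i -> 0 < w i (z ^+ B.+1) + w i a /\ 0 < w i (z ^+ B.+1).
  move=> ig Pi; have [hwi _] := hw i (ltnW ig) Pi.
  have := HB i ig; have := wz i ig Pi; rewrite (nvalX hwi) -mulr_natr.
  by move: (w i z) (w i a) => c d; nia.
have uzB : u (z ^+ B.+1) < 0.
  by rewrite (nvalX hu) -mulr_natr; move: uz; move: (u z) => c; nia.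
have [wgz|wgz] := leP 0 (w g z).
  exists (z ^+ B.+1 * a); split; first by rewrite mulf_neq0.
    by rewrite (nvalM hu) //; lia.
  move=> i; rewrite ltnS leq_eqVlt => /orP[/eqP-> _|ig Pi].
    rewrite (nvalM hwg) // (nvalX hwg) -mulr_natr.
    by move: wgz wa; move: (w g z) (w g a) => c d; nia.
  by have [hwi _] := hw i (ltnW ig) Pi; rewrite (nvalM hwi) //; case: (big i ig Pi).
have wgzB : w g (z ^+ B.+1) < 0.
  by rewrite (nvalX hwg) -mulr_natr; move: wgz; move: (w g z) => c; nia.
have [z10 uz1] := nval_add1 hu zB uzB.
have zz0 : z ^+ B.+1 / (1 + z ^+ B.+1) != 0 by rewrite mulf_neq0 ?invr_eq0.
exists (a * (z ^+ B.+1 / (1 + z ^+ B.+1))); split; first by rewrite mulf_neq0.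
  by rewrite (nvalM hu) // (nvalM hu) ?invr_eq0 // (nvalV hu) uz1 subrr addr0.
move=> i; rewrite ltnS leq_eqVlt => /orP[/eqP-> _|ig Pi].
  have [_ e] := nval_add1 hwg zB wgzB.
  by rewrite (nvalM hwg) // (nvalM hwg) ?invr_eq0 // (nvalV hwg) e subrr addr0.
have [hwi _] := hw i (ltnW ig) Pi.
have [b1 b2] := big i ig Pi.
have [_ e] := nval_add1' hwi zB b2.
by rewrite (nvalM hwi) // (nvalM hwi) ?invr_eq0 // (nvalV hwi) e subr0 addrC.
Qed.

(** With [z] having a pole at [w i] and zeros at the other places, [z ^+ r / (1 + z ^+ r)] is close
    to 1 at [w i] and to 0 elsewhere; the answer combines the [x i] with these coefficients. The
    precision [r] exceeds [N] by more than the bound [B] on the poles of the [x i]. *)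
Theorem weak_approximation (w : nat -> K -> int) g (x : nat -> K) (N : nat) :
  (forall i, (i < g)%N -> normalized_valuation (w i)) ->
  (forall i j, (i < g)%N -> (j < g)%N -> i != j -> w i <> w j) ->
  exists y, forall i, (i < g)%N -> val_ge (w i) N%:Z (y - x i).
Proof.
move=> hw dw.
have [B HB] : exists B : nat, forall i j, (i < g)%N -> (j < g)%N ->
    val_ge (w j) (- B%:Z) (x i).
  have Hi i := bounded_below (fun j => `|w j (x i)|%N) g.
  pose f i := projT1 (cid (Hi i)).
  have [B HB] := bounded_below f g; exists B => i j ig jg; right.
  have := HB i ig; have := projT2 (cid (Hi i)) j jg.
  by rewrite -/(f i); lia.
pose r := (N + B).+1.
have He i : exists e, (i < g)%N -> val_ge (w i) r%:Z (e - 1) /\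
    forall j, (j < g)%N -> j != i -> val_ge (w j) r%:Z e.
  have [ig|_] := boolP (i < g)%N; last by exists 0.
  have [|z [z0 uz wz]] := @val_separate_family (w i) w (fun j => j != i) g (hw i ig).
    by move=> j jg ji; split; [exact: hw | exact: dw].
  have zr : z ^+ r != 0 by rewrite expf_neq0.
  have hwi := hw i ig.
  have uzr : w i (z ^+ r) <= - r%:Z.
    by rewrite (nvalX hwi) -mulr_natr; move: uz; move: (w i z) => c; nia.
  have uzr0 : w i (z ^+ r) < 0 by lia.
  have [z10 uz1] := nval_add1 hwi zr uzr0.
  exists (z ^+ r / (1 + z ^+ r)) => _; split.
    have -> : z ^+ r / (1 + z ^+ r) - 1 = - (1 + z ^+ r)^-1 by field.
    by right; rewrite (nvalN hwi) (nvalV hwi) uz1; lia.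
  move=> j jg ji; have hwj := hw j jg.
  have wzr : r%:Z <= w j (z ^+ r).
    by rewrite (nvalX hwj) -mulr_natr; move: (wz j jg ji); move: (w j z) => c; nia.
  have wzr0 : 0 < w j (z ^+ r) by lia.
  have [_ e] := nval_add1' hwj zr wzr0.
  by right; rewrite (nvalM hwj) ?invr_eq0 // (nvalV hwj) e subr0.
have [e eP] := choice He.
exists (\sum_(i < g) x i * e i) => j jg.
have hwj := hw j jg.
rewrite (bigD1 (Ordinal jg)) //=.
have -> : forall s, x j * e j + s - x j = x j * (e j - 1) + s.
  by move=> s; rewrite mulrBr mulr1 addrAC.
apply: (val_geD hwj).
  have [e1 _] := eP j jg.
  by apply: val_ge_le (val_geM hwj (HB j j jg jg) e1); rewrite /r; lia.
apply: (val_ge_sum hwj) => i ij.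
have [_ /(_ j jg)] := eP i (ltn_ord i).
rewrite eq_sym => /(_ ij) e1.
by apply: val_ge_le (val_geM hwj (HB i j (ltn_ord i) jg) e1); rewrite /r; lia.
Qed.

End WeakApproximation.

(** * Lower bounds on cardinalities and the pigeonhole principle *)

Definition atleast (T : eqType) (N : nat) (P : set T) : Prop :=
  exists s : seq T, [/\ uniq s, (N <= size s)%N & forall x, x \in s -> P x].

Section AtLeast.
Variables T T' : eqType.

Lemma atleast_le M N (P : set T) : (M <= N)%N -> atleast N P -> atleast M P.
Proof. by move=> MN [s [us Ns sP]]; exists s; split=> //; apply: leq_trans Ns. Qed.

Lemma atleast_sub N (P Q : set T) : P `<=` Q -> atleast N P -> atleast N Q.
Proof. by move=> PQ [s [us Ns sP]]; exists s; split=> // x /sP/PQ. Qed.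

Lemma atleast_fin (X : finType) (f : X -> T) (P : set T) :
  injective f -> (forall x, P (f x)) -> atleast #|X| P.
Proof.
move=> fi fP; exists [seq f x | x <- enum X]; split.
- by rewrite map_inj_uniq // enum_uniq.
- by rewrite size_map -cardE.
- by move=> _ /mapP[x _ ->].
Qed.

Lemma atleast_image N (P : set T) (Q : set T') (f : T -> T') :
  (forall x y, P x -> P y -> f x = f y -> x = y) ->
  (forall x, P x -> Q (f x)) -> atleast N P -> atleast N Q.
Proof.
move=> fi fQ [s [us Ns sP]]; exists [seq f x | x <- s]; split.
- by rewrite map_inj_in_uniq // => x y /sP px /sP py; apply: fi.
- by rewrite size_map.
- by move=> _ /mapP[x /sP px ->]; apply: fQ.
Qed.

Lemma atleast_pigeonhole (X : finType) (f : T -> X) M N (P : set T) :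
  (#|X| <= M)%N -> (0 < N)%N -> (0 < M)%N -> atleast (M * N) P ->
  exists y, atleast N [set x | P x /\ f x = y].
Proof.
move=> XM N0 M0 [s [us Ns sP]]; apply: contrapT => H.
have small y : (count (fun x => f x == y) s < N)%N.
  rewrite ltnNge; apply/negP => c; apply: H; exists y.
  exists [seq x <- s | f x == y]; rewrite filter_uniq // size_filter; split=> //.
  by move=> x; rewrite mem_filter => /andP[/eqP fx /sP].
have sE : size s = (\sum_(y : X) count (fun x => f x == y) s)%N.
  under eq_bigr do rewrite -sum1_count.
  rewrite (exchange_big_dep predT) //= -sum1_size; apply: eq_bigr => x _.
  by rewrite sum1_card (eq_card (B := pred1 (f x))) ?card1 // => y; rewrite !inE eq_sym.
have le : (size s <= \sum_(y : X) N.-1)%N.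
  by rewrite sE; apply: leq_sum => y _; have := small y; case: (N).
rewrite sum_nat_const in le.
by move: le Ns XM M0 N0; move: (size s) #|X| => a c; case: (N) => //= n; nia.
Qed.

Lemma atleast_collision (X : finType) (f : T -> X) N (P : set T) :
  (#|X| < N)%N -> atleast N P -> exists x y, [/\ P x, P y, x != y & f x = f y].
Proof.
move=> XN [s [us Ns sP]]; apply: contrapT => H.
have fi : {in s &, injective f}.
  move=> x y xs ys fxy; apply/eqP; apply: contraT => xy.
  by exfalso; apply: H; exists x, y; split=> //; apply: sP.
have := max_card [in [seq f x | x <- s]].
rewrite (card_uniqP _) ?map_inj_in_uniq // size_map.
by move: (leq_trans XN Ns); rewrite ltnNge => /negP.
Qed.

End AtLeast.

(** Subtracting one member of a fibre with [N] elements from all of them: Minkowski's argument with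
    counting in place of volume. *)
Lemma atleast_pigeonhole_sub (V : zmodType) (X : finType) (f : V -> X) M N
    (P Q : set V) : (#|X| <= M)%N -> (0 < N)%N -> (0 < M)%N ->
  (forall x y, P x -> P y -> f x = f y -> Q (x - y)) ->
  atleast (M * N) P -> atleast N Q.
Proof.
move=> XM N0 M0 PQ /(atleast_pigeonhole f XM N0 M0)[y aN].
have [[|x0 s] [us Ns sP]] := aN; first by move: Ns; rewrite leqn0; case: (N) N0.
have [Px0 fx0] := sP x0 (mem_head _ _).
apply: atleast_image aN => [x x' _ _|x [Px fx]]; last by apply: (PQ x x0); rewrite ?fx.
exact: (@addIr V (- x0)).
Qed.

(** * Residue systems and digit expansions *)

Definition residue_family (F : fieldType) (u : F -> int) (Q : nat) (rho : 'I_Q -> F) : Prop :=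
  (forall d, val_ge u 0 (rho d)) /\ (forall d d', val_ge u 1 (rho d - rho d') -> d = d').

(** Completeness is kept apart from incongruence: incongruent families bound a residue field from
    below before it is known to be finite. *)
Definition residue_system (F : fieldType) (u : F -> int) (Q : nat) (rho : 'I_Q -> F) : Prop :=
  residue_family u rho /\ (forall x, val_ge u 0 x -> exists d, val_ge u 1 (x - rho d)).

Section Digits.
Variables (F : fieldType) (u : F -> int).
Hypothesis hu : normalized_valuation u.
Variables (Q : nat) (rho : 'I_Q -> F) (p : F).
Hypotheses (p0 : p != 0) (up : u p = 1).

Definition expansion n (f : 'I_n -> 'I_Q) : F := \sum_(i < n) rho (f i) * p ^+ i.

Lemma val_ge_pX i : val_ge u i%:Z (p ^+ i).
Proof. by right; rewrite (nvalX hu) up; lia. Qed.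

Lemma val_ge_pXz i : val_ge u i (p ^ i).
Proof. by right; rewrite (nvalXz hu) up mul1r. Qed.

Lemma val_ge_mul_pXz N i x : val_ge u N (x * p ^ i) -> val_ge u (N - i) x.
Proof.
move=> h; have -> : x = x * p ^ i * p ^ (- i).
  by rewrite -mulrA -expfzDr // subrr mulr1.
exact: (val_geM hu h (val_ge_pXz _)).
Qed.

Lemma expansion_ge0 n (f : 'I_n -> 'I_Q) : (forall d, val_ge u 0 (rho d)) ->
  val_ge u 0 (expansion f).
Proof.
move=> r0; apply: (val_ge_sum hu) => i _; rewrite -[0]addr0; apply: (val_geM hu) => //.
by apply: val_ge_le (val_ge_pX i).
Qed.

Lemma expansion_inj n (f g : 'I_n -> 'I_Q) : residue_family u rho ->
  val_ge u n%:Z (expansion f - expansion g) -> f =1 g.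
Proof.
move=> [r0 r1] fg.
suff H m (i : 'I_n) : (i < m)%N -> f i = g i by move=> i; exact: (H i.+1).
elim: m i => // m IH i im; apply: r1.
have {}IH (l : 'I_n) : (l < i)%N -> f l = g l by move=> li; apply: IH; apply: leq_trans li _.
rewrite -[1]/(1%:Z) (_ : 1%:Z = i.+1%:Z - i%:Z); last by lia.
apply: val_ge_mul_pXz; rewrite -exprnP mulrBl.
have -> : rho (f i) * p ^+ i - rho (g i) * p ^+ i = expansion f - expansion g
   - \sum_(l < n | l != i) (rho (f l) - rho (g l)) * p ^+ l.
  rewrite /expansion (bigD1 i) //= [\sum_(l < n) rho (g l) * _](bigD1 i) //=.
  under [X in _ - _ - X]eq_bigr do rewrite mulrBl.
  by rewrite sumrB; ring.
apply: (val_geB hu); first by apply: val_ge_le fg; have := ltn_ord i; lia.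
apply: (val_ge_sum hu) => l li.
have [il|] := ltnP i l.
  rewrite -[_%:Z]add0r; apply: (val_geM hu); first exact: (val_geB hu).
  by apply: val_ge_le (val_ge_pX l); lia.
rewrite leq_eqVlt => /orP[/eqP/val_inj E|/IH ->]; first by rewrite E eqxx in li.
by rewrite subrr mul0r; left.
Qed.

Lemma expansion_approx n x : residue_system u rho -> val_ge u 0 x ->
  exists f : 'I_n -> 'I_Q, val_ge u n%:Z (x - expansion f).
Proof.
move=> [[r0 r1] r2] x0; elim: n => [|n [f fx]].
  have [d _] := r2 0 (val_ge0 u 0).
  by exists (fun=> d); rewrite /expansion big_ord0 subr0.
have [d dx] : exists d, val_ge u 1 ((x - expansion f) * p ^ (- n%:Z) - rho d).
  by apply: r2; have := val_geM hu fx (val_ge_pXz (- n%:Z)); rewrite subrr.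
exists (fun i => if unlift ord_max i is Some i' then f i' else d).
rewrite /expansion big_ord_recr /= unlift_none.
have -> : \sum_(i < n) rho (if unlift ord_max (widen_ord (leqnSn n) i) is Some i' then f i' else d)
    * p ^+ i = expansion f.
  by apply: eq_bigr => i _; rewrite widen_ord_lift liftK.
have := val_geM hu dx (val_ge_pX n).
rewrite mulrBl -mulrA [p ^+ n]exprnP -expfzDr // addNr mulr1 -exprnP opprD addrA.
by rewrite (_ : 1 + n%:Z = n.+1%:Z); last by lia.
Qed.

(** The class is coded by the first [n] digits of [x * p ^ (- a)]; outside [val_ge u a] the code is
    arbitrary. *)
Lemma class_map (a : int) n : residue_system u rho ->
  exists f : F -> {ffun 'I_n -> 'I_Q}, forall x y, val_ge u a x -> val_ge u a y ->
    f x = f y -> val_ge u (a + n%:Z) (x - y).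
Proof.
move=> hr.
have H x : exists f : {ffun 'I_n -> 'I_Q}, val_ge u a x ->
    val_ge u (a + n%:Z) (x - expansion f * p ^ a).
  have [ax|nax] := pselect (val_ge u a x); last first.
    have [f _] := expansion_approx n hr (val_ge0 u 0).
    by exists [ffun i => f i] => /nax.
  have x0 : val_ge u 0 (x * p ^ (- a)) by have := val_geM hu ax (val_ge_pXz (- a)); rewrite subrr.
  have [f fx] := expansion_approx n hr x0; exists [ffun i => f i] => _.
  have -> : expansion [ffun i => f i] = expansion f by apply: eq_bigr => i _; rewrite ffunE.
  have := val_geM hu fx (val_ge_pXz a).
  by rewrite mulrBl -mulrA -expfzDr // addNr mulr1 addrC.
have [f fP] := choice H; exists f => x y ax ay fxy.
apply: (val_ge_trans hu (fP x ax)); rewrite fxy.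
exact/(val_geBC hu)/fP.
Qed.

End Digits.

Lemma residue_system_gt1 (F : fieldType) (u : F -> int) (Q : nat) (rho : 'I_Q -> F) :
  normalized_valuation u -> residue_system u rho -> (1 < Q)%N.
Proof.
move=> hu [_ r2]; rewrite ltnNge; apply/negP => Q1.
have [d hd] := r2 0 (val_ge0 u 0); have [d' hd'] := r2 1 (val_ge1 hu).
have dd : d = d'.
  by apply: val_inj; have := ltn_ord d; have := ltn_ord d'; move=> /=; lia.
rewrite -dd in hd'; have := val_geB hu hd' hd.
rewrite opprB addrA subrK subr0 => /(val_ge_nz _ _ (oner_neq0 F)).
by rewrite (nval1 hu).
Qed.

(** * Function fields: spaces of bounded degree, poles, Riemann's inequality *)

Definition spanning (k : finFieldType) (K : fieldType) (iota : {rmorphism k -> K})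
    (t : K) (e : nat) (b : 'I_e -> K) : Prop :=
  forall x : K, exists (d : {poly k}) (c : 'I_e -> {poly k}),
    d != 0 /\ (map_poly iota d).[t] * x = \sum_(i < e) (map_poly iota (c i)).[t] * b i.

Section FunctionField.
Variables (k : finFieldType) (K : fieldType) (iota : {rmorphism k -> K}) (t : K).
Hypothesis t_transc : ~ algebraicOver iota t.
Variables (e : nat) (b : 'I_e -> K).
Hypothesis b_span : spanning iota t b.

Local Notation ev p := (map_poly iota p).[t].

Lemma evM p q : ev (p * q) = ev p * ev q.
Proof. by rewrite rmorphM hornerM. Qed.

Lemma evD p q : ev (p + q) = ev p + ev q.
Proof. by rewrite rmorphD hornerD. Qed.

Lemma evB p q : ev (p - q) = ev p - ev q.
Proof. by rewrite rmorphB hornerD hornerN. Qed.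

Lemma ev0 : ev 0 = 0. Proof. by rewrite rmorph0 horner0. Qed.

Lemma evC a : ev a%:P = iota a. Proof. by rewrite map_polyC hornerC. Qed.

Lemma evX s : ev ('X^s) = t ^+ s. Proof. by rewrite map_polyXn hornerXn. Qed.

Lemma ev_neq0 p : p != 0 -> ev p != 0.
Proof. by move=> p0; apply/eqP => ep; apply: t_transc; exists p => //; apply/rootP. Qed.

(** The finite pieces of [K] in which everything is counted. The [b i] span but need not be free, so
    only an upper bound on the cardinality is immediate. *)
Definition bounded_comb (D : nat) : set K :=
  [set x | exists c : 'I_e -> {poly k},
     (forall i, size (c i) <= D)%N /\ x = \sum_(i < e) ev (c i) * b i].

Lemma bounded_comb_le C D x : (C <= D)%N -> bounded_comb C x -> bounded_comb D x.
Proof. by move=> CD [c [sc ->]]; exists c; split=> // i; apply: leq_trans CD. Qed.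

Lemma bounded_comb0 D : bounded_comb D 0.
Proof.
exists (fun=> 0); split; first by move=> i; rewrite size_poly0.
by rewrite big1 // => i _; rewrite ev0 mul0r.
Qed.

Lemma bounded_combD D x y : bounded_comb D x -> bounded_comb D y -> bounded_comb D (x + y).
Proof.
move=> [c [sc ->]] [c' [sc' ->]]; exists (fun i => c i + c' i); split.
  by move=> i; apply: leq_trans (size_polyD _ _) _; rewrite geq_max sc sc'.
by rewrite -big_split; apply: eq_bigr => i _; rewrite evD mulrDl.
Qed.

Lemma bounded_comb_sum (I : Type) (s : seq I) (P : pred I) (f : I -> K) D :
  (forall i, P i -> bounded_comb D (f i)) -> bounded_comb D (\sum_(i <- s | P i) f i).
Proof. by move=> fN; elim/big_ind: _ => [|x y|//]; [exact: bounded_comb0 | exact: bounded_combD]. Qed.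

Lemma bounded_combZ D C (p : {poly k}) x : (size p <= C)%N -> bounded_comb D x -> bounded_comb (C + D) (ev p * x).
Proof.
move=> pC [c [sc ->]]; exists (fun i => p * c i); split.
  move=> i; have [->|p0] := eqVneq p 0; first by rewrite mul0r size_poly0.
  have [->|c0] := eqVneq (c i) 0; first by rewrite mulr0 size_poly0.
  by apply: leq_trans (size_polyMleq _ _) _; have := sc i; move: pC; lia.
by rewrite mulr_sumr; apply: eq_bigr => i _; rewrite evM mulrA.
Qed.

Lemma bounded_combX D s x : bounded_comb D x -> bounded_comb (s + D) (t ^+ s * x).
Proof.
move=> [c [sc ->]]; exists (fun i => 'X^s * c i); split.
  move=> i; have [->|c0] := eqVneq (c i) 0; first by rewrite mulr0 size_poly0.
  by rewrite mulrC size_mulXn // leq_add2l.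
by rewrite mulr_sumr; apply: eq_bigr => i _; rewrite evM evX mulrA.
Qed.

Lemma common_denominator (I : finType) (a : I -> K) :
  exists (d : {poly k}) (C : nat), d != 0 /\ forall i, bounded_comb C (ev d * a i).
Proof.
pose d i := projT1 (cid (b_span (a i))).
have dP i : exists c, d i != 0 /\ ev (d i) * a i = \sum_(l < e) ev (c l) * b l.
  exact: projT2 (cid (b_span (a i))).
have [c cP] := choice dP.
exists (\prod_i d i).
have HC : exists C, forall i, bounded_comb C (ev (\prod_i d i) * a i).
  pose C i := (size (\prod_(l | l != i) d l)%R + \max_(l < e) size (c i l))%N.
  exists (\max_i C i)%N => i.
  apply: (bounded_comb_le (C := C i)); first exact: leq_bigmax.
  rewrite (bigD1 i) //= evM mulrAC mulrC; apply: bounded_combZ => //.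
  have [_ ->] := cP i.
  by exists (c i); split=> // l; apply: (leq_bigmax l).
have [C CP] := HC; exists C; split=> //.
by apply/prodf_neq0 => i _; case: (cP i).
Qed.

Lemma mul_bounded_comb (y : K) : exists (d : {poly k}) (C : nat), d != 0 /\
  forall D x, bounded_comb D x -> bounded_comb (D + C) (ev d * y * x).
Proof.
have [d [C [d0 dC]]] := common_denominator (fun i => y * b i).
exists d, C; split=> // D x [c [sc ->]]; rewrite mulr_sumr.
apply: bounded_comb_sum => i _.
have -> : ev d * y * (ev (c i) * b i) = ev (c i) * (ev d * (y * b i)) by ring.
exact: bounded_combZ.
Qed.

Lemma bounded_comb_code D : exists f : K -> {ffun 'I_e * 'I_D -> k},
  forall x y, bounded_comb D x -> bounded_comb D y -> f x = f y -> x = y.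
Proof.
have H x : exists g : {ffun 'I_e * 'I_D -> k}, bounded_comb D x ->
    x = \sum_(i < e) ev (\poly_(l < D) (if insub l is Some l' then g (i, l') else 0)) * b i.
  have [[c [sc ->]]|nx] := pselect (bounded_comb D x); last by exists [ffun=> 0].
  exists [ffun p : 'I_e * 'I_D => (c p.1)`_(p.2)] => _; apply: eq_bigr => i _; congr (ev _ * _).
  apply/polyP => l; rewrite coef_poly; case: ltnP => lD; last by rewrite nth_default // (leq_trans _ lD).
  by rewrite insubT ffunE.
have [f fP] := choice H; exists f => x y vx vy fxy.
by rewrite (fP x vx) (fP y vy) fxy.
Qed.

Lemma bounded_comb_card N D : atleast N (bounded_comb D) -> (N <= #|k| ^ (e * D))%N.
Proof.
have [f fP] := bounded_comb_code D => aN; rewrite leqNgt; apply/negP => lt.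
have c : (#|{ffun 'I_e * 'I_D -> k}| < N)%N by rewrite card_ffun card_prod !card_ord.
have [x [y [vx vy /eqP xy fxy]]] := atleast_collision f c aN.
exact/xy/fP.
Qed.

(** Linear algebra by counting: without a relation, the [#|k| ^ #|I|] combinations times the common
    denominator [h] would be distinct elements of [bounded_comb D], which has at most
    [#|k| ^ (e * D)]. *)
Lemma bounded_comb_relation (I : finType) (a : I -> K) (h : K) D :
  h != 0 -> (forall i, bounded_comb D (h * a i)) -> (e * D < #|I|)%N ->
  exists c : {ffun I -> k}, (exists i, c i != 0) /\ \sum_i iota (c i) * a i = 0.
Proof.
move=> h0 ha lt; apply: contrapT => H.
have inj (c c' : {ffun I -> k}) :
    h * \sum_i iota (c i) * a i = h * \sum_i iota (c' i) * a i -> c = c'.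
  move/(mulfI h0) => cc; apply: contrapT => ne; apply: H; exists (c - c'); split.
    apply: contrapT => N; apply: ne; apply/ffunP => i; apply/eqP; rewrite -subr_eq0.
    apply: contraT => ci; exfalso; apply: N; exists i.
    by rewrite !ffunE.
  transitivity (\sum_i iota (c i) * a i - \sum_i iota (c' i) * a i); last by rewrite cc subrr.
  by rewrite -sumrB; apply: eq_bigr => i _; rewrite !ffunE rmorphB mulrBl.
have aN := @atleast_fin K _ (fun c : {ffun I -> k} => h * \sum_i iota (c i) * a i)
  (bounded_comb D) inj.
have {}aN : atleast #|{ffun I -> k}| (bounded_comb D).
  apply: aN => c; rewrite mulr_sumr; apply: bounded_comb_sum => i _.
  rewrite mulrCA -evC -[D]add0n.
  have [->|c0] := eqVneq (c i) 0; first by rewrite ev0 mul0r; exact: bounded_comb0.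
  have [cc [sc ->]] := ha i.
  exists (fun l => (c i)%:P * cc l); split.
    by move=> l; rewrite mul_polyC (leq_trans (size_scale_leq _ _)).
  by rewrite mulr_sumr; apply: eq_bigr => l _; rewrite evM mulrA.
have := bounded_comb_card aN; rewrite card_ffun leq_exp2l ?card_finNzRing_gt1 //.
by rewrite leqNgt lt.
Qed.

Lemma sum_coef_polys n M (z : 'I_n -> K) (x : K) (c : {ffun 'I_n * 'I_M -> k}) :
  exists p : 'I_n -> {poly k}, [/\ forall i, (size (p i) <= M)%N,
    forall i (l : 'I_M), (p i)`_l = c (i, l)
  & \sum_i (map_poly iota (p i)).[x] * z i = \sum_i iota (c i) * (x ^+ i.2 * z i.1)].
Proof.
exists (fun i => \poly_(l < M) (if insub l is Some l' then c (i, l') else 0)); split.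
- by move=> i; apply: size_poly.
- by move=> i l; rewrite coef_poly ltn_ord valK.
rewrite (eq_bigr (fun i : 'I_n * 'I_M => iota (c (i.1, i.2)) * (x ^+ i.2 * z i.1))); last by case.
rewrite -(pair_bigA _ (fun i l => iota (c (i, l)) * (x ^+ l * z i))) /=.
apply: eq_bigr => i _; rewrite (horner_coef_wide _ (_ : (_ <= M)%N)); last first.
  by apply: leq_trans (size_poly _ _) (size_poly _ _).
by rewrite mulr_suml; apply: eq_bigr => l _; rewrite coef_map coef_poly ltn_ord valK mulrA.
Qed.

(** One denominator serves all powers up to [M], and the degree bound grows only linearly in [M];
    families of monomials that outgrow [e] times this bound must satisfy a relation. *)
Lemma pow_bounded_comb (y : K) : exists (d : {poly k}) (C : nat), d != 0 /\
  forall D M s x, (s <= M)%N -> bounded_comb D x ->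
    bounded_comb (D + C * M) (ev d ^+ M * (y ^+ s * x)).
Proof.
have [d [C [d0 dC]]] := mul_bounded_comb y.
exists d, (C + size d)%N; split=> // D M s x sM vx.
have pow_y r : bounded_comb (D + C * r) ((ev d * y) ^+ r * x).
  elim: r => [|r IH]; first by rewrite expr0 mul1r muln0 addn0.
  by rewrite exprS -mulrA; apply: bounded_comb_le (dC _ _ IH); lia.
have pow_d r D' z : bounded_comb D' z -> bounded_comb (D' + size d * r) (ev d ^+ r * z).
  move=> vz; elim: r => [|r IH]; first by rewrite expr0 mul1r muln0 addn0.
  by rewrite exprS -mulrA; apply: bounded_comb_le (bounded_combZ (leqnn _) IH); lia.
have -> : ev d ^+ M * (y ^+ s * x) = ev d ^+ (M - s) * ((ev d * y) ^+ s * x).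
  by rewrite exprMn -{1}(subnK sM) exprD; ring.
apply: bounded_comb_le (pow_d _ _ _ (pow_y s)).
by have : (M - s <= M)%N := leq_subr _ _; move: (M - s)%N => r; nia.
Qed.

Lemma expf_ev_neq0 (d : {poly k}) M : d != 0 -> ev d ^+ M != 0.
Proof. by move=> d0; rewrite expf_neq0 // ev_neq0. Qed.

Lemma nval_const (w : K -> int) a : normalized_valuation w -> w (iota a) = 0.
Proof.
move=> hw; have := congr1 (fun c => w (iota c)) (finfield.expf_card a).
rewrite rmorphXn (nvalX hw) -mulr_natr; have := card_finNzRing_gt1 k.
by move: #|k| (w (iota a)) => q c; nia.
Qed.

Lemma val_ge_const (w : K -> int) a : normalized_valuation w -> val_ge w 0 (iota a).
Proof. by move=> hw; right; rewrite nval_const. Qed.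

(** The Riemann-Roch space of [D] times the divisor of poles of [t], read place by place. *)
Definition pole_bounded (D : nat) (x : K) : Prop :=
  forall w : K -> int, normalized_valuation w ->
    (0 <= w t -> val_ge w 0 x) /\ (w t < 0 -> val_ge w (D%:Z * w t) x).

Lemma pole_bounded_ev (p : {poly k}) D : (size p <= D.+1)%N -> pole_bounded D (ev p).
Proof.
move=> sp w hw.
have -> : ev p = \sum_(l < D.+1) iota p`_l * t ^+ l.
  rewrite (horner_coef_wide _ (_ : (_ <= D.+1)%N)) ?(leq_trans (size_poly _ _)) //.
  by apply: eq_bigr => l _; rewrite coef_map.
split=> wt; apply: (val_ge_sum hw) => l _.
  rewrite -[0]addr0; apply: (val_geM hw); first exact: val_ge_const.
  by apply: (val_geX hw); right.
rewrite -[_ * w t]add0r; apply: (val_geM hw); first exact: val_ge_const.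
right; rewrite (nvalX hw) -mulr_natr; have := ltn_ord l.
by move: (nat_of_ord l) (w t) wt => l' c; nia.
Qed.

Lemma pole_boundedD D x y : pole_bounded D x -> pole_bounded D y -> pole_bounded D (x + y).
Proof.
move=> hx hy w hw; have [x1 x2] := hx w hw; have [y1 y2] := hy w hw.
by split=> wt; apply: (val_geD hw); auto.
Qed.

Lemma pole_boundedM C D x y :
  pole_bounded C x -> pole_bounded D y -> pole_bounded (C + D) (x * y).
Proof.
move=> hx hy w hw; have [x1 x2] := hx w hw; have [y1 y2] := hy w hw.
split=> wt; first by rewrite -[0]addr0; apply: (val_geM hw); auto.
by rewrite PoszD mulrDl; apply: (val_geM hw); auto.
Qed.

Lemma pole_bounded_le C D x : (C <= D)%N -> pole_bounded C x -> pole_bounded D x.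
Proof.
move=> CD hx w hw; have [x1 x2] := hx w hw; split=> // wt.
by apply: val_ge_le (x2 wt); move: (w t) wt => c; nia.
Qed.

Lemma pole_bounded_sum (I : Type) (s : seq I) (P : pred I) (f : I -> K) D :
  (forall i, P i -> pole_bounded D (f i)) -> pole_bounded D (\sum_(i <- s | P i) f i).
Proof.
move=> fN; elim/big_ind: _ => [|x y|//]; last exact: pole_boundedD.
by move=> w hw; split=> _; exact: val_ge0.
Qed.

Lemma algebraic_relation (x : K) : exists (M D : nat) (p : nat -> {poly k}),
  [/\ forall s, (size (p s) <= D)%N, exists2 s, (s < M)%N & p s != 0
    & \sum_(s < M) ev (p s) * x ^+ s = 0].
Proof.
have [d0 [C1 [d00 /(_ tt) v1]]] := common_denominator (fun _ : unit => 1).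
have [d [C [dn0 dC]]] := pow_bounded_comb x.
(* The [M * D] monomials face the bound [e * (D + C1 + C * M)]; for [M = e.+1] the excess is
   [D - e * (C1 + C * M)]. *)
pose M := e.+1; pose D := (e * (C1 + C * M)).+1.
have := @bounded_comb_relation ('I_M * 'I_D)%type (fun i => t ^+ i.2 * x ^+ i.1)
  (ev d0 * ev d ^+ M) (D + (C1 + C * M))%N.
case=> [||| c [[i0 ci0] rel]].
- by rewrite mulf_neq0 ?ev_neq0 ?expf_ev_neq0.
- move=> i; rewrite mulr1 in v1.
  have := dC _ M i.1 _ (ltnW (ltn_ord i.1)) v1.
  move=> /(bounded_combX i.2).
  have -> : t ^+ i.2 * (ev d ^+ M * (x ^+ i.1 * ev d0)) = ev d0 * ev d ^+ M * (t ^+ i.2 * x ^+ i.1) by ring.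
  by apply: bounded_comb_le; rewrite leq_add2r ltnW.
- by rewrite card_prod !card_ord /M /D; nia.
have [p [sp pc pE]] := sum_coef_polys (fun s : 'I_M => x ^+ s) t c.
exists M, D, (fun s => if insub s is Some s' then p s' else 0); split.
- by move=> s; case: insubP => [s' _ _|_]; rewrite ?size_poly0.
- exists i0.1; rewrite ?valK //; apply: contraNneq ci0 => p0.
  by rewrite [i0]surjective_pairing -pc p0 coef0.
by rewrite -[RHS]rel -pE; apply: eq_bigr => s _; rewrite valK.
Qed.

(** Multiplying an algebraic relation by a power of its leading coefficient [P] makes [ev P * x] a
    root of a monic polynomial over [k[t]], whose coefficients bound its poles. *)
Lemma integral_multiple (x : K) : exists (P : {poly k}) (C : nat),
  P != 0 /\ pole_bounded C (ev P * x).
Proof.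
have [M [D [p [sp [s0 s0M ps0] rel]]]] := algebraic_relation x.
have [] := @ex_maxnP (fun s => (s < M)%N && (p s != 0)) M.
- by exists s0; rewrite s0M.
- by move=> s /andP[/ltnW].
move=> N /andP[NM pN0] Nmax.
have {}rel : \sum_(s < N.+1) ev (p s) * x ^+ s = 0.
  have tail : \sum_(N.+1 <= s < M) ev (p s) * x ^+ s = 0.
    rewrite big_nat_cond big1 // => s /andP[/andP[Ns sM] _].
    suff -> : p s = 0 by rewrite rmorph0 horner0 mul0r.
    by apply/eqP; apply: contraTT Ns => ps; rewrite -leqNgt Nmax // sM ps.
  move: rel; rewrite -!(big_mkord xpredT (fun s => ev (p s) * x ^+ s)).
  by rewrite (big_cat_nat (leq0n _) NM) /= tail addr0.
case: N => [|N] in NM pN0 Nmax rel *.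
  by move: rel; rewrite big_ord1 expr0 mulr1 => /eqP; rewrite (negPf (ev_neq0 pN0)).
set P := p N.+1; set y := ev P * x.
pose C := (D * M)%N.
have {}rel : y ^+ N.+1 = - \sum_(s < N.+1) ev (p s * P ^+ (N - s)) * y ^+ s.
  apply/eqP; rewrite -addr_eq0 addrC; apply/eqP.
  transitivity (ev P ^+ N * \sum_(s < N.+2) ev (p s) * x ^+ s); last by rewrite rel mulr0.
  rewrite [in RHS]big_ord_recr /= mulrDr mulr_sumr; congr (_ + _).
    apply: eq_bigr => s _; rewrite evM rmorphXn /= horner_exp /y exprMn.
    have sN : (s <= N)%N by rewrite -ltnS.
    have -> : ev P ^+ N = ev P ^+ (N - s) * ev P ^+ s by rewrite -exprD subnK.
    by ring.
  by rewrite /y exprMn exprS; ring.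
have qb s : (s < N.+1)%N -> pole_bounded C (ev (p s * P ^+ (N - s))).
  move=> sN; apply: pole_bounded_ev.
  apply: leq_trans (size_polyMleq _ _) _.
  have arith (a a' a'' r : nat) : (a <= D -> a' <= D -> a'' <= (a'.-1 * r).+1 -> r <= N ->
      (a + a'').-1 <= (D * M).+1)%N by nia.
  exact: arith (sp s) (sp N.+1) (size_poly_exp_leq _ _) (leq_subr _ _).
exists P, C; split=> // w hw.
(* If [w y] were below [beta], every term on the right of the monic relation would have a smaller
   pole than [y ^+ N.+1]. *)
have key beta : beta <= 0 ->
    (forall s, (s < N.+1)%N -> val_ge w beta (ev (p s * P ^+ (N - s)))) -> val_ge w beta y.
  move=> b0 hb; apply: contrapT => /val_geNP[y0 wy].
  have : val_ge w (w (y ^+ N.+1) + 1) (y ^+ N.+1).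
    rewrite {2}rel; apply/(val_geN hw); apply: (val_ge_sum hw) => s _.
    have ys : val_ge w (w y *+ s) (y ^+ s) by right; rewrite (nvalX hw).
    apply: val_ge_le (val_geM hw (hb s (ltn_ord s)) ys).
    rewrite (nvalX hw) !pmulrn !mulrzz; have := ltn_ord s.
    move: (nat_of_ord s) (w y) wy b0 => s' c wy b0 sN.
    have : c * N.+1%:Z <= c * s'.+1%:Z by rewrite ler_nM2l; lia.
    by move=> h; have : c * s'.+1%:Z = c * s'%:Z + c; [rewrite -addn1 PoszD mulrDr mulr1 | lia].
  by move=> /(val_ge_nz _ _)-/(_ (expf_neq0 _ y0)); lia.
split=> wt; apply: key => //.
- by move=> s sN; have [] := qb s sN w hw; auto.
- by move: (w t) wt => c; nia.
- by move=> s sN; have [] := qb s sN w hw; auto.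
Qed.

Lemma bounded_comb_pole_bounded : exists (P : {poly k}) (C : nat), P != 0 /\
  forall D x, bounded_comb D x -> pole_bounded (D + C) (ev P * x).
Proof.
have [P HP] := choice (fun i => integral_multiple (b i)).
have [C PC] := choice HP.
pose Q i := \prod_(l | l != i) P l.
exists (\prod_i P i), (\max_i (size (Q i) + C i))%N; split.
  by apply/prodf_neq0 => i _; case: (PC i).
move=> D x [c [sc ->]]; rewrite mulr_sumr; apply: pole_bounded_sum => i _.
have [P0 bi] := PC i.
have -> : ev (\prod_i P i) * (ev (c i) * b i) = ev (c i) * (ev (Q i) * (ev (P i) * b i)).
  by rewrite (bigD1 i) //= evM -/(Q i); ring.
apply: (pole_bounded_le (C := D + (size (Q i) + C i))).
  by rewrite leq_add2l; apply: (leq_bigmax (F := fun i => (size (Q i) + C i)%N)).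
apply: pole_boundedM; first by apply/pole_bounded_ev/leqW.
by apply: pole_boundedM => //; apply/pole_bounded_ev.
Qed.

Lemma residue_tuples (w : nat -> K -> int) g (M n : nat -> nat) (rho : forall i, 'I_(M i) -> K) :
  (forall i, (i < g)%N -> normalized_valuation (w i) /\ residue_family (w i) (rho i)) ->
  exists (X : finType) (tau : X -> nat -> K),
  [/\ #|X| = (\prod_(i < g) M i ^ n i)%N,
      forall x i, (i < g)%N -> val_ge (w i) 0 (tau x i)
    & forall x x', (forall i, (i < g)%N -> val_ge (w i) (n i)%:Z (tau x i - tau x' i)) -> x = x'].
Proof.
elim: g => [|g IH] H.
  by exists unit, (fun _ _ => 0); split=> [|//|[] []//]; rewrite big_ord0 card_unit.
have [X [tau [cX tau0 tauI]]] := IH (fun i ig => H i (ltnW ig)).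
have [hw [r0 r1]] := H g (ltnSn g).
have [p p0 wp] := nval_unif hw.
exists (X * {ffun 'I_(n g) -> 'I_(M g)})%type,
  (fun (x : X * {ffun 'I_(n g) -> 'I_(M g)}) (i : nat) =>
     if i == g then expansion (rho g) p (fun l => x.2 l) else tau x.1 i); split.
- by rewrite card_prod cX card_ffun !card_ord big_ord_recr.
- move=> x i; rewrite ltnS leq_eqVlt; case: eqP => [-> _|_ /= ig]; last exact: tau0.
  exact: expansion_ge0.
- move=> [x f] [x' f'] xx'; congr (_, _).
    apply: tauI => i ig; have := xx' i (ltnW ig).
    by rewrite /=; case: eqP => // E; rewrite E ltnn in ig.
  apply/ffunP; apply: (expansion_inj hw p0 wp (conj r0 r1)).
  by have := xx' g (ltnSn g); rewrite /= eqxx.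
Qed.

(* With [Y] representing all residue classes modulo [1 / t] at the given poles,
   the sums of [y_s t ^ s] over [s < D] are pairwise distinct. *)
Lemma pole_counting (w : nat -> K -> int) g (M : nat -> nat) (rho : forall i, 'I_(M i) -> K) :
  (forall i, (i < g)%N -> [/\ normalized_valuation (w i), residue_family (w i) (rho i) & w i t < 0]) ->
  (forall i j, (i < g)%N -> (j < g)%N -> i != j -> w i <> w j) ->
  exists C, forall D,
    atleast ((\prod_(i < g) M i ^ `|w i t|) ^ D)%N (bounded_comb (D + C)).
Proof.
move=> hw dw.
have [X [tau [cX tau0 tauI]]] := @residue_tuples w g M (fun i => `|w i t|%N) rho
  (fun i ig => let: And3 h1 h2 _ := hw i ig in conj h1 h2).
have [B HB] := bounded_below (fun i => `|w i t|%N) g.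
have Hy x : exists y, forall i, (i < g)%N -> val_ge (w i) B%:Z (y - tau x i).
  by apply: weak_approximation => // i ig; case: (hw i ig).
have [y yP] := choice Hy.
have [d [C [d0 dC]]] := common_denominator y.
exists C => D; rewrite -cX -[D in (_ ^ D)%N]card_ord -card_ffun.
have t0 : t != 0.
  by apply/eqP => t0; apply: t_transc; rewrite t0; exists 'X; rewrite ?polyX_eq0 // map_polyX rootX.
apply: (@atleast_fin K _ (fun f : {ffun 'I_D -> X} => ev d * \sum_(s < D) t ^+ s * y (f s))).
  move=> f f' /(mulfI (ev_neq0 d0)) ff'; apply: contrapT => ne.
  have [s0 sne] : exists s, f s != f' s.
    apply: contrapT => N; apply: ne; apply/ffunP => s; apply/eqP; apply: contraT => h.
    by exfalso; apply: N; exists s.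
  have [] := @ex_maxnP (fun s => [exists s' : 'I_D, (f s' != f' s') && (val s' == s)]) D.
  - by exists s0; apply/existsP; exists s0; rewrite sne /=.
  - by move=> s /existsP[s' /andP[_ /eqP <-]]; exact/ltnW/ltn_ord.
  (* At the last index [s] where [f] and [f'] differ, [t ^+ s] dominates at every [w i], so equal
     sums force [y (f s)] and [y (f' s)] to agree modulo [1 / t] there. *)
  move=> _ /existsP[s /andP[fs /eqP <-]] smax; case/eqP: fs; apply: tauI => i ig.
  have [hwi [r0 r1] wt] := hw i ig.
  have yint x : val_ge (w i) 0 (y x).
    rewrite -[y x](subrK (tau x i)); apply: (val_geD hwi); last exact: tau0.
    by apply: val_ge_le (yP x i ig); lia.
  have wtE : w i t = - `|w i t|%N%:Z by lia.
  have tX (l : nat) : val_ge (w i) (- (`|w i t|%N%:Z * l%:Z)) (t ^+ l).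
    by right; rewrite (nvalX hwi) pmulrn mulrzz {2}wtE mulNr.
  have main : val_ge (w i) (`|w i t|%N%:Z) (y (f s) - y (f' s)).
    have -> : y (f s) - y (f' s) = (t ^+ s * (y (f s) - y (f' s))) * (t ^+ s)^-1.
      by rewrite mulrAC mulfV ?mul1r // expf_neq0.
    have -> : t ^+ s * (y (f s) - y (f' s)) = - \sum_(l < D | l != s) t ^+ l * (y (f l) - y (f' l)).
      apply/eqP; rewrite -addr_eq0; apply/eqP.
      transitivity (\sum_(l < D) t ^+ l * (y (f l) - y (f' l))); first by rewrite [RHS](bigD1 s).
      by under eq_bigr do rewrite mulrBr; rewrite sumrB ff' subrr.
    have tVs : val_ge (w i) (`|w i t|%N%:Z * s%:Z) (t ^+ s)^-1.
      by right; rewrite (nvalV hwi) (nvalX hwi) pmulrn mulrzz {2}wtE mulNr opprK.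
    rewrite (_ : `|w i t|%N%:Z = `|w i t|%N%:Z * (1 - s%:Z) + `|w i t|%N%:Z * s%:Z); last by ring.
    apply: (val_geM hwi) => //; apply/(val_geN hwi); apply: (val_ge_sum hwi) => l ls.
    have [fl|/eqP fl] := eqVneq (f l) (f' l); first by rewrite fl subrr mulr0; left.
    have sl : (l < s)%N.
      rewrite ltn_neqAle (inj_eq val_inj) ls smax //.
      by apply/existsP; exists l; rewrite eqxx andbT; apply/eqP.
    apply: val_ge_le (val_geM hwi (tX l) (val_geB hwi (yint (f l)) (yint (f' l)))).
    by move: sl; move: (nat_of_ord l) (nat_of_ord s) (`|w i t|%N) => l' s' a; nia.
  have -> : tau (f s) i - tau (f' s) i = (y (f s) - y (f' s)) - (y (f s) - tau (f s) i)
     + (y (f' s) - tau (f' s) i) by ring.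
  have := HB i ig => wB.
  apply: (val_geD hwi); first apply: (val_geB hwi) => //.
    by apply: val_ge_le (yP _ i ig); lia.
  by apply: val_ge_le (yP _ i ig); lia.
move=> f; rewrite mulr_sumr; apply: bounded_comb_sum => s _.
rewrite mulrCA; apply: bounded_comb_le (bounded_combX _ (dC _)).
by rewrite leq_add2r ltnW.
Qed.

(** A multiplicative form of the inequality between the sum of the [e_i f_i] and the degree: the
    lower count from [pole_counting] is compared with [#|k| ^ (e * (D + C))]. With [D = (e * C).+1]
    the constant [C] no longer hides a surplus factor [#|k|]. *)
Lemma pole_bound (w : nat -> K -> int) g (M : nat -> nat) (rho : forall i, 'I_(M i) -> K) :
  (forall i, (i < g)%N -> [/\ normalized_valuation (w i), residue_family (w i) (rho i) & w i t < 0]) ->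
  (forall i j, (i < g)%N -> (j < g)%N -> i != j -> w i <> w j) ->
  (\prod_(i < g) M i ^ `|w i t| < #|k| ^ e.+1)%N.
Proof.
move=> hw dw; have [C HC] := pole_counting hw dw.
rewrite ltnNge; apply/negP => big.
have := bounded_comb_card (HC (e * C).+1).
apply/negP; rewrite -ltnNge.
have h : ((#|k| ^ e.+1) ^ (e * C).+1 <= (\prod_(i < g) M i ^ `|w i t|) ^ (e * C).+1)%N.
  by rewrite leq_exp2r.
apply: leq_trans h.
rewrite -expnM ltn_exp2l ?card_finNzRing_gt1 //; nia.
Qed.

(** [pole_bound] limits the size of an incongruent family at a pole of [t], and a family of maximal
    size is complete. *)
Lemma pole_residue_system (w : K -> int) : normalized_valuation w -> w t < 0 ->
  exists (Q : nat) (rho : 'I_Q -> K), residue_system w rho.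
Proof.
move=> hw wt.
have [] := @ex_maxnP (fun Q => `[< exists rho : 'I_Q -> K, residue_family w rho >]) (#|k| ^ e.+1).
- by exists 0%N; apply/asboolP; exists (fun=> 0); split=> [[]|[]].
- move=> Q /asboolP[rho hr].
  have := @pole_bound (fun=> w) 1 (fun=> Q) (fun=> rho).
  rewrite big_ord1 => H; apply: leq_trans (ltnW (H _ _)) => //; last by case=> [|i] [].
  have [->//|Q0] := posnP Q; rewrite -{1}(expn1 Q) leq_pexp2l //; lia.
move=> Q /asboolP[rho hr] Qmax; exists Q, rho; split=> // x x0.
apply: contrapT => nx; have := Qmax Q.+1; rewrite ltnn => H.
suff : false by []; apply: H; apply/asboolP; have [r0 r1] := hr.
exists (fun i => if unlift ord_max i is Some i' then rho i' else x); split.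
  by move=> d; case: unliftP.
move=> d d'; case: unliftP => [i ->|->]; case: unliftP => [i' ->|->] //.
- by move=> /r1 ->.
- by move=> /(val_geBC hw) h; exfalso; apply: nx; exists i.
- by move=> h; exfalso; apply: nx; exists i'.
Qed.

Lemma residue_family01 (w : K -> int) : normalized_valuation w ->
  residue_family w (fun d : 'I_2 => (val d)%:R).
Proof.
move=> hw; have n1 : ~ val_ge w 1 1.
  by move=> /(val_ge_nz _ _ (oner_neq0 K)); rewrite (nval1 hw).
split=> [[[|[|//]] /= _]|]; [by left | exact: val_ge1|].
move=> [[|[|//]] i1] [[|[|//]] i2] /= h; try exact: val_inj.
- by exfalso; apply/n1/(val_geN hw); rewrite -sub0r.
- by exfalso; apply: n1; rewrite subr0 in h.
Qed.

(** The residues 0 and 1 are incongruent at every place, so [pole_bound] gives [2 ^ g < #|k| ^ e.+1]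
    for [g] distinct poles; a family of maximal size contains all poles other than [v]. *)
Lemma finitely_many_poles (v : K -> int) : exists (g : nat) (w : nat -> K -> int),
  [/\ forall i, (i < g)%N -> [/\ normalized_valuation (w i), w i t < 0 & w i <> v],
      forall i j, (i < g)%N -> (j < g)%N -> i != j -> w i <> w j
    & forall u, normalized_valuation u -> u t < 0 -> u <> v -> exists2 i, (i < g)%N & u = w i].
Proof.
pose P g := `[< exists w : nat -> K -> int,
  (forall i, (i < g)%N -> [/\ normalized_valuation (w i), w i t < 0 & w i <> v]) /\
  (forall i j, (i < g)%N -> (j < g)%N -> i != j -> w i <> w j) >].
have [] := @ex_maxnP P (#|k| ^ e.+1)%N.
- by exists 0%N; apply/asboolP; exists (fun _ _ => 0).
- move=> g /asboolP[w [hw dw]].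
  have := @pole_bound w g (fun=> 2%N) (fun _ d => (val d)%:R).
  move=> H; apply: leq_trans (ltnW (H _ dw)); last first.
    by move=> i /hw[hwi wt _]; split=> //; exact: residue_family01.
  apply: (@leq_trans (2 ^ g)%N); first exact/ltnW/ltn_expl.
  rewrite -[g in (2 ^ g)%N]card_ord -prod_nat_const; apply: leq_prod => i _.
  by have [_ wt _] := hw i (ltn_ord i); rewrite -{1}(expn1 2) leq_exp2l //; lia.
move=> g /asboolP[w [hw dw]] gmax; exists g, w; split=> // u hu ut uv.
apply: contrapT => nu; have := gmax g.+1; rewrite ltnn => H.
suff : false by []; apply: H; apply/asboolP.
have nuw i : (i < g)%N -> u <> w i by move=> ig uw; apply: nu; exists i.
exists (fun i => if (i < g)%N then w i else u); split.
  by move=> i _; case: ifP => [/hw//|_].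
move=> i j; rewrite !ltnS => ig jg ij.
case: ifP => [ig'|/negbT ig']; case: ifP => [jg'|/negbT jg'].
- exact: dw.
- exact/not_eq_sym/nuw.
- exact: nuw.
- by exfalso; move: ij ig' jg'; lia.
Qed.

(** Used to remove the poles other than [v]: a bound on the orders of the poles leaves finitely many
    principal parts, and equal principal parts cancel in a difference. *)
Lemma condition_classes (w : nat -> K -> int) g (Q n : nat -> nat)
    (rho : forall i, 'I_(Q i) -> K) :
  (forall i, (i < g)%N -> normalized_valuation (w i) /\ residue_system (w i) (rho i)) ->
  exists (X : finType) (cl : K -> X), #|X| = (\prod_(i < g) Q i ^ n i)%N /\
    forall x y, (forall i, (i < g)%N -> val_ge (w i) (- (n i)%:Z) x /\ val_ge (w i) (- (n i)%:Z) y) ->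
      cl x = cl y -> forall i, (i < g)%N -> val_ge (w i) 0 (x - y).
Proof.
elim: g => [|g IH] H.
  by exists unit, (fun=> tt); split=> [|? ? _ _ []]; rewrite ?big_ord0 ?card_unit.
have [X [cl [cX clP]]] := IH (fun i ig => H i (ltnW ig)).
have [hw hr] := H g (ltnSn g).
have [p p0 wp] := nval_unif hw.
have [f fP] := class_map hw p0 wp (- (n g)%:Z) (n g) hr.
exists (X * {ffun 'I_(n g) -> 'I_(Q g)})%type, (fun x => (cl x, f x)); split.
  by rewrite card_prod cX card_ffun !card_ord big_ord_recr.
move=> x y hxy [] clxy fxy i; rewrite ltnS leq_eqVlt => /orP[/eqP->|ig].
  by have [hx hy] := hxy g (ltnSn g); have := fP x y hx hy fxy; rewrite addNr.
by apply: clP => // l lg; exact: hxy (ltnW lg).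
Qed.

(** There are at least [(q ^ vt' * Pi) ^ D] elements whose poles are about [D] times those of [t],
    where [Pi] collects the poles of [t] other than [v]. Cancelling the principal parts there costs
    [Pi ^ (D + B)]: the factor [Pi ^ D] drops out and the loss [Pi ^ B] does not depend on [D]. *)
Lemma riemann_inequality_at_pole (v : K -> int) (q : nat) (rho : 'I_q -> K) :
  normalized_valuation v -> residue_system v rho -> v t < 0 ->
  exists c : nat, forall a : nat,
    atleast (q ^ a)%N [set x | Rv v x /\ val_ge v (- (a + c)%:Z) x].
Proof.
move=> hv hrv vt.
have [g [w [hw dw wall]]] := finitely_many_poles v.
have HQ i : exists Q, exists rh : 'I_Q -> K, (i < g)%N -> residue_system (w i) rh.
  have [ig|] := boolP (i < g)%N; last by exists 0%N, (fun=> 0).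
  by have [hwi wt _] := hw i ig; have [Q [rh hrh]] := pole_residue_system hwi wt; exists Q, rh.
have [Q HQ'] := choice HQ.
pose rh i := projT1 (cid (HQ' i)).
have rhP i : (i < g)%N -> residue_system (w i) (rh i) := projT2 (cid (HQ' i)).
have [p p0 vp] := nval_unif hv.
have q1 := residue_system_gt1 hv hrv.
pose w' i := if i is i'.+1 then w i' else v.
pose M' i := if i is i'.+1 then Q i' else q.
pose rh' i : 'I_(M' i) -> K := match i with 0 => rho | i'.+1 => rh i' end.
have [||C HC] := @pole_counting w' g.+1 M' rh'.
- case=> [_|i]; first by split=> //; case: hrv.
  rewrite ltnS => ig; have [hwi wt _] := hw i ig.
  by split=> //; case: (rhP i ig).
- move=> [|i] [|j] //; rewrite ?ltnS => ig jg ij.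
  + by have [_ _] := hw j jg; exact: not_eq_sym.
  + by have [_ _] := hw i ig.
  + exact: dw.
have [P [C' [P0 HP]]] := bounded_comb_pole_bounded.
pose vt' := `|v t|%N; pose E i := `|w i t|%N.
pose Pi := (\prod_(i < g) Q i ^ E i)%N.
have Q0 i : (i < g)%N -> (0 < Q i)%N.
  by move=> ig; have [hwi _ _] := hw i ig; exact/ltnW/(residue_system_gt1 hwi (rhP i ig)).
have Pi0 : (0 < Pi)%N by apply: prodn_gt0 => i; rewrite expn_gt0 Q0.
pose B := (C + C')%N.
have HD D c0 : (Pi ^ B <= q ^ c0)%N -> (c0 <= vt' * D)%N ->
   atleast (q ^ (vt' * D - c0))%N [set x | Rv v x /\ val_ge v (- (vt' * (D + B))%:Z) x].
  move=> hc0 c0D.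
  have [X [cl [cX clP]]] := @condition_classes w g Q (fun i => E i * (D + B))%N rh
    (fun i ig => let: And3 h _ _ := hw i ig in conj h (rhP i ig)).
  have := HC D; rewrite big_ord_recl /= => aN.
  have {}aN : atleast (Pi ^ (D + B) * q ^ (vt' * D - c0))
     [set x | pole_bounded (D + B) x].
    apply: (@atleast_le _ _ ((q ^ vt' * Pi) ^ D)%N).
      rewrite expnMn expnD -mulnA mulnC -expnM mulnC [X in (_ <= X)%N]mulnC leq_mul2l.
      apply/orP; right; apply: (@leq_trans (q ^ c0 * q ^ (vt' * D - c0))%N).
        by rewrite leq_mul2r hc0 orbT.
      by rewrite -expnD subnKC.
    apply: (atleast_image (f := fun x => ev P * x)) aN.
      by move=> x y _ _; apply/mulfI/ev_neq0.
    by move=> x /HP; rewrite addnA.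
  have cX' : (#|X| <= Pi ^ (D + B))%N.
    rewrite cX /Pi; under eq_bigr do rewrite expnM.
    by rewrite (big_morph (fun n => n ^ (D + B))%N (fun x y => expnMn x y _) (exp1n _)).
  apply: (atleast_pigeonhole_sub (f := cl)) cX' _ _ _ aN.
  - by rewrite expn_gt0 (ltnW q1).
  - by rewrite expn_gt0 Pi0.
  move=> x y px py clxy; split.
    move=> u hu uv; have [ut|ut] := lerP 0 (u t).
      by apply: (val_geB hu); [case: (px u hu)|case: (py u hu)]; auto.
    have [i ig ->] := wall u hu ut uv.
    apply: clP clxy _ ig => l lg; have [hwl wlt _] := hw l lg.
    have -> : - (E l * (D + B))%:Z = (D + B)%:Z * w l t by rewrite /E; nia.
    by split; [case: (px _ hwl)|case: (py _ hwl)]; auto.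
  have -> : - (vt' * (D + B))%:Z = (D + B)%:Z * v t by rewrite /vt'; nia.
  by apply: (val_geB hv); [case: (px v hv)|case: (py v hv)]; auto.
pose c0 := (Pi ^ B)%N.
exists (c0 + vt' + vt' * B)%N => a.
have vt'0 : (0 < vt')%N by rewrite /vt'; lia.
(* Pole orders at [v] come in multiples of [vt']; the overshoot, at most [vt'], is absorbed by the
   constant. *)
pose D := ((a + c0) %/ vt').+1.
have D1 : (a + c0 <= vt' * D)%N by rewrite mulnC ltnW // /D -ltn_divLR.
have D2 : (vt' * D <= a + c0 + vt')%N.
  by rewrite /D mulnS addnC leq_add2r mulnC leq_trunc_div.
have hc0 : (Pi ^ B <= q ^ c0)%N by apply/ltnW/ltn_expl.
have c0D : (c0 <= vt' * D)%N by lia.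
apply: atleast_le (atleast_sub _ (HD D c0 hc0 c0D)).
  by rewrite leq_exp2l //; lia.
by move=> x [Rx vx]; split=> //; apply: val_ge_le vx; rewrite mulnDr; lia.
Qed.

End FunctionField.

(** * Every transcendental element has a pole *)

Lemma expr_div_sub (K : fieldType) (z : K) (i n : nat) : z != 0 -> (i <= n)%N ->
  z ^+ n * z^-1 ^+ i = z ^+ (n - i).
Proof. by move=> z0 ni; rewrite -{1}(subnK ni) exprD -mulrA -exprMn mulfV // expr1n mulr1. Qed.

Lemma divf_mul2l (K : fieldType) (a c d : K) : a != 0 -> (a * c) / (a * d) = c / d.
Proof. by move=> a0; rewrite invfM mulrACA mulfV // mul1r. Qed.

Section PlaceAtPole.
Variables (k : finFieldType) (K : fieldType) (iota : {rmorphism k -> K}) (t : K).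
Hypothesis t_transc : ~ algebraicOver iota t.
Variables (e : nat) (b : 'I_e -> K).
Hypothesis b_span : spanning iota t b.
Variable x : K.
Hypothesis x_transc : ~ algebraicOver iota x.

Local Notation y := (x^-1).

Record pole_ring (A : set K) : Prop := {
  pole_ring1 : A 1;
  pole_ringB : forall a a', A a -> A a' -> A (a - a');
  pole_ringM : forall a a', A a -> A a' -> A (a * a');
  pole_ringC : forall c, A (iota c);
  pole_ringV : A y;
  pole_ringN : ~ A x }.

Lemma x_neq0 : x != 0.
Proof.
apply/eqP => x0; apply: x_transc; rewrite x0.
by exists 'X; rewrite ?polyX_eq0 // map_polyX rootX.
Qed.

Lemma y_transc : ~ algebraicOver iota y.
Proof. by move=> /algebraic_inv; rewrite invrK. Qed.

Lemma pole_ring_exists : exists A, pole_ring A.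
Proof.
exists [set z | exists p : {poly k}, z = (map_poly iota p).[y]]; split.
- by exists 1; rewrite rmorph1 hornerC.
- by move=> _ _ [p ->] [q ->]; exists (p - q); rewrite evB.
- by move=> _ _ [p ->] [q ->]; exists (p * q); rewrite evM.
- by move=> c; exists c%:P; rewrite evC.
- by exists 'X; rewrite map_polyX hornerX.
- case=> p xp; apply: y_transc; exists ('X * p - 1).
    apply/eqP => /(congr1 (fun q : {poly k} => q`_0)).
    rewrite coefB coefXM coef1 coef0 sub0r => /eqP.
    by rewrite oppr_eq0 oner_eq0.
  apply/rootP; rewrite evB evM map_polyX hornerX -xp rmorph1 hornerC mulVf ?x_neq0 //.
  by rewrite subrr.
Qed.

(* A maximal subring containing [k] and [1 / x] but not [x] is a valuation ring. *)
Lemma max_pole_ring : exists2 O, pole_ring O &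
  forall B, pole_ring B -> O `<=` B -> B `<=` O.
Proof.
have [A0 hA0] := pole_ring_exists.
have [F FP Ftot|O [ OP Omax]] := @Zorn_bigcup K [set A | A = set0 \/ pole_ring A].
- have [[A FA [a Aa]]|H] := pselect (exists2 A, F A & A !=set0); last first.
    left; rewrite -subset0 => z [A FA Az]; apply: H; exists A => //; by exists z.
  have ring B z : F B -> B z -> pole_ring B.
    by move=> FB Bz; case: (FP B FB) => // B0; rewrite B0 in Bz.
  have hA := ring A a FA Aa.
  have common z z' : (\bigcup_(B in F) B) z -> (\bigcup_(B in F) B) z' ->
      exists2 B, F B & B z /\ B z'.
    move=> [B FB Bz] [B' FB' Bz']; have [BB'|B'B] := Ftot B B' FB FB'.
      by exists B' => //; split=> //; exact: BB'.
    by exists B => //; split=> //; exact: B'B.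
  right; split.
  + by exists A => //; apply: pole_ring1.
  + move=> z z' Uz Uz'; have [B FB [Bz Bz']] := common z z' Uz Uz'; exists B => //.
    exact: (pole_ringB (ring B z FB Bz)).
  + move=> z z' Uz Uz'; have [B FB [Bz Bz']] := common z z' Uz Uz'; exists B => //.
    exact: (pole_ringM (ring B z FB Bz)).
  + by move=> c; exists A => //; apply: pole_ringC.
  + by exists A => //; apply: pole_ringV.
  + by case=> B FB Bx; apply: (pole_ringN (ring B x FB Bx)).
- have max B : pole_ring B -> O `<=` B -> B `<=` O.
    move=> hB OB; apply: contrapT => nBO; apply: (Omax B); last by right.
    by split.
  case: OP => [Oe|hO]; last by exists O.
  exfalso; have := max A0 hA0; rewrite Oe => /(_ (@sub0set _ _)) /(_ 1 (pole_ring1 hA0)).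
  by [].
Qed.

Variable O : set K.
Hypothesis hO : pole_ring O.
Hypothesis maxO : forall B, pole_ring B -> O `<=` B -> B `<=` O.

Lemma O0 : O 0. Proof. by rewrite -(subrr 1); apply: (pole_ringB hO); apply: (pole_ring1 hO). Qed.

Lemma ON a : O a -> O (- a).
Proof. by move=> Oa; rewrite -sub0r; apply: (pole_ringB hO) => //; apply: O0. Qed.

Lemma OD a a' : O a -> O a' -> O (a + a').
Proof. by move=> Oa Oa'; rewrite -[a']opprK; apply: (pole_ringB hO) => //; apply: ON. Qed.

Lemma O_sum (I : Type) (s : seq I) (P : pred I) (f : I -> K) :
  (forall i, P i -> O (f i)) -> O (\sum_(i <- s | P i) f i).
Proof. by move=> fN; elim/big_ind: _ => [|u v|//]; [exact: O0 | exact: OD]. Qed.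

Lemma OX a n : O a -> O (a ^+ n).
Proof.
by move=> Oa; elim: n => [|n IH]; rewrite ?exprS; [exact: (pole_ring1 hO) | exact: (pole_ringM hO)].
Qed.

(** By maximality [O[z]] is not a [pole_ring], and the only condition that can fail for it is the
    absence of [x]. *)
Lemma adjoin z : ~ O z ->
  exists (n : nat) (a : nat -> K), (forall i, O (a i)) /\ x = \sum_(i < n) a i * z ^+ i.
Proof.
move=> nOz; apply: contrapT => H.
pose B := [set u | exists p : {poly K}, (forall i, O p`_i) /\ u = p.[z]].
have OB : O `<=` B.
  move=> a Oa; exists a%:P; rewrite hornerC; split=> // i; rewrite coefC.
  by case: ifP => // _; exact: O0.
apply: nOz; apply: (maxO (B := B)) => //; last first.
  exists 'X; rewrite hornerX; split=> // i; rewrite coefX.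
  by case: (i == 1)%N; [exact: (pole_ring1 hO) | exact: O0].
split.
- exact/OB/(pole_ring1 hO).
- move=> _ _ [p [ Op ->]] [q [ Oq ->]]; exists (p - q); rewrite hornerD hornerN; split=> // i.
  by rewrite coefB; apply: (pole_ringB hO).
- move=> _ _ [p [ Op ->]] [q [ Oq ->]]; exists (p * q); rewrite hornerM; split=> // i.
  by rewrite coefM; apply: O_sum => j _; apply: (pole_ringM hO).
- by move=> c; apply/OB/(pole_ringC hO).
- exact/OB/(pole_ringV hO).
- move=> [p [ Op xp]]; apply: H; exists (size p), (fun i => p`_i); split=> //.
  by rewrite xp horner_coef.
Qed.

(** The element [1 / x] lies in the Jacobson radical of [O]. If [c = 1 - y * a] had no inverse in
    [O], then [x] would be a polynomial in [c^-1], so [c ^+ n * x] would be in [O]; as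
    [c ^+ n = 1 - y * r], also [x = c ^+ n * x + r] would be in [O]. *)
Lemma sub1_unit a : O a -> 1 - y * a != 0 /\ O (1 - y * a)^-1.
Proof.
move=> Oa; set c := 1 - y * a.
have c0 : c != 0.
  apply/eqP => /eqP; rewrite subr_eq0 => /eqP ya; apply: (pole_ringN hO).
  by rewrite -[x]mulr1 ya mulrA mulfV ?x_neq0 // mul1r.
split=> //; apply: contrapT => /adjoin [n [u [ Ou xE]]].
pose q := \sum_(i < n) u i * c ^+ (n - i).
have Oc : O c by apply: (pole_ringB hO); [exact: (pole_ring1 hO) | apply: (pole_ringM hO) => //; exact: (pole_ringV hO)].
have Oq : O q by apply: O_sum => i _; apply: (pole_ringM hO) => //; apply: OX.
have cq : c ^+ n * x = q.
  rewrite xE mulr_sumr; apply: eq_bigr => i _.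
  by rewrite mulrCA expr_div_sub // ltnW.
have [r Or cr] : exists2 r, O r & c ^+ n = 1 - y * r.
  elim: n {u Ou xE q Oq cq} => [|n [r Or cr]]; first by exists 0; [exact: O0 | rewrite mulr0 subr0].
  exists (r + a - y * a * r); last by rewrite exprS cr /c; ring.
  apply: (pole_ringB hO); first exact: OD.
  apply: (pole_ringM hO) => //; apply: (pole_ringM hO) => //; exact: (pole_ringV hO).
apply: (pole_ringN hO); rewrite (_ : x = q + r); first exact: OD.
by rewrite -cq cr mulrBl mulrAC mulVf ?x_neq0 //; ring.
Qed.

Definition unit_comb (z : K) n := exists a : nat -> K,
  (forall i, O (a i)) /\ 1 = y * \sum_(i < n.+1) a i * z ^+ i.

Lemma unit_comb_le z m n : (m <= n)%N -> unit_comb z m -> unit_comb z n.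
Proof.
move=> mn [a [ Oa a1]]; exists (fun i => if (i < m.+1)%N then a i else 0); split.
  by move=> i; case: ifP => // _; exact: O0.
rewrite [LHS]a1; congr (_ * _).
rewrite (big_ord_widen n.+1 (fun i => a i * z ^+ i)) // [LHS]big_mkcond /=; apply: eq_bigr => i _.
by case: ifP; rewrite ?mul0r.
Qed.

(** The descent in the classical proof that [O] is a valuation ring: the relation for [z^-1], in
    which [1 - y * c 0] is invertible by [sub1_unit], expresses [z ^+ n.+1] by lower powers, which
    are substituted in the relation for [z]. In degree 0 the relation [1 = y * a] contradicts
    [sub1_unit]. *)
Lemma unit_comb_step z n : z != 0 -> unit_comb z n.+1 -> unit_comb z^-1 n.+1 -> unit_comb z n.
Proof.
move=> z0 [a [ Oa a1]] [c [ Oc c1]].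
have [d0 Od] := sub1_unit (Oc 0%N).
set d := 1 - y * c 0%N in d0 Od.
have zE : z ^+ n.+1 = y * \sum_(i < n.+1) c (n.+1 - i)%N / d * z ^+ i.
  apply: (mulfI d0).
  transitivity (y * \sum_(i < n.+1) c (n.+1 - i)%N * z ^+ i); last first.
    rewrite mulrCA; congr (_ * _); rewrite mulr_sumr; apply: eq_bigr => i _.
    by field.
  have : z ^+ n.+1 = y * \sum_(i < n.+2) c (n.+1 - i)%N * z ^+ i.
    rewrite -[LHS]mul1r {1}c1 -mulrA mulr_suml; congr (_ * _).
    rewrite (reindex_inj rev_ord_inj) /=; apply: eq_bigr => i _.
    rewrite subSS -mulrA; congr (_ * _).
    have iN : (i <= n.+1)%N by rewrite -ltnS.
    by rewrite mulrC expr_div_sub ?leq_subr // subKn.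
  by rewrite big_ord_recr /= subnn mulrDr /d mulrBl mul1r => {1}->; ring.
exists (fun i => a i + y * (a n.+1 * (c (n.+1 - i)%N / d))); split.
  move=> i; apply: OD => //; apply: (pole_ringM hO); first exact: (pole_ringV hO).
  by apply: (pole_ringM hO) => //; apply: (pole_ringM hO).
rewrite a1; congr (_ * _); rewrite big_ord_recr /= zE !mulr_sumr -big_split /=.
by apply: eq_bigr => i _; ring.
Qed.

Lemma O_valuation_ring z : O z \/ O z^-1.
Proof.
have [->|z0] := eqVneq z 0; first by left; exact: O0.
have toComb u : ~ O u -> exists n, unit_comb u n.
  move=> /adjoin[n [a [ Oa xa]]]; exists n; apply: (unit_comb_le (m := n.-1)); first exact: leq_pred.
  case: n => [|n] in xa *; first by move: x_neq0; rewrite xa big_ord0 eqxx.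
  by exists a; split=> //; rewrite -xa mulVf ?x_neq0.
apply: contrapT => /not_orP[/toComb[n zn] /toComb[m zm]].
have {}zn := unit_comb_le (leq_maxl n m) zn.
have {}zm := unit_comb_le (leq_maxr n m) zm.
elim: (maxn n m) zn zm => [|l IH] zn zm.
  case: zn => a [ Oa]; rewrite big_ord1 expr0 mulr1 => ya.
  have [] := sub1_unit (Oa 0%N); by rewrite -ya subrr eqxx.
apply: IH; apply: unit_comb_step => //; by rewrite ?invr_eq0 ?invrK.
Qed.

(** The maximal ideal of [O]; membership in [O] follows because [O] is a valuation ring. *)
Definition nonunit (a : K) : Prop := a = 0 \/ ~ O a^-1.

Lemma nonunitO a : nonunit a -> O a.
Proof.
case=> [->|nOa]; first exact: O0.
by case: (O_valuation_ring a).
Qed.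

Lemma nonunitM a c : O a -> nonunit c -> nonunit (a * c).
Proof.
move=> Oa [->|nOc]; first by left; rewrite mulr0.
have [->|a0] := eqVneq a 0; first by left; rewrite mul0r.
right=> Oac; apply: nOc; rewrite -[c^-1]mul1r -(mulfV a0) -mulrA -invfM.
exact: (pole_ringM hO).
Qed.

Lemma nonunit1 : ~ nonunit 1.
Proof.
case=> [/eqP|]; first by rewrite oner_eq0.
by rewrite invr1; apply; exact: (pole_ring1 hO).
Qed.

Lemma nonunitD a c : nonunit a -> nonunit c -> nonunit (a + c).
Proof.
move=> ma mc.
have [->|a0] := eqVneq a 0; first by rewrite add0r.
have [->|c0] := eqVneq c 0; first by rewrite addr0.
case: (O_valuation_ring (a / c)) => [Oac|].
  have -> : a + c = (a / c + 1) * c by field.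
  by apply: nonunitM => //; apply: OD => //; exact: (pole_ring1 hO).
rewrite invf_div => Oca.
have -> : a + c = (c / a + 1) * a by field.
by apply: nonunitM => //; apply: OD => //; exact: (pole_ring1 hO).
Qed.

Lemma nonunit_sum (I : Type) (s : seq I) (P : pred I) (f : I -> K) :
  (forall i, P i -> nonunit (f i)) -> nonunit (\sum_(i <- s | P i) f i).
Proof. by move=> fN; elim/big_ind: _ => [|u v|//]; [left | exact: nonunitD]. Qed.

Lemma nonunit_y : nonunit y.
Proof. by right; rewrite invrK; exact: (pole_ringN hO). Qed.

(** Dividing a relation by the [a l] of its first nonzero term would make a nonzero constant a
    nonunit, but nonzero constants are units of [O]. *)
Lemma decreasing_free L (a : nat -> K) (c : 'I_L -> k) :
  (forall l, (l < L)%N -> a l != 0) ->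
  (forall l, (l.+1 < L)%N -> nonunit (a l.+1 / a l)) ->
  \sum_(l < L) iota (c l) * a l = 0 -> forall l, c l = 0.
Proof.
move=> a0 da rel.
have ratio l d : (l + d.+1 < L)%N -> nonunit (a (l + d.+1)%N / a l).
  elim: d => [|d IH]; first by rewrite addn1; exact: da.
  rewrite [(l + d.+2)%N]addnS => ld.
  have -> : a (l + d.+1).+1 / a l = a (l + d.+1).+1 / a (l + d.+1)%N * (a (l + d.+1)%N / a l).
    by have := a0 (l + d.+1)%N (ltnW ld) => ?; field; rewrite a0 //; lia.
  by apply: nonunitM; [apply/nonunitO/da | exact/IH/ltnW].
suff H n (l : 'I_L) : (l < n)%N -> c l = 0 by move=> l; exact: (H l.+1).
elim: n l => // n IH l ln; apply: contrapT => /eqP cl.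
have {}IH (i : 'I_L) : (i < l)%N -> c i = 0 by move=> il; apply: IH; apply: leq_trans il _.
have al := a0 l (ltn_ord l).
have : nonunit (iota (c l)).
  move: rel; rewrite (bigD1 l) //= => /eqP; rewrite addr_eq0 => /eqP /(congr1 (fun z => z / a l)).
  rewrite mulfK // => ->; rewrite mulNr -mulN1r.
  apply: nonunitM; first by apply: ON; exact: (pole_ring1 hO).
  rewrite mulr_suml; apply: nonunit_sum => i il.
  have [li|] := ltnP l i; last first.
    rewrite leq_eqVlt => /orP[/eqP/val_inj E|/IH ->]; first by rewrite E eqxx in il.
    by left; rewrite rmorph0 !mul0r.
  rewrite -mulrA; apply: nonunitM; first exact: (pole_ringC hO).
  have -> : nat_of_ord i = (l + (i - l).-1.+1)%N by lia.
  by apply: ratio; have := ltn_ord i; lia.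
case=> [/eqP|]; first by rewrite fmorph_eq0 (negPf cl).
by apply; rewrite -fmorphV; exact: (pole_ringC hO).
Qed.

(** In lexicographic order the products [g ^+ i * z j] form a chain as in [decreasing_free]; the
    condition on [g * z 0 / z N] handles the passage from [g ^+ i * z N] to [g ^+ i.+1 * z 0]. *)
Lemma grid_free N L (g : K) (z : nat -> K) (c : 'I_L -> k) :
  g != 0 -> (forall i, z i != 0) -> (forall i, (i < N)%N -> nonunit (z i.+1 / z i)) ->
  nonunit (g * z 0%N / z N) ->
  \sum_(l < L) iota (c l) * (g ^+ (l %/ N.+1) * z (l %% N.+1)%N) = 0 -> forall l, c l = 0.
Proof.
move=> g0 z0 dz wrap rel.
apply: (@decreasing_free L (fun l => g ^+ (l %/ N.+1) * z (l %% N.+1)%N) c) rel => l _.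
  by rewrite mulf_neq0 ?expf_neq0.
have := divn_eq l N.+1; have := ltn_pmod l (ltn0Sn N).
set q := (l %/ N.+1)%N; set r := (l %% N.+1)%N => rN lE.
have [rN'|rN'] := eqVneq r N.
  have -> : (l.+1 = q.+1 * N.+1)%N by rewrite lE rN'; lia.
  by rewrite mulnK // modnMl exprSr -[_ * g * _]mulrA divf_mul2l ?expf_neq0 // rN'.
have -> : (l.+1 = q * N.+1 + r.+1)%N by rewrite lE; lia.
have rN2 : (r < N)%N by lia.
by rewrite divnMDl // modnMDl divn_small // modn_small // addn0 divf_mul2l ?expf_neq0 //; exact: dz.
Qed.

(* The products [y ^+ i * u j] form a long decreasing chain, so they are free
   over [k]; but there are more of them than the pigeonhole bound on relations allows. *)
Lemma no_infinite_chain (u : nat -> K) : u 0%N = y -> (forall i, u i != 0) ->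
  (forall i, nonunit (u i)) -> (forall i, nonunit (u i / u i.+1)) -> False.
Proof.
move=> u0 un0 mu du.
have [d [C [d0 dC]]] := pow_bounded_comb b_span y.
(* The [M * N.+1] products face the bound [e * (C' + C * M)], and [N = e * C] leaves the excess
   [M - e * C']. As [C'] depends on [N], [M] is chosen afterwards. *)
pose N := (e * C)%N.
have [d' [C' [d'0 dC']]] := common_denominator b_span (fun i : 'I_N.+1 => u (N - i)%N).
pose M := (e * C').+1.
have y0 : y != 0 by rewrite invr_eq0 x_neq0.
have [|l|/=|c [[l cl] rel]] := @bounded_comb_relation k K iota t e b
  'I_(M * N.+1) (fun l => y ^+ (l %/ N.+1) * u (N - l %% N.+1)%N)
  ((map_poly iota d).[t] ^+ M * (map_poly iota d').[t]) (C' + C * M)%N.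
- by rewrite mulf_neq0 ?ev_neq0 ?expf_ev_neq0.
- have lM : (l %/ N.+1 <= M)%N by rewrite ltnW // ltn_divLR.
  have := dC C' M (l %/ N.+1)%N _ lM (dC' (Ordinal (ltn_pmod l (ltn0Sn N)))).
  by rewrite /= !mulrA; congr bounded_comb; ring.
- by rewrite card_ord /M /N; nia.
case/eqP: cl; apply: (grid_free (z := fun i => u (N - i)%N) y0 _ _ _ rel) => // [i iN|].
  by have := du (N - i.+1)%N; rewrite subnSK.
by rewrite subn0 subnn u0 mulrAC mulfV ?mul1r.
Qed.

(** Without a generator of the maximal ideal, every nonzero nonunit is a proper multiple of another
    one, and iterating from [y] gives the chain excluded by [no_infinite_chain]. *)
Lemma uniformizer_exists : exists p, [/\ p != 0, nonunit p &
  forall z, nonunit z -> O (z / p)].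
Proof.
apply: contrapT => H.
have next z : exists z', z != 0 -> nonunit z -> [/\ z' != 0, nonunit z' & nonunit (z / z')].
  have [[z0 mz]|nz] := pselect (z != 0 /\ nonunit z); last by exists 0 => z0 mz; exfalso; apply: nz.
  apply: contrapT => H'; apply: H; exists z; split=> // z' mz'.
  have [->|z'0] := eqVneq z' 0; first by rewrite mul0r; exact: O0.
  apply: contrapT => nO; apply: H'; exists z' => _ _; split=> //.
  by right; rewrite invf_div.
have [f fP] := choice next.
pose u := fun i => iter i f y.
have uP i : u i != 0 /\ nonunit (u i).
  elim: i => [|i [u0 mu]]; first by rewrite invr_eq0 x_neq0; split=> //; exact: nonunit_y.
  by rewrite /u /=; have [] := fP _ u0 mu.
apply: (@no_infinite_chain u) => // i; first by case: (uP i).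
  by case: (uP i).
by have [u0 mu] := uP i; have [] := fP _ u0 mu.
Qed.

Variable p : K.
Hypotheses (p_neq0 : p != 0) (p_nonunit : nonunit p).
Hypothesis p_gen : forall z, nonunit z -> O (z / p).

(** If [u] were divisible by all powers of [p], the monomials [u ^+ i * p ^+ j] with [j <= N] would
    be free by [grid_free]; there are [M * M] of them against a degree bound linear in [M]. *)
Lemma archimedean u : u != 0 -> O u -> exists n, O (u / p ^+ n) /\ ~ nonunit (u / p ^+ n).
Proof.
move=> u0 Ou; apply: contrapT => H.
have Oup n : O (u / p ^+ n) /\ nonunit (u / p ^+ n).
  have step n' : O (u / p ^+ n') -> nonunit (u / p ^+ n').
    by move=> Oup; apply: contrapT => nm; apply: H; exists n'.
  elim: n => [|n [_ mn]]; first by have := step 0%N; rewrite expr0 divr1; auto.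
  have Oup : O (u / p ^+ n.+1) by rewrite exprSr invfM mulrA; exact: p_gen.
  by split=> //; exact: step.
have [d1 [C1 [d10 dC1]]] := pow_bounded_comb b_span p.
have [d2 [C2 [d20 dC2]]] := pow_bounded_comb b_span u.
have [d0 [C0 [d00 /(_ tt) dC0]]] := common_denominator b_span (fun _ : unit => 1).
pose N := (e * (C0 + C1 + C2))%N; pose M := N.+1.
have [|l|/=|c [[l cl] rel]] := @bounded_comb_relation k K iota t e b
  'I_(M * M) (fun l => u ^+ (l %/ N.+1) * p ^+ (l %% N.+1))
  ((map_poly iota d1).[t] ^+ M * (map_poly iota d2).[t] ^+ M * (map_poly iota d0).[t])
  (C0 + C2 * M + C1 * M)%N.
- by rewrite !mulf_neq0 ?ev_neq0 ?expf_ev_neq0.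
- have lM : (l %/ M <= M)%N by rewrite ltnW // ltn_divLR.
  have lM' : (l %% M <= M)%N by rewrite ltnW // ltn_pmod.
  have := dC1 _ _ _ _ lM' (dC2 _ _ _ _ lM dC0).
  by congr bounded_comb; ring.
- by rewrite card_ord /M /N; nia.
case/eqP: cl; apply: (grid_free (z := fun i => p ^+ i) u0 _ _ _ rel) => [i|i _|].
- by rewrite expf_neq0.
- by rewrite exprSr mulrAC mulfV ?mul1r ?expf_neq0.
- by rewrite expr0 mulr1; case: (Oup N).
Qed.

Definition val_exponent (z : K) (n : int) : Prop := O (z / p ^ n) /\ O (z / p ^ n)^-1.

Lemma val_exponent_exists z : z != 0 -> exists n, val_exponent z n.
Proof.
move=> z0; case: (O_valuation_ring z) => Oz.
  have [n [On mn]] := archimedean z0 Oz; exists n%:Z; split=> //.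
  by apply: contrapT => nO; apply: mn; right.
have [|n [On mn]] := archimedean _ Oz; first by rewrite invr_eq0.
exists (- n%:Z); rewrite /val_exponent -exprnN invrK invfM.
have -> : z * p ^+ n = (z^-1 / p ^+ n)^-1 by rewrite invfM !invrK.
split; last by rewrite -invfM [X in O X](_ : _ = z^-1 / p ^+ n) //; rewrite invfM.
by apply: contrapT => nO; apply: mn; right.
Qed.

Lemma p_pow n : ~ O (p ^ (- n.+1%:Z)).
Proof.
move=> Op; apply: nonunit1.
have -> : 1 = p ^ (- n.+1%:Z) * p ^+ n * p.
  by rewrite -mulrA -exprSr -exprnN mulVf // expf_neq0.
by apply: nonunitM => //; apply: (pole_ringM hO) => //; exact/OX/nonunitO.
Qed.

Lemma val_exponent_ge z n l : z != 0 -> val_exponent z n -> O (z / p ^ l) -> l <= n.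
Proof.
move=> z0 [_ On] Ol; rewrite leNgt; apply/negP => nl.
have : O (p ^ (n - l)).
  have -> : p ^ (n - l) = (z / p ^ l) * (z / p ^ n)^-1.
    by rewrite expfzDr // -invr_expz; field; rewrite z0 !expfz_neq0.
  exact: (pole_ringM hO).
have -> : n - l = - (`|l - n|%N.-1.+1)%:Z by lia.
exact: p_pow.
Qed.

Lemma valuation_of_ring : exists2 w : K -> int, normalized_valuation w & w x < 0.
Proof.
have H z : exists n, if z == 0 then n = 0 else val_exponent z n.
  by case: eqVneq => [_|z0]; [exists 0 | exact: val_exponent_exists].
have [w wP] := choice H.
have wz z : z != 0 -> val_exponent z (w z) by move=> z0; have := wP z; rewrite (negPf z0).
have wE z n : z != 0 -> val_exponent z n -> w z = n.
  move=> z0 zn; apply/eqP; rewrite eq_le.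
  rewrite (val_exponent_ge z0 zn (wz z z0).1).
  by rewrite (val_exponent_ge z0 (wz z z0) zn.1).
exists w; [split|].
- by have := wP 0; rewrite eqxx.
- move=> z z' z0 z'0; apply: wE; first by rewrite mulf_neq0.
  have [ O1 O2] := wz z z0; have [ O3 O4] := wz z' z'0; rewrite /val_exponent.
  have -> : z * z' / p ^ (w z + w z') = (z / p ^ w z) * (z' / p ^ w z').
    by rewrite expfzDr //; field; rewrite !expfz_neq0.
  by rewrite invfM; split; apply: (pole_ringM hO).
- move=> z z' z0 z'0 zz'0.
  have ge u l : l <= w u -> u != 0 -> O (u / p ^ l).
    move=> lu u0; have [ O1 _] := wz u u0.
    have -> : u / p ^ l = (u / p ^ w u) * p ^ `|w u - l|%N%:Z.
      have -> : p ^ `|w u - l|%N%:Z = p ^ (w u - l) by congr (_ ^ _); lia.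
      by rewrite expfzDr // -invr_expz; field; rewrite !expfz_neq0.
    by apply: (pole_ringM hO) => //; exact/OX/nonunitO.
  apply: (val_exponent_ge zz'0 (wz _ zz'0)); rewrite mulrDl.
  by apply: OD; apply: ge => //; lia.
- move=> n; exists (p ^ n); first by rewrite expfz_neq0.
  apply: wE; first by rewrite expfz_neq0.
  rewrite /val_exponent mulfV ?expfz_neq0 // invr1.
  by split; exact: (pole_ring1 hO).
- rewrite ltNge; apply/negP => wx; apply: (pole_ringN hO).
  have [ Ox _] := wz x x_neq0.
  have -> : x = x / p ^ w x * p ^+ `|w x|%N.
    have -> : p ^+ `|w x|%N = p ^ w x by rewrite exprnP; congr (_ ^ _); lia.
    by rewrite divfK // expfz_neq0.
  by apply: (pole_ringM hO) => //; exact/OX/nonunitO.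
Qed.

End PlaceAtPole.

Lemma place_at_pole (k : finFieldType) (K : fieldType) (iota : {rmorphism k -> K}) (x : K) :
  function_field iota -> ~ algebraicOver iota x ->
  exists2 w : K -> int, normalized_valuation w & w x < 0.
Proof.
move=> [[t [t_transc [e [b b_span]]]] _] x_transc.
have [ O hO maxO] := max_pole_ring x_transc.
have [p [p0 mp pgen]] := uniformizer_exists t_transc b_span x_transc hO maxO.
exact: (valuation_of_ring t_transc b_span x_transc hO maxO p0 mp pgen).
Qed.

(** Counting the products [x ^+ l * z i] shows that a family free over [k[x]] has at most [e * C]
    members; one of maximal size spans. *)
Lemma finite_over_transcendental (k : finFieldType) (K : fieldType) (iota : {rmorphism k -> K})
    (x : K) : function_field iota ->
  exists (e : nat) (b : 'I_e -> K), spanning iota x b.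
Proof.
move=> [[t [t_transc [e [b b_span]]]] _].
have [d [C [d0 dC]]] := pow_bounded_comb b_span x.
pose indep n := `[< exists z : 'I_n -> K, forall p : 'I_n -> {poly k},
  \sum_(i < n) (map_poly iota (p i)).[x] * z i = 0 -> forall i, p i = 0 >].
have [] := @ex_maxnP indep (e * C)%N.
- by exists 0%N; apply/asboolP; exists (fun=> 0) => p _ [].
- move=> n /asboolP[z zi]; rewrite leqNgt; apply/negP => nC.
  have [d' [C' [d'0 dC']]] := common_denominator b_span z.
  pose M := (e * C').+1.
  have [|i|/=|c [[[i l] cil] rel]] := @bounded_comb_relation k K iota t e b
    ('I_n * 'I_M)%type (fun i => x ^+ i.2 * z i.1)
    ((map_poly iota d).[t] ^+ M * (map_poly iota d').[t]) (C' + C * M)%N.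
  + by rewrite mulf_neq0 ?ev_neq0 ?expf_ev_neq0.
  + have := dC _ _ _ _ (ltnW (ltn_ord i.2)) (dC' i.1).
    by congr bounded_comb; ring.
  + by rewrite card_prod !card_ord /M; nia.
  have [p [_ pc pE]] := sum_coef_polys iota z x c.
  have := zi p; rewrite pE => /(_ rel i) /(congr1 (fun q : {poly k} => q`_l)) /eqP.
  by rewrite pc coef0 (negPf cil).
move=> n /asboolP[z zi] nmax; exists n, z => u.
have ndep : ~ indep n.+1 by move=> /nmax; rewrite ltnn.
apply: contrapT => H; apply: ndep; apply/asboolP.
exists (fun i => if unlift ord_max i is Some i' then z i' else u) => p.
rewrite big_ord_recr /= unlift_none => rel.
have {}rel : (map_poly iota (p ord_max)).[x] * u =
    \sum_(i < n) (map_poly iota (- p (widen_ord (leqnSn n) i))).[x] * z i.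
  move/eqP: rel; rewrite addrC addr_eq0 => /eqP ->; rewrite -sumrN; apply: eq_bigr => i _.
  by rewrite widen_ord_lift liftK rmorphN hornerN mulNr.
have pmax : p ord_max = 0.
  apply/eqP; apply: contraT => pm; exfalso; apply: H.
  by exists (p ord_max), (fun i => - p (widen_ord (leqnSn n) i)).
move: rel; rewrite pmax rmorph0 horner0 mul0r => /esym /zi zi0 i.
case: (unliftP ord_max i) => [i' ->|->//].
by apply/eqP; rewrite -widen_ord_lift -oppr_eq0 zi0.
Qed.

(** An element [t] with a simple pole at [v] is transcendental, since algebraic elements are
    constants and have valuation 0; taking it as the new parameter makes [v] a pole of [t]. *)
Theorem riemann_inequality (k : finFieldType) (K : fieldType) (iota : {rmorphism k -> K})
    (v : K -> int) (q : nat) (rho : 'I_q -> K) :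
  function_field iota -> normalized_valuation v -> residue_system v rho ->
  exists c : nat, forall a : nat,
    atleast (q ^ a)%N [set x | Rv v x /\ val_ge v (- (a + c)%:Z) x].
Proof.
move=> hK hv hr.
have [t t0 vt] := nval_onto hv (-1).
have t_transc : ~ algebraicOver iota t.
  by case: hK => _ h /h[a ta]; have := nval_const iota a hv; rewrite -ta vt.
have [e [b b_span]] := finite_over_transcendental t hK.
by apply: (riemann_inequality_at_pole t_transc b_span hv hr); rewrite vt.
Qed.

Lemma Rv_small_eq0 (k : finFieldType) (K : fieldType) (iota : {rmorphism k -> K})
    (v : K -> int) (x : K) :
  function_field iota -> normalized_valuation v -> Rv v x -> val_ge v 1 x -> x = 0.
Proof.
move=> hK hv Rx vx; apply/eqP; apply: contraT => x0; exfalso.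
have {}vx : 1 <= v x by move: vx => /(val_ge_nz _ _ x0).
have [ax|nax] := pselect (algebraicOver iota x).
  by case: hK => _ /(_ x ax)[a xa]; have := nval_const iota a hv; rewrite -xa; lia.
have [w hw wx] := place_at_pole hK nax.
have [wv|wv] := pselect (w = v); first by rewrite wv in wx; lia.
by have := Rx w hw wv => /(val_ge_nz _ _ x0); lia.
Qed.

(** * Counting vectors coordinate by coordinate *)

Lemma atleast_prod (T T' : eqType) M N (P : set T) (Q : set T') :
  atleast M P -> atleast N Q -> atleast (M * N) [set x : T * T' | P x.1 /\ Q x.2].
Proof.
move=> [s [us Ms sP]] [s' [us' Ns sQ]]; exists [seq (x, y) | x <- s, y <- s']; split.
- by apply: allpairs_uniq => // -[x y] [x' y'] _ _.
- by rewrite size_allpairs leq_mul.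
- by move=> _ /allpairsP[[x y] [/= /sP px /sQ qy ->]].
Qed.

Lemma atleast_singleton (T : eqType) (P : set T) x : P x -> atleast 1 P.
Proof. by move=> Px; exists [:: x]; split=> // y; rewrite inE => /eqP ->. Qed.

Lemma atleast_col (R : nmodType) m (N : 'I_m -> nat) (P : 'I_m -> set R) :
  (forall i, atleast (N i) (P i)) ->
  atleast (\prod_i N i)%N [set x : 'cV[R]_m | forall i, P i (x i 0)].
Proof.
move=> aN.
suff H g : (g <= m)%N -> atleast (\prod_(i < m | (i < g)%N) N i)%N
    [set x : 'cV[R]_m | forall i : 'I_m, if (i < g)%N then P i (x i 0) else x i 0 = 0].
  have := H m (leqnn m).
  have -> : (\prod_(i < m | (i < m)%N) N i = \prod_i N i)%N by apply: eq_bigl => i; exact: ltn_ord.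
  by apply: atleast_sub => x /= h i; have := h i; rewrite ltn_ord.
elim: g => [_|g IH gm].
  rewrite big_pred0 //; apply: (@atleast_singleton _ _ 0) => i /=; by rewrite mxE.
pose o := Ordinal gm.
rewrite (bigD1 o) ?ltnSn //= mulnC.
have -> : (\prod_(i < m | (i < g.+1)%N && (i != o)) N i = \prod_(i < m | (i < g)%N) N i)%N.
  by apply: eq_bigl => i; rewrite -(inj_eq val_inj) /=; lia.
apply: (atleast_image (f := fun p : 'cV[R]_m * R => \col_i (if i == o then p.2 else p.1 i 0)))
    (atleast_prod (IH (ltnW gm)) (aN o)).
- move=> [x y] [x' y'] [/= hx _] [/= hx' _] /colP E.
  congr (_, _); last by have := E o; rewrite !mxE eqxx.
  apply/colP => i; have := E i; rewrite !mxE; case: eqP => // -> _.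
  by have := hx o; have := hx' o; rewrite /= ltnn => -> ->.
- move=> [x y] [/= hx hy] i; rewrite mxE.
  have [->|io] := eqVneq i o; first by rewrite /= ltnSn.
  have := hx i; have -> : (i < g.+1)%N = (i < g)%N; last by [].
  by move: io; rewrite -(inj_eq val_inj) /=; lia.
Qed.

Lemma Posz_sum (I : finType) (f : I -> nat) : (\sum_i f i)%N%:Z = \sum_i (f i)%:Z.
Proof. exact: (big_morph Posz PoszD erefl). Qed.

Lemma uniform_bound (F : fieldType) (u : F -> int) (I : finType) (f : I -> F) : exists N : nat, forall i, val_ge u (- N%:Z) (f i).
Proof.
exists (\max_i `|u (f i)|)%N => i; right.
by have := leq_bigmax (F := fun i => `|u (f i)|%N) i; move: (\max_i _)%N => N; lia.
Qed.

Lemma nonzero_coord (R : nmodType) h (x : 'cV[R]_h) : x != 0 -> exists i, x i 0 != 0.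
Proof.
move=> x0; apply: contrapT => N; case/eqP: x0; apply/colP => i; rewrite mxE; apply/eqP.
by apply: contraT => xi; exfalso; apply: N; exists i.
Qed.

(** * Sets of times of density zero and the greedy choice of vectors *)

Definition sublinear (f : nat -> nat) : Prop :=
  forall M : nat, exists N0, forall N, (N0 <= N)%N -> (M * f N <= N)%N.

Definition cnt (P : nat -> Prop) (N : nat) : nat := count (fun t => `[< P t >]) (iota 0 N).

Lemma cntS P N : cnt P N.+1 = (cnt P N + `[< P N >])%N.
Proof. by rewrite /cnt -addn1 iotaD add0n count_cat /= addn0. Qed.

Lemma cnt_le P M N : (M <= N)%N -> (cnt P M <= cnt P N)%N.
Proof.
by move=> MN; rewrite /cnt -(subnKC MN) iotaD count_cat leq_addr.
Qed.

Lemma cnt_sub (P Q : nat -> Prop) N : (forall t, P t -> Q t) -> (cnt P N <= cnt Q N)%N.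
Proof. by move=> PQ; apply: sub_count => t /asboolP/PQ/asboolP. Qed.

(** Lifetimes are compared by inclusion, since a vector may stay alive forever. *)
Definition longest_lived (Z : Type) (size_ok alive : nat -> Z -> Prop) (t : nat) (z : Z) : Prop :=
  [/\ size_ok t z, alive t z &
  forall z', size_ok t z' -> alive t z' -> forall t', alive t' z' -> alive t' z].

(* Always keep the vector which stays alive longest among those available when
   the previous one dies: a change costs either a time with no long-lived vector or a long
   waiting time, so that changes are rare. *)
Section Greedy.
Variables (Z : Type) (size_ok alive : nat -> Z -> Prop) (t0 : nat).
Hypothesis size_mono : forall t t' z, (t <= t')%N -> size_ok t z -> size_ok t' z.
Hypothesis alive_mono : forall t t' z, (t <= t')%N -> alive t' z -> alive t z.
Hypothesis size_0 : forall z, ~ size_ok 0 z.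
Hypothesis best_exists : forall t, (t0 <= t)%N -> exists z, longest_lived size_ok alive t z.
Hypothesis long_lived : forall L, sublinear
  (cnt (fun t => ~ exists z, [/\ size_ok t z, alive t z & alive (t + L) z])).

Lemma greedy : exists Con : nat -> Z -> Prop,
  [/\ forall t z, Con t z -> (0 < t)%N /\ size_ok t z /\ ~ size_ok t.-1 z,
      forall t z z', Con t z -> Con t z' -> z = z',
      forall t, (t0 <= t)%N -> exists t' z, [/\ Con t' z, size_ok t z & alive t z]
    & sublinear (cnt (fun t => exists z, Con t z))].
Proof.
have [z0 _] := best_exists (leqnn t0).
have Hbest t : exists z, (t0 <= t)%N -> longest_lived size_ok alive t z.
  have [h|_] := boolP (t0 <= t)%N; last by exists z0.
  by have [z hz] := best_exists h; exists z.
have [best bestP] := choice Hbest.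
(* For an immortal vector the value is [t' = t], so that the sequence [l] below becomes
   stationary. *)
have Hdeath t : exists t', (t0 <= t)%N ->
   (t' = t /\ forall t'', alive t'' (best t)) \/
   [/\ (t < t')%N, ~ alive t' (best t) & forall t'', (t'' < t')%N -> alive t'' (best t)].
  have [im|nim] := pselect (forall t'', alive t'' (best t)); first by exists t; left.
  have ex : exists t', ~~ `[< alive t' (best t) >].
    apply: contrapT => N; apply: nim => t''; apply: contrapT => na; apply: N; exists t''.
    exact/asboolPn.
  exists (ex_minn ex) => tt; case: ex_minnP => d /asboolPn nd dmin; right.
  have lt t'' : (t'' < d)%N -> alive t'' (best t).
    by move=> td; apply: contrapT => /asboolPn /dmin; rewrite leqNgt td.
  split=> //; rewrite ltnNge; apply/negP => dt; apply: nd.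
  by have [_ al _] := bestP t tt; apply: alive_mono al.
have [death deathP] := choice Hdeath.
pose l i := iter i death t0.
pose z i := best (l i).
have lS i : l i.+1 = death (l i) by [].
have l_ge i : (t0 <= l i)%N.
  elim: i => // i IH; rewrite lS; case: (deathP _ IH) => [[-> _]//|[h _ _]].
  exact: leq_trans IH (ltnW h).
have l_le i : (l i <= l i.+1)%N.
  by rewrite lS; case: (deathP _ (l_ge i)) => [[-> _]//|[/ltnW]].
have l_mono i j : (i <= j)%N -> (l i <= l j)%N.
  by move=> ij; apply: (homo_leq _ leq_trans) ij.
have cover t : (t0 <= t)%N -> exists i, (l i <= t)%N /\ alive t (z i).
  move=> tt; apply: contrapT => N.
  have H i : (l i <= t)%N /\ (i <= l i)%N.
    elim: i => // i [li il].
    case: (deathP _ (l_ge i)) => [[_ im]|[d1 d2 d3]]; first by exfalso; apply: N; exists i.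
    rewrite lS; split; last exact: leq_ltn_trans il d1.
    by rewrite leqNgt; apply/negP => td; apply: N; exists i; split=> //; exact: d3.
  by have [h1 h2] := H t.+1; have := leq_trans h2 h1; rewrite ltnn.
(* A vector chosen after time [l i] was not yet [size_ok] at [l i]: otherwise the vector kept just
   before it, which lives at least as long, would not have died. *)
have fresh i j : (l i < l j)%N -> ~ size_ok (l i) (z j).
  elim: j => [|j IH] ij sz.
    by have := l_mono 0%N i (leq0n i); rewrite leqNgt ij.
  have [e|ne] := eqVneq (l j) (l j.+1).
    by rewrite -e in ij; apply: (IH ij); move: sz; rewrite /z e.
  have ltj : (l j < l j.+1)%N by rewrite ltn_neqAle ne l_le.
  case: (deathP _ (l_ge j)) => [[e _]|[_ d2 d3]]; first by rewrite lS e eqxx in ne.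
  have ilj : (l i <= l j)%N.
    rewrite leqNgt; apply/negP => lji; have : (j < i)%N.
      by rewrite ltnNge; apply/negP => /l_mono; rewrite leqNgt lji.
    by move=> /l_mono; rewrite leqNgt ij.
  apply: d2; have [_ al _] := bestP _ (l_ge j.+1); have [_ _ mx] := bestP _ (l_ge j).
  apply: (mx (z j.+1)); first exact: size_mono sz.
    by apply: alive_mono al.
  by rewrite -lS.
(* A vector is registered at its birth, the first time it is [size_ok], and not at the time [l i]
   when it is chosen: the digits of theta that control it are those of the round of its birth. *)
pose Con t y := exists i, [/\ y = z i, (0 < t)%N, size_ok t y & ~ size_ok t.-1 y].
have Con_le t i : (0 < t)%N -> ~ size_ok t.-1 (z i) -> (t <= l i)%N.
  move=> t1 ns; rewrite leqNgt; apply/negP => lt; apply: ns.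
  have [sz _ _] := bestP _ (l_ge i).
  by apply: size_mono sz; case: t t1 lt.
exists Con; split.
- by move=> t y [i [_ t1 s1 s2]].
- move=> t _ _ [i [-> t1 si nsi]] [j [-> _ sj nsj]].
  have key a c : size_ok t (z c) -> ~ size_ok t.-1 (z a) -> ~ (l a < l c)%N.
    by move=> sc nsa lt; apply: (fresh a c lt); apply: size_mono sc; exact: Con_le.
  have [lt|lt|e] := ltngtP (l i) (l j); last by rewrite /z e.
    by case: (key i j).
  by case: (key j i).
- move=> t tt; have [i [li al]] := cover t tt.
  have [sz _ _] := bestP _ (l_ge i).
  have ex : exists t', `[< size_ok t' (z i) >] by exists (l i); apply/asboolP.
  exists (ex_minn ex), (z i); case: ex_minnP => d /asboolP sd dmin.
  split=> //; last exact: size_mono sz.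
  have d0 : (0 < d)%N by case: d sd {dmin} => // /size_0.
  exists i; split=> // /asboolP /dmin.
  by case: d d0 {sd dmin} => //= d _; rewrite ltnn.
- move=> M; pose L := (4 * M)%N.
  have [N0 HN0] := long_lived L L.
  exists (maxn N0 L) => N; rewrite geq_max => /andP[/HN0 badN LN].
  set bad := fun t => _ in badN.
  have count_changes J : (forall i, (i < J)%N -> (l i < l i.+1)%N) ->
      (L * J <= l J + L * cnt bad (l J))%N.
    elim: J => [|J IH] st; first by rewrite muln0.
    have {}IH := IH (fun i iJ => st i (ltnW iJ)).
    have ltJ := st J (ltnSn J).
    have [bJ|/contrapT[y [y1 y2 y3]]] := pselect (bad (l J)).
      have : (cnt bad (l J).+1 <= cnt bad (l J.+1))%N by apply: cnt_le.
      rewrite cntS (asboolT bJ) addn1 => hc.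
      have : (L * (cnt bad (l J)).+1 <= L * cnt bad (l J.+1))%N by rewrite leq_mul2l hc orbT.
      by rewrite !mulnS; move: ltJ IH; lia.
    have [_ _ mx] := bestP _ (l_ge J).
    have zL := mx y y1 y2 _ y3.
    case: (deathP _ (l_ge J)) => [[e _]|[_ d2 d3]]; first by rewrite lS e ltnn in ltJ.
    have : (l J + L < l J.+1)%N.
      rewrite ltnNge; apply/negP => le; apply: d2; rewrite -lS.
      exact: alive_mono zL.
    have : (L * cnt bad (l J) <= L * cnt bad (l J.+1))%N.
      by rewrite leq_mul2l cnt_le ?orbT // ltnW.
    by rewrite mulnS; move: IH; lia.
  have [J [strictJ lastJ]] : exists J, (forall i, (i < J)%N -> (l i < l i.+1)%N /\ (l i < N)%N) /\
       ((l J = l J.+1) \/ (N <= l J)%N).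
    have ex : exists J, (l J == l J.+1) || (N <= l J)%N.
      apply: contrapT => H.
      have st i : (l i < l i.+1)%N /\ (l i < N)%N.
        have : ~~ ((l i == l i.+1) || (N <= l i)%N) by apply/negP => h; apply: H; exists i.
        by rewrite negb_or -ltnNge => /andP[h1 h2]; rewrite ltn_neqAle h1 l_le.
      have ge i : (i <= l i)%N.
        by elim: i => // i IH; apply: leq_ltn_trans IH _; case: (st i).
      by have [_] := st N; rewrite ltnNge ge.
    exists (ex_minn ex); case: ex_minnP => J /orP hJ Jmin; split; last first.
      by case: hJ => [/eqP|]; [left|right].
    move=> i iJ; have : ~~ ((l i == l i.+1) || (N <= l i)%N).
      by apply/negP => /Jmin; rewrite leqNgt iJ.
    by rewrite negb_or -ltnNge => /andP[h1 h2]; rewrite ltn_neqAle h1 l_le.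
  have cntJ : (cnt (fun t => exists y, Con t y) N <= J.+1)%N.
    have Hi t : exists i, (exists y, Con t y) -> Con t (z i) /\ forall j, Con t (z j) -> (i <= j)%N.
      have [[y [i0 [-> t1 s1 s2]]]|ny] := pselect (exists y, Con t y); last by exists 0%N.
      have ex : exists i, `[< Con t (z i) >] by exists i0; apply/asboolP; exists i0.
      exists (ex_minn ex) => _; case: ex_minnP => i /asboolP hi imin; split=> // j hj.
      by apply: imin; apply/asboolP.
    have [ii iiP] := choice Hi.
    rewrite /cnt -size_filter; set S := seq.filter _ _.
    have SP t : t \in S -> (t < N)%N /\ exists y, Con t y.
      by rewrite mem_filter mem_iota => /andP[/asboolP h1 /andP[_ h2]].
    rewrite -(size_map ii) -(size_iota 0 J.+1); apply: uniq_leq_size.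
      rewrite map_inj_in_uniq ?filter_uniq ?iota_uniq // => t t' /SP[_ ct] /SP[_ ct'] e.
      have [[_ [_ t1 s1 n1]] _] := iiP t ct.
      have [[_ [_ t1' s1' n1']] _] := iiP t' ct'.
      rewrite -e in s1' n1'.
      have H a c : (0 < c)%N -> size_ok a (z (ii t)) -> ~ size_ok c.-1 (z (ii t)) -> (c <= a)%N.
        move=> c0 sa nc; rewrite leqNgt; apply/negP => ac; apply: nc; apply: size_mono sa.
        by case: c c0 ac.
      by apply/eqP; rewrite eqn_leq (H t' t) // (H t t').
    move=> _ /mapP[t /SP[tN ct] ->]; rewrite mem_iota add0n /= ltnS leqNgt; apply/negP => Ji.
    have [[_ [_ t1 s1 n1]] imin] := iiP t ct.
    have [e|ne] := eqVneq (l J) (l (ii t)).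
      have : (ii t <= J)%N.
        by apply: imin; exists J; rewrite /z e.
      by rewrite leqNgt Ji.
    have ltJ : (l J < l (ii t))%N by rewrite ltn_neqAle ne l_mono // ltnW.
    case: lastJ => [st|NJ].
      have cst j : l (J + j)%N = l J.
        by elim: j => [|j IH]; rewrite ?addn0 // addnS lS IH -lS -st.
      by move: ltJ; rewrite -(subnKC (ltnW Ji)) cst ltnn.
    by apply: (fresh J (ii t) ltJ); apply: size_mono s1; exact: leq_trans (ltnW tN) NJ.
  have boundJ : (L * J.-1 <= N + L * cnt bad N)%N.
    case: J strictJ {lastJ cntJ} => [|J] strictJ /=; first by rewrite muln0.
    have [_ lJN] := strictJ J (ltnSn J).
    apply: leq_trans (count_changes J _) _.
      by move=> i iJ; case: (strictJ i (ltnW iJ)).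
    by rewrite leq_add ?leq_mul2l ?(ltnW lJN) //= cnt_le ?orbT // ltnW.
  move: cntJ boundJ badN LN; rewrite /L; move: (cnt _ N) (cnt bad N) => c c'.
  by case: J {strictJ lastJ} => [|J] /=; nia.
Qed.

End Greedy.

(** * A Cantor construction that escapes a given cover *)

Definition visits (m : nat) (e : nat -> 'I_m) (k : nat) (j : 'I_m) : nat :=
  (\sum_(0 <= l < k) (e l == j))%N.

Lemma visitsS m (e : nat -> 'I_m) k j : visits e k.+1 j = (visits e k j + (e k == j))%N.
Proof. by rewrite /visits big_nat_recr. Qed.

(** A round of [S] steps gives [r j] digits to coordinate [j], so that after full rounds the boxes
    are balls of the [r]-norm; fixing one digit per step gives every box exactly [q] children. *)
Lemma periodic_visits m (r : 'I_m -> nat) : (0 < m)%N -> (forall j, (0 < r j)%N) ->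
  exists e : nat -> 'I_m, forall t j, visits e ((\sum_j r j) * t) j = (r j * t)%N.
Proof.
move=> m0 r0; pose rr := flatten [seq nseq (r j) j | j <- enum 'I_m].
have szr : size rr = (\sum_j r j)%N.
  by rewrite size_flatten /shape -map_comp sumnE big_map big_enum; apply: eq_bigr => j _; rewrite /= size_nseq.
have cnt_rr j : count (pred1 j) rr = r j.
  rewrite count_flatten -map_comp sumnE big_map big_enum /= (bigD1 j) //=.
  rewrite count_nseq /= eqxx mul1n big1 ?addn0 // => i ij.
  by rewrite count_nseq /= (negPf ij).
pose j0 := Ordinal m0; pose S := (\sum_j r j)%N.
have S0 : (0 < S)%N by rewrite /S (bigD1 j0) //= addn_gt0 r0.
exists (fun k => nth j0 rr (k %% S)) => t j.
elim: t => [|t IH]; first by rewrite !muln0 /visits big_nil.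
rewrite mulnS addnC /visits (big_cat_nat (n := (S * t)%N)) //= ?leq_addr // -/(visits _ _ _) IH mulnS addnC.
congr (_ + _)%N.
rewrite -{1}(add0n (S * t)%N) big_addn addKn.
rewrite -[RHS](cnt_rr j) -sum1_count [RHS](big_nth j0) szr [RHS]big_mkcond /=.
rewrite !big_nat; apply: eq_bigr => i /andP[_ iS].
by rewrite addnC mulnC modnMDl modn_small //; case: eqP.
Qed.

Section Cantor.
Variables (R : realType) (F : fieldType) (u : F -> int).
Hypothesis hu : normalized_valuation u.
Hypothesis hcomp : complete_valuation u.
Variables (q : nat) (rho : 'I_q -> F) (p : F).
Hypotheses (hrho : residue_system u rho) (p0 : p != 0) (up : u p = 1).
Variables (m : nat) (r : 'I_m -> nat) (e : nat -> 'I_m).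
Hypothesis r0 : forall j, (0 < r j)%N.
Local Notation S := (\sum_j r j)%N.
Hypothesis eS : forall t j, visits e (S * t) j = (r j * t)%N.
Variables (Forb : nat -> 'cV[F]_m -> 'I_q -> Prop) (fb : nat -> bool).
Hypothesis Forb1 : forall k th d d', Forb k th d -> Forb k th d' -> d = d'.
Hypothesis Forb_fb : forall k th d, Forb k th d -> fb k.

Local Notation b := ((q%:R : R)^-1).
Definition fcount (k : nat) : nat := (\sum_(0 <= l < k) fb l)%N.

Definition child k (th : 'cV[F]_m) (d : 'I_q) : 'cV[F]_m :=
  \col_j (th j 0 + if j == e k then rho d * p ^+ visits e k j else 0).

Definition meets k (th c : 'cV[F]_m) (w : nat) : Prop :=
  forall j, val_ge u (minn w (visits e k j))%:Z (th j 0 - c j 0).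

(* The Haar measure of the intersection of the box with exponents [visits e k]
   around [th] and the ball of radius [q ^ -w] around [c]. *)
Definition overlap k (th c : 'cV[F]_m) (w : nat) : R :=
  if `[< meets k th c w >] then b ^+ (\sum_j maxn w (visits e k j))%N else 0.

Let q1 : (1 < q)%N := residue_system_gt1 hu hrho.

Lemma b_gt0 : 0 < b. Proof. by rewrite invr_gt0 ltr0n ltnW. Qed.

Lemma overlap_ge0 k th c w : 0 <= overlap k th c w.
Proof. by rewrite /overlap; case: ifP => // _; rewrite exprn_ge0 // ltW // b_gt0. Qed.

Lemma visits_le k j : (visits e k j <= visits e k.+1 j)%N.
Proof. by rewrite visitsS leq_addr. Qed.

Lemma child_meets k th c w d : meets k.+1 (child k th d) c w -> meets k th c w.
Proof.
move=> h j; have := h j; rewrite mxE; have [->|je] := eqVneq j (e k); last first.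
  rewrite /= addr0; apply: (@val_ge_le _ u).
  by have := visits_le k j; lia.
move=> h1; have v1 := visits_le k (e k).
have h2 : val_ge u (minn w (visits e k (e k)))%:Z (rho d * p ^+ visits e k (e k)).
  rewrite -[_%:Z]add0r; apply: (val_geM hu); first by case: hrho => -[].
  by apply: val_ge_le (val_ge_pX hu p0 up _); lia.
rewrite (_ : th _ 0 - c _ 0 = th (e k) 0 + rho d * p ^+ visits e k (e k) - c (e k) 0
   - rho d * p ^+ visits e k (e k)); last by ring.
by apply: (val_geB hu) => //; apply: val_ge_le h1; lia.
Qed.

(** If in direction [e k] the box is already inside the ball, each child has at most [1 / q] of the
    overlap; otherwise at most one child meets the ball. *)
Lemma overlap_children k th c w :
  \sum_(d < q) overlap k.+1 (child k th d) c w <= overlap k th c w.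
Proof.
have [mt|nmt] := pselect (meets k th c w); last first.
  rewrite big1 ?overlap_ge0 // => d _; rewrite /overlap.
  by case: asboolP => // /child_meets.
have [wv|vw] := leqP w (visits e k (e k)).
  apply: (@le_trans _ _ (\sum_(d < q) b * b ^+ (\sum_j maxn w (visits e k j))%N)).
    apply: ler_sum => d _; rewrite {1}/overlap; case: asboolP => _; last first.
      by rewrite mulr_ge0 ?exprn_ge0 ?(ltW b_gt0).
    rewrite -exprS; rewrite (_ : (\sum_j maxn w (visits e k.+1 j) = (\sum_j maxn w (visits e k j)).+1)%N) //.
    rewrite (bigD1 (e k)) // [in RHS](bigD1 (e k)) //= visitsS eqxx -addSn; congr (_ + _)%N; first by lia.
    by apply: eq_bigr => j je; rewrite visitsS eq_sym (negPf je) addn0.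
  rewrite sumr_const card_ord -[X in X <= _]mulr_natl mulrA mulfV ?mul1r ?pnatr_eq0 -?lt0n ?(ltnW q1) //.
  by rewrite /overlap (asboolT mt).
have ovE d : overlap k.+1 (child k th d) c w =
    if `[< meets k.+1 (child k th d) c w >] then overlap k th c w else 0.
  rewrite /overlap (asboolT mt); case: ifP => // _; congr (_ ^+ _).
  apply: eq_bigr => j _; rewrite visitsS; case: eqP => [<-|_]; last by rewrite addn0.
  by lia.
have uniq_d d d' : meets k.+1 (child k th d) c w -> meets k.+1 (child k th d') c w -> d = d'.
  move=> /(_ (e k)) h /(_ (e k)) h'; case: hrho => -[_ inj] _; apply: inj.
  rewrite (_ : 1 = (visits e k (e k)).+1%:Z - (visits e k (e k))%:Z); last by lia.
  apply: (val_ge_mul_pXz hu p0 up); rewrite -exprnP.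
  move: h h'; rewrite !mxE eqxx visitsS eqxx addn1 (minn_idPr _) // => h h'.
  rewrite (_ : _ * _ = th (e k) 0 + rho d * p ^+ visits e k (e k) - c (e k) 0
    - (th (e k) 0 + rho d' * p ^+ visits e k (e k) - c (e k) 0)); last by ring.
  exact: (val_geB hu).
under eq_bigr do rewrite ovE.
have [[d hd]|nd] := pselect (exists d, meets k.+1 (child k th d) c w); last first.
  rewrite big1 ?overlap_ge0 // => d _; case: asboolP => // h.
  by exfalso; apply: nd; exists d.
rewrite (bigD1 d) //= big1 ?addr0; first by case: ifP => // _; exact: overlap_ge0.
move=> d' dd'; case: asboolP => // h; case/eqP: dd'; exact: uniq_d.
Qed.

Variables (c : nat -> 'cV[F]_m) (w : nat -> nat).

(** If the limit point lay in ball [i], then at step [S * w i] the box would be inside that ball and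
    the single term [i] would equal [weight (S * w i)]; the factor [q ^ fcount] is chosen for this
    contradiction. *)
Definition potential k th : \bar R :=
  (\sum_(0 <= i <oo) ((q%:R ^+ fcount (S * w i) * overlap k th (c i) (w i))%:E))%E.

Lemma potential_term_ge0 k th i : (0 <= (q%:R ^+ fcount (S * w i) * overlap k th (c i) (w i))%:E)%E.
Proof. by rewrite lee_fin mulr_ge0 ?overlap_ge0 // exprn_ge0. Qed.

Lemma potential_children k th :
  (\sum_(d < q) potential k.+1 (child k th d) <= potential k th)%E.
Proof.
rewrite /potential -(@nneseries_sum _ (index_enum 'I_q) xpredT R
  (fun d i => (q%:R ^+ fcount (S * w i) * overlap k.+1 (child k th d) (c i) (w i))%:E)); last first.
  by move=> d i _; exact: potential_term_ge0.
apply: lee_nneseries => [i _ _|i _]; first by apply: sume_ge0 => d _; exact: potential_term_ge0.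
rewrite sumEFin lee_fin -mulr_sumr ler_wpM2l ?exprn_ge0 //.
exact: overlap_children.
Qed.

Definition weight k : R := b ^+ k * q%:R ^+ fcount k.

(** At an ordinary step the potentials of the [q] children average at most [1 / q] of the parent's,
    and the threshold shrinks by the same factor. At a step that may forbid a digit the threshold
    stays constant, so any one allowed child will do. *)
Lemma good_child k th : (potential k th < (weight k)%:E)%E ->
  exists d, ~ Forb k th d /\ (potential k.+1 (child k th d) < (weight k.+1)%:E)%E.
Proof.
move=> small; apply: contrapT => N.
have big d : ~ Forb k th d -> ((weight k.+1)%:E <= potential k.+1 (child k th d))%E.
  by move=> nf; rewrite leNgt; apply/negP => lt; apply: N; exists d.
move: small; rewrite ltNge => /negP; apply; apply: le_trans (potential_children k th).
have pge0 d : (0 <= potential k.+1 (child k th d))%E.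
  by apply: nneseries_ge0 => i _ _; exact: potential_term_ge0.
have bq : b * q%:R = 1 by rewrite mulVf // pnatr_eq0 -lt0n ltnW.
have weightS : weight k.+1 = weight k * (b * q%:R ^+ fb k).
  by rewrite /weight /fcount big_nat_recr //= exprD exprSr; ring.
have [fk|nfk] := boolP (fb k); last first.
  apply: (@le_trans _ _ (\sum_(d < q) (weight k.+1)%:E)%E).
    rewrite sumEFin lee_fin sumr_const card_ord weightS (negPf nfk) expr0 mulr1 -[X in _ <= X]mulr_natr.
    by rewrite -mulrA bq mulr1.
  by apply: lee_sum => d _; apply: big => /Forb_fb; rewrite (negPf nfk).
have [d0 Hd0] : exists d0, forall d, d != d0 -> ~ Forb k th d.
  have [[d hd]|nd] := pselect (exists d, Forb k th d).
    by exists d => d' /eqP dd' h; apply: dd'; exact: Forb1 h hd.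
  by exists (Ordinal (ltnW q1)) => d _ h; apply: nd; exists d.
have [d1 d10] : exists d1, d1 != d0.
  case: d0 {Hd0} => [[|i] hi]; first by exists (Ordinal q1).
  by exists (Ordinal (ltnW q1)).
rewrite (bigD1 d1) //=; apply: (@le_trans _ _ (potential k.+1 (child k th d1))); last first.
  by rewrite leeDl //; apply: sume_ge0.
apply: le_trans (big d1 (Hd0 d1 d10)).
by rewrite lee_fin weightS fk expr1 bq mulr1.
Qed.

Lemma small_path : (potential 0 0 < 1)%E ->
  exists th : nat -> 'cV[F]_m, [/\ th 0%N = 0,
    forall k, exists d, th k.+1 = child k (th k) d /\ ~ Forb k (th k) d
  & forall k, (potential k (th k) < (weight k)%:E)%E].
Proof.
move=> start.
have H kth : exists d, (potential kth.1 kth.2 < (weight kth.1)%:E)%E ->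
   ~ Forb kth.1 kth.2 d /\ (potential kth.1.+1 (child kth.1 kth.2 d) < (weight kth.1.+1)%:E)%E.
  have [h|nh] := pselect (potential kth.1 kth.2 < (weight kth.1)%:E)%E.
    by have [d hd] := good_child h; exists d.
  by exists (Ordinal (ltnW q1)).
have [dd ddP] := choice H.
pose th := fix th k := if k is k'.+1 then child k' (th k') (dd (k', th k')) else 0.
have inv k : (potential k (th k) < (weight k)%:E)%E.
  elim: k => [|k IH]; first by rewrite /weight /fcount big_nil !expr0 mulr1.
  by have [_] := ddP (k, th k) IH.
exists th; split=> // k; exists (dd (k, th k)); split=> //.
by have [] := ddP (k, th k) (inv k).
Qed.

Lemma sum_rS t : (\sum_j r j * t = S * t)%N.
Proof. by rewrite big_distrl. Qed.

Theorem avoiding_point : (potential 0 0 < 1)%E ->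
  exists (th : nat -> 'cV[F]_m) (l : 'cV[F]_m), [/\
    forall k, exists d, th k.+1 = child k (th k) d /\ ~ Forb k (th k) d,
    forall k j, val_ge u (visits e k j)%:Z (l j 0 - th k j 0)
  & forall i, ~ forall j, val_ge u (w i)%:Z (l j 0 - c i j 0)].
Proof.
move=> /small_path[th [_ path small]].
have step k k' j : (k <= k')%N -> val_ge u (visits e k j)%:Z (th k' j 0 - th k j 0).
  move=> kk'; rewrite -(subnKC kk'); elim: (k' - k)%N => [|i IH].
    by rewrite addn0 subrr; left.
  rewrite addnS; apply: (val_ge_trans hu _ IH).
  have [d [-> _]] := path (k + i)%N; rewrite mxE addrC addKr.
  case: eqP => [je|_]; last by left.
  rewrite -[_%:Z]add0r; apply: (val_geM hu); first by case: hrho => -[].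
  apply: val_ge_le (val_ge_pX hu p0 up _).
  by elim: i {IH d je} => [|i IH]; rewrite ?addn0 // addnS (le_trans IH) // lez_nat visits_le.
have large (N : int) j : exists n0, forall k, (n0 <= k)%N -> N <= (visits e k j)%:Z.
  exists (S * `|N|)%N => k hk.
  have : (visits e (S * `|N|) j <= visits e k j)%N.
    rewrite -(subnKC hk); elim: (k - _)%N => [|i IH]; rewrite ?addn0 // addnS.
    exact: leq_trans IH (visits_le _ _).
  by rewrite eS; have := r0 j; move: (r j) (visits e k j) => a b'; nia.
have Hl j : exists l : F, forall N : int, exists n0 : nat, forall k : nat,
    (n0 <= k)%N -> val_ge u N (th k j 0 - l).
  apply: hcomp => N; have [n0 hn0] := large N j; exists n0 => k k' hk hk'.
  apply: (val_ge_trans hu (y := th n0 j 0)).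
    by apply: val_ge_le (step n0 k j hk); exact: hn0.
  by apply/(val_geBC hu)/(val_ge_le (hn0 _ (leqnn _)))/step.
have [l lP] := choice Hl.
have llim k j : val_ge u (visits e k j)%:Z (l j - th k j 0).
  have [n0 hn0] := lP j (visits e k j)%:Z.
  apply: (val_ge_trans hu (y := th (maxn n0 k) j 0)).
    by apply/(val_geBC hu)/hn0; rewrite leq_maxl.
  by apply: step; rewrite leq_maxr.
exists th, (\col_j l j); split=> // [k j|i]; first by rewrite mxE.
move=> cov; have := small (S * w i)%N; rewrite ltNge => /negP; apply.
have mt : meets (S * w i) (th (S * w i)%N) (c i) (w i).
  move=> j; have := cov j; rewrite mxE eS => h.
  have wr : (w i <= r j * w i)%N by rewrite leq_pmull.
  rewrite (minn_idPl wr).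
  apply: (val_ge_trans hu (y := l j)) => //.
  apply/(val_geBC hu); apply: val_ge_le (llim (S * w i)%N j); rewrite eS; lia.
rewrite /potential (nneseriesD1 (n := i)) //; last by move=> ? _; exact: potential_term_ge0.
apply: (@le_trans _ _ ((q%:R ^+ fcount (S * w i) * overlap (S * w i) (th (S * w i)%N) (c i) (w i))%:E)).
  rewrite lee_fin /weight /overlap (asboolT mt) mulrC.
  have -> : (\sum_j maxn (w i) (visits e (S * w i) j) = S * w i)%N.
    rewrite -[RHS]sum_rS; apply: eq_bigr => j _; rewrite eS; apply/maxn_idPr.
    by rewrite leq_pmull.
  exact: lexx.
rewrite leeDl //; apply: nneseries_ge0 => ? _ _; exact: potential_term_ge0.
Qed.

End Cantor.

(** * Norms, balls and Hausdorff measure *)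

Lemma double_nneseries (R : realType) : exists f : nat -> nat * nat,
  (forall k l, exists i, f i = (k, l)) /\
  forall a : nat -> nat -> \bar R, (forall k l, (0 <= a k l)%E) ->
  (\sum_(0 <= i <oo) a (f i).1 (f i).2 = \sum_(0 <= k <oo) \sum_(0 <= l <oo) a k l)%E.
Proof.
have /card_esym/ppcard_eqP[f] := card_nat2.
have fb : set_bij [set: nat] [set: nat * nat] f by exact: bij.
exists f; split.
  by move=> k l; have [i _ fi] := set_bij_surj fb (I : [set: nat * nat] (k, l)); exists i.
move=> a a0; rewrite nneseries_esumT; last by move=> i; exact: a0.
rewrite -(@reindex_esum R _ _ _ _ f (fun p => a p.1 p.2) fb).
have -> : [set: nat * nat] = [set: nat] `*`` (fun=> [set: nat]).
  by apply/seteqP; split.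
rewrite -esum_esum // nneseries_esumT; last by move=> k; exact: nneseries_ge0.
by apply: eq_esum => k _; rewrite nneseries_esumT.
Qed.

Section Norms.
Variables (R : realType) (F : fieldType) (u : F -> int) (q : nat).
Hypothesis hu : normalized_valuation u.
Hypothesis q1 : (1 < q)%N.
Local Notation Q := (q%:R : R).

Lemma Q_gt1 : 1 < Q. Proof. by rewrite ltr1n. Qed.
Lemma Q_gt0 : 0 < Q. Proof. exact: lt_trans ltr01 Q_gt1. Qed.

Lemma Qz_ge0 (z : int) : 0 <= Q ^ z. Proof. by rewrite exprz_ge0 // ltW // Q_gt0. Qed.
Lemma QV_ge0 N : 0 <= Q ^- N. Proof. by rewrite exprnN Qz_ge0. Qed.
Lemma QV_gt0 N : 0 < Q ^- N. Proof. by rewrite invr_gt0 exprn_gt0 // Q_gt0. Qed.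

Lemma absv_ge0 x : 0 <= absv R u q x.
Proof. by rewrite /absv; case: ifP => // _; rewrite Qz_ge0. Qed.

Lemma absv_le x (N : int) : absv R u q x <= Q ^ (- N) <-> val_ge u N x.
Proof.
rewrite /absv; case: eqVneq => [->|x0].
  by split=> _; [left | rewrite Qz_ge0].
by rewrite ler_eXz2l ?Q_gt1 // lerN2 (val_ge_nz u N x0).
Qed.

Lemma max_norm_le m (x : 'cV[F]_m) (N : int) :
  max_norm R u q x <= Q ^ (- N) <-> forall j, val_ge u N (x j 0).
Proof.
split=> [h j|h]; first by apply/absv_le; apply: le_trans h; exact: le_bigmax.
by apply: bigmax_le => [|j _]; [rewrite Qz_ge0 | apply/absv_le].
Qed.

Lemma wnorm_ge0 m r (x : 'cV[F]_m) : 0 <= wnorm R u q r x.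
Proof.
rewrite /wnorm; elim/big_ind: _ => [//|a b a0 b0|i _]; first by rewrite le_max a0.
exact: powR_ge0.
Qed.

Lemma root_le (a : R) (k : nat) (z : int) : (0 < k)%N -> 0 <= a ->
  (a `^ (k%:R^-1) <= Q ^ z) = (a <= Q ^ (z * k%:Z)).
Proof.
move=> k0 a0; have z0 : 0 <= Q ^ z by rewrite Qz_ge0.
rewrite -exprz_exp -exprnP -(ler_pXn2r k0) ?nnegrE ?powR_ge0 //.
by rewrite -powR_mulrn ?powR_ge0 // -powRrM mulVf ?powRr1 // pnatr_eq0 -lt0n.
Qed.

Lemma wnorm_le m (r : 'I_m -> nat) (x : 'cV[F]_m) (z : int) : (forall j, (0 < r j)%N) ->
  wnorm R u q r x <= Q ^ z <-> forall j, val_ge u (- (z * (r j)%:Z)) (x j 0).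
Proof.
move=> r0; have e j : (absv R u q (x j 0) `^ ((r j)%:R^-1) <= Q ^ z) <-> val_ge u (- (z * (r j)%:Z)) (x j 0).
  by rewrite root_le ?absv_ge0 //; have := absv_le (x j 0) (- (z * (r j)%:Z)); rewrite opprK.
split=> [h j|h]; first by apply/e; apply: le_trans h; exact: le_bigmax.
by apply: bigmax_le => [|j _]; [rewrite Qz_ge0 | apply/e].
Qed.

Definition ball_at m (c : 'cV[F]_m) (N : int) : set 'cV[F]_m :=
  [set x | forall j, val_ge u N (x j 0 - c j 0)].

Local Notation dist m := (fun x y : 'cV[F]_m => max_norm R u q (x - y)).

Lemma dist_le m (x y : 'cV[F]_m) (N : int) :
  max_norm R u q (x - y) <= Q ^ (- N) <-> forall j, val_ge u N (x j 0 - y j 0).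
Proof.
by rewrite max_norm_le; split=> h j; have := h j; rewrite !mxE.
Qed.

Lemma diameter_ge0 m (U : set 'cV[F]_m) : (0 <= diameter (dist m) U)%E.
Proof. by apply: ereal_sup_ubound; left. Qed.

Lemma diameter_ball m (c : 'cV[F]_m) (N : int) :
  (diameter (dist m) (ball_at c N) <= (Q ^ (- N))%:E)%E.
Proof.
apply: ge_ereal_sup => z [->|[x [y [xc yc ->]]]].
  by rewrite lee_fin Qz_ge0.
rewrite lee_fin; apply/dist_le => j.
by apply: (val_ge_trans hu (xc j)); exact/(val_geBC hu)/yc.
Qed.

Lemma diameter_set0 m : diameter (dist m) set0 = 0%E.
Proof.
apply/eqP; rewrite eq_le diameter_ge0 andbT; apply: ge_ereal_sup => z [->//|].
by move=> [x [y []]].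
Qed.

Lemma Q_small (eps : R) : 0 < eps -> exists N : nat, Q ^- N <= eps.
Proof.
move=> e0; have [N hN] : exists N : nat, eps^-1 < N%:R by exists (Num.bound eps^-1); apply: archi_boundP; rewrite invr_ge0 ltW.
exists N; rewrite invf_ple ?posrE ?exprn_gt0 ?Q_gt0 //; apply/ltW/(lt_le_trans hN).
by rewrite -natrX ler_nat ltnW // ltn_expl.
Qed.

(** A set in an ultrametric space lies in the ball around any of its points with its diameter as
    radius. The factor [Q ^ s] pays for rounding the radius up to a power of [Q], and [eta] for sets
    of diameter 0, which have no smallest such radius. *)
Lemma small_set_in_ball m (U : set 'cV[F]_m) (s eta : R) : 0 < s -> 0 < eta ->
  (diameter (dist m) U <= 1)%E ->
  exists (c : 'cV[F]_m) (w : nat), U `<=` ball_at c w%:Z /\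
    (((Q ^- w) `^ s)%:E <= (Q `^ s)%:E * (diameter (dist m) U `^ s)%E + eta%:E)%E.
Proof.
move=> s0 eta0; move: (diameter_ge0 U); move dE: (diameter (dist m) U) => d; case: d dE => // d dE d0 d1.
have [c Uc] : exists c, U c \/ U = set0.
  by have [U0|/set0P[c Uc]] := eqVneq U set0; [exists 0; right | exists c; left].
have inball (w : nat) : d <= Q ^- w -> U `<=` ball_at c w%:Z.
  move=> dw x Ux; apply/dist_le; rewrite -exprnN; apply: le_trans dw; rewrite -lee_fin -dE.
  case: Uc => [Uc|U0]; last by rewrite U0 in Ux.
  by apply: ereal_sup_ubound; right; exists x, c.
rewrite lee_fin in d0; rewrite lee_fin in d1.
have [d00|dn0] := eqVneq d 0.
  have [w hw] := Q_small (powR_gt0 s^-1 eta0); exists c, w; split.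
    by apply: inball; rewrite d00 QV_ge0.
  apply: (@le_trans _ _ eta%:E); last by rewrite leeDr // poweR_EFin -EFinM lee_fin mulr_ge0 ?powR_ge0.
  rewrite lee_fin; have -> : eta = (eta `^ s^-1) `^ s.
    by rewrite -powRrM mulVf ?powRr1 ?ltW ?lt0r_neq0.
  apply: ge0_ler_powR => //; first exact: ltW.
    by rewrite nnegrE QV_ge0.
  by rewrite nnegrE powR_ge0.
have {dn0} d00 : 0 < d by rewrite lt_def dn0.
have [N hN] : exists N, Q ^- N < d.
  have [N hN] := Q_small (divr_gt0 d00 Q_gt0).
  by exists N; apply: le_lt_trans hN _; rewrite ltr_pdivrMr ?Q_gt0 // ltr_pMr // Q_gt1.
have Qmono (a c' : nat) : (a <= c')%N -> Q ^- c' <= Q ^- a.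
  move=> ac; rewrite lef_pV2 ?posrE ?exprn_gt0 ?Q_gt0 //.
  by apply: ler_weXn2l ac; rewrite ltW // Q_gt1.
have [] := @ex_maxnP (fun w => d <= Q ^- w) N.
- by exists 0%N; rewrite expr0 invr1.
- move=> w dw; rewrite leqNgt; apply/negP => /ltnW /Qmono h.
  by have := lt_le_trans hN (le_trans dw h); rewrite ltxx.
move=> w dw wmax; exists c, w; split; first exact: inball.
have wd : Q ^- w <= Q * d.
  have : Q ^- w.+1 < d by rewrite ltNge; apply/negP => /wmax; rewrite ltnn.
  rewrite exprS invfM -ler_pdivrMl ?Q_gt0 // => /ltW.
  by [].
apply: (@le_trans _ _ ((Q `^ s)%:E * (d%:E `^ s))%E); last by rewrite leeDl // lee_fin ltW.
rewrite poweR_EFin -EFinM lee_fin -powRM // ?(ltW Q_gt0) //.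
apply: ge0_ler_powR => //; first exact: ltW.
  by rewrite nnegrE QV_ge0.
by rewrite nnegrE mulr_ge0 // ltW // Q_gt0.
Qed.

(** As [K w = o(w)] and [s < m], the quantity [Q ^ (K w - m * w)] is at most a constant times
    [Q ^ (- s * w)]; a cover with small [s]-sum is thus one of those from which a point of [X]
    escapes. *)
Lemma hausdorff_measure_neq0 m (X : set 'cV[F]_m) (K : nat -> nat) (s : R) :
  (forall (c : nat -> 'cV[F]_m) (w : nat -> nat),
    (\sum_(0 <= i <oo) (Q ^+ K (w i) * Q ^- (m * w i))%:E < 1)%E ->
    exists2 th, X th & forall i, ~ ball_at (c i) (w i)%:Z th) ->
  sublinear K -> 0 < s -> s < m%:R -> hausdorff_measure (dist m) s X <> 0%E.
Proof.
move=> avoid slow s0 sm meas0.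
have Q0 := Q_gt0.
have [M hM] : exists M : nat, (m%:R - s)^-1 < M%:R.
  by exists (Num.bound (m%:R - s)^-1); apply: archi_boundP; rewrite invr_ge0 subr_ge0 ltW.
have ms0 : 0 < m%:R - s by rewrite subr_gt0.
have [N0 hN0] := slow M.
have [C0 hC0] := bounded_below K N0.
pose C1 := Q ^+ C0.
have C10 : 0 < C1 by rewrite exprn_gt0.
have Kbound w : Q ^+ K w * Q ^- (m * w) <= C1 * ((Q ^- w) `^ s).
  have -> : (Q ^- w) `^ s = Q `^ (- (w%:R * s)).
    by rewrite -powR_invn ?(ltW Q0) // -powRrM mulNr.
  rewrite /C1 -!powR_mulrn ?(ltW Q0) // -powRN -!powRD ?(lt0r_neq0 Q0) ?implybT //.
  rewrite ler_powR ?(ltW Q_gt1) //.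
  have [wN|Nw] := ltnP w N0.
    have h1 : (K w)%:R <= C0%:R :> R by rewrite ler_nat hC0.
    have h2 : w%:R * s <= (m * w)%:R by rewrite natrM mulrC ler_wpM2r // ltW.
    by apply: lerD => //; rewrite lerN2.
  have h1 : M%:R * (K w)%:R <= w%:R :> R by rewrite -natrM ler_nat hN0.
  have h2 : (K w)%:R <= w%:R * (m%:R - s).
    have M0 : 0 < M%:R :> R by apply: le_lt_trans hM; rewrite invr_ge0 ltW.
    have : (K w)%:R <= w%:R / M%:R :> R by rewrite ler_pdivlMr // mulrC.
    move=> /le_trans; apply; rewrite ler_wpM2l //.
    by rewrite invf_ple ?posrE // ltW.
  have h3 : 0 <= C0%:R :> R by [].
  rewrite natrM; lra.
(* Two quarters: [C1 * Q ^ s * e'] comes from the diameters and [C1 * e] from the error terms, so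
   the total stays below 1. *)
pose e := (4 * C1)^-1; pose e' := (4 * C1 * Q `^ s)^-1.
have e0 : 0 < e by rewrite invr_gt0 mulr_gt0.
have e'0 : 0 < e' by rewrite invr_gt0 !mulr_gt0 // powR_gt0.
have : (hausdorff_premeasure (dist m) s 1 X < e'%:E)%E.
  apply: (@le_lt_trans _ _ 0%E); last by rewrite lte_fin.
  by rewrite -meas0; apply: ereal_sup_ubound; exists 1; first exact: ltr01.
move=> /ereal_inf_lt[_ [U [cover small ->]]] sumU.
have H i : exists cw : 'cV[F]_m * nat, U i `<=` ball_at cw.1 cw.2%:Z /\
    (((Q ^- cw.2) `^ s)%:E <= (Q `^ s)%:E * (diameter (dist m) (U i) `^ s)%E + (e / (2 ^ i.+1)%:R)%:E)%E.
  have [|c [w h]] := @small_set_in_ball m (U i) s (e / (2 ^ i.+1)%:R) s0 _ (small i); last by exists (c, w).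
  by rewrite divr_gt0 // ltr0n expn_gt0.
have [cw cwP] := choice H.
have [|th Xth out] := avoid (fun i => (cw i).1) (fun i => (cw i).2); last first.
  have [i _ Ui] := cover th Xth.
  by apply: (out i); case: (cwP i) => h _; exact: h.
apply: (@le_lt_trans _ _ (\sum_(0 <= i <oo) (C1%:E * ((Q `^ s)%:E * (diameter (dist m) (U i) `^ s) + (e / (2 ^ i.+1)%:R)%:E)))%E).
  apply: lee_nneseries => [i _ _|i _].
    by rewrite lee_fin mulr_ge0 ?invr_ge0 ?exprn_ge0 // ltW.
  apply: (@le_trans _ _ (C1 * ((Q ^- (cw i).2) `^ s))%:E); first by rewrite lee_fin.
  by rewrite EFinM lee_pmul2l // ?lte_fin //; case: (cwP i).
have term0 i : (0 <= (Q `^ s)%:E * (diameter (dist m) (U i) `^ s) + (e / (2 ^ i.+1)%:R)%:E)%E.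
  rewrite adde_ge0 ?mule_ge0 ?poweR_ge0 ?lee_fin ?powR_ge0 //.
  by rewrite divr_ge0 // ltW.
rewrite nneseriesZl; last by move=> i _; exact: term0.
apply: (@le_lt_trans _ _ (C1%:E * (\sum_(0 <= i <oo) ((Q `^ s)%:E * (diameter (dist m) (U i) `^ s)) + e%:E))%E).
  rewrite lee_pmul2l // ?lte_fin //; apply: (@epsilon_trick R _ e xpredT); last exact: ltW.
  by move=> i; rewrite mule_ge0 ?poweR_ge0 // lee_fin powR_ge0.
rewrite nneseriesZl; last by move=> i _; exact: poweR_ge0.
apply: (@le_lt_trans _ _ (C1%:E * ((Q `^ s)%:E * e'%:E + e%:E))%E).
  rewrite lee_pmul2l // ?lte_fin // leeD2r // lee_pmul2l // ?lte_fin ?powR_gt0 //.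
  exact: ltW.
rewrite -[X in (X < _)%E]/((C1 * (Q `^ s * e' + e))%:E) lte_fin.
have -> : C1 * (Q `^ s * e' + e) = 2^-1.
  by rewrite /e' /e; field; rewrite !lt0r_neq0 ?powR_gt0.
by rewrite invf_lt1 ?ltr1n.
Qed.

(** Countable stability and box counting at once: [Xk k] is allotted [eps / 2 ^ k.+1], and the
    finite covers are enumerated together by [double_nneseries]. *)
Lemma hausdorff_measure_eq0 m (X : set 'cV[F]_m) (Xk : nat -> set 'cV[F]_m) (s : R) :
  0 < s -> X `<=` \bigcup_k Xk k ->
  (forall k (eta : R) (N0 : nat), 0 < eta -> exists (N : nat) (cs : seq 'cV[F]_m),
    [/\ (N0 <= N)%N, Xk k `<=` [set x | exists2 c, c \in cs & ball_at c N%:Z x]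
      & (size cs)%:R * ((Q ^- N) `^ s) <= eta]) ->
  hausdorff_measure (dist m) s X = 0%E.
Proof.
move=> s0 XXk covers.
have Q0 := Q_gt0.
have nonneg delta : (0 <= hausdorff_premeasure (dist m) s delta X)%E.
  apply: le_ereal_inf_tmp => _ [U [_ _ ->]].
  by apply: nneseries_ge0 => i _ _; exact: poweR_ge0.
have pre0 delta : 0 < delta -> hausdorff_premeasure (dist m) s delta X = 0%E.
  move=> d0; apply/eqP; rewrite eq_le nonneg andbT.
  apply/lee_addgt0Pr => eps eps0; rewrite add0e.
  have [N0 hN0] := Q_small d0.
  have H k : exists Nc : nat * seq 'cV[F]_m, [/\ (N0 <= Nc.1)%N,
      Xk k `<=` [set x | exists2 c, c \in Nc.2 & ball_at c Nc.1%:Z x]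
      & (size Nc.2)%:R * ((Q ^- Nc.1) `^ s) <= eps / (2 ^ k.+1)%:R].
    have [|N [cs h]] := covers k (eps / (2 ^ k.+1)%:R) N0 _; last by exists (N, cs).
    by rewrite divr_gt0 // ltr0n expn_gt0.
  have [Nc NcP] := choice H.
  have [f [fsurj fsum]] := double_nneseries R.
  pose V k l := if (l < size (Nc k).2)%N then ball_at (nth 0 (Nc k).2 l) (Nc k).1%:Z else set0.
  pose a k l : \bar R := if (l < size (Nc k).2)%N then ((Q ^- (Nc k).1) `^ s)%:E else 0%E.
  have a0 k l : (0 <= a k l)%E by rewrite /a; case: ifP => // _; rewrite lee_fin powR_ge0.
  have Va k l : (diameter (dist m) (V k l) `^ s <= a k l)%E.
    rewrite /V /a; case: ifP => _; last by rewrite diameter_set0 poweR0r // lt0r_neq0.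
    have := diameter_ball (nth 0 (Nc k).2 l) (Nc k).1%:Z.
    move: (diameter_ge0 (ball_at (nth 0 (Nc k).2 l) (Nc k).1%:Z)); case: diameter => // d.
    rewrite !lee_fin -exprnN => d00 dN.
    apply: ge0_ler_powR => //; first exact: ltW.
    by rewrite nnegrE invr_ge0 exprn_ge0 // ltW.
  apply: (@le_trans _ _ (\sum_(0 <= i <oo) (diameter (dist m) (V (f i).1 (f i).2) `^ s))%E).
    apply: ereal_inf_lbound; exists (fun i => V (f i).1 (f i).2); split=> //.
      move=> x /XXk[k _ Xkx]; have [_ sub _] := NcP k; have [c cin cx] := sub x Xkx.
      have [i fi] := fsurj k (index c (Nc k).2); exists i => //.
      by rewrite fi /V /= index_mem cin nth_index.
    move=> i; rewrite /V; case: ifP => _; last by rewrite diameter_set0 lee_fin ltW.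
    apply: le_trans (diameter_ball _ _) _; rewrite lee_fin -exprnN.
    have [NN _ _] := NcP (f i).1; apply: le_trans hN0.
    rewrite lef_pV2 ?posrE ?exprn_gt0 //.
    by apply: ler_weXn2l NN; rewrite ltW // Q_gt1.
  apply: (@le_trans _ _ (\sum_(0 <= i <oo) a (f i).1 (f i).2)%E).
    by apply: lee_nneseries => [i _ _|i _]; [exact: poweR_ge0 | exact: Va].
  rewrite fsum //; apply: (@le_trans _ _ (\sum_(0 <= k <oo) (eps / (2 ^ k.+1)%:R)%:E)%E); last first.
    by apply: (@epsilon_trick0 R eps xpredT); exact: ltW.
  apply: lee_nneseries => [k _ _|k _]; first by apply: nneseries_ge0.
  rewrite (nneseries_split 0%N (size (Nc k).2)) // add0n [X in (_ + X)%E](_ : _ = 0%E).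
    rewrite adde0 big_mkord (eq_bigr (fun=> ((Q ^- (Nc k).1) `^ s)%:E)); last first.
      by move=> l _; rewrite /a ltn_ord.
    rewrite sumEFin lee_fin sumr_const card_ord -[X in X <= _]mulr_natl.
    by have [_ _] := NcP k.
  apply: eseries0 => l hl _; by rewrite /a ltnNge hl.
apply/eqP; rewrite eq_le; apply/andP; split.
  by apply: ge_ereal_sup => _ [delta d0 <-]; rewrite pre0.
by apply: ereal_sup_ubound; exists 1; [exact: ltr01 | exact/pre0/ltr01].
Qed.

End Norms.

Lemma residue_system_of_card (F : fieldType) (u : F -> int) (q : nat) :
  normalized_valuation u -> (residue_field u #= `I_q)%card ->
  exists rho : 'I_q -> F, residue_system u rho.
Proof.
move=> hu /card_set_bijP[f [fI finj fsurj]].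
pose coset x : set F := [set y | val_ge u 1 (y - x)].
have cos x : coset x x by left; rewrite subrr.
have H (d : 'I_q) : exists x, val_ge u 0 x /\ f (coset x) = d.
  have [X [x x0 <-] fX] := fsurj d (ltn_ord d); by exists x.
have [rho rhoP] := choice H.
have res x : val_ge u 0 x -> residue_field u (coset x) by move=> x0; exists x.
have inj x y : val_ge u 0 x -> val_ge u 0 y -> f (coset x) = f (coset y) -> coset x = coset y.
  by move=> x0 y0; apply: finj; rewrite inE; apply: res.
exists rho; split; first split.
- by move=> d; case: (rhoP d).
- move=> d d' dd'; apply: val_inj; case: (rhoP d) => _ /= <-; case: (rhoP d') => _ /= <-.
  congr f; apply/seteqP; split=> y /= h.
    exact: (val_ge_trans hu h dd').
  exact: (val_ge_trans hu h (val_geBC hu dd')).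
- move=> x x0; have lt := fI _ (res x x0).
  exists (Ordinal lt); have [r0 fr] := rhoP (Ordinal lt).
  by have := inj _ _ r0 x0 fr => /seteqP[_ /(_ _ (cos x))].
Qed.

(** * Weighted boxes and the geometry of numbers *)

Section Weights.
Variables (m n : nat) (r : 'I_m -> nat) (s : 'I_n -> nat).

(** The exponents of the diagonal flow at time [l]: size up to [q ^ (l * s i)] for the vector, at
    most [q ^ (- l * r i)] for its error of approximation. *)
Definition weights (l : nat) (i : 'I_(n + m)) : int := match fintype.split i with
  | inl i => - (l%:Z * (s i)%:Z) | inr i => l%:Z * (r i)%:Z end.

Lemma weightsl l i : weights l (lshift m i) = - (l%:Z * (s i)%:Z).
Proof. by rewrite /weights (unsplitK (inl _)). Qed.

Lemma weightsr l i : weights l (rshift n i) = l%:Z * (r i)%:Z.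
Proof. by rewrite /weights (unsplitK (inr _)). Qed.

Lemma sum_weights l : (\sum_i r i = \sum_i s i)%N -> \sum_i weights l i = 0.
Proof.
move=> hrs; rewrite big_split_ord /=; under eq_bigr do rewrite weightsl.
under [X in _ + X]eq_bigr do rewrite weightsr.
by rewrite sumrN -!mulr_sumr -!Posz_sum hrs addNr.
Qed.

End Weights.

Lemma total_max (T : eqType) (le : T -> T -> Prop) (s : seq T) (x0 : T) :
  (forall x y, le x y \/ le y x) -> (forall x y z, le x y -> le y z -> le x z) ->
  x0 \in s -> exists2 x, x \in s & forall y, y \in s -> le y x.
Proof.
move=> tot tr; elim: s x0 => // a s IH x0 _.
have refl x : le x x by case: (tot x x).
case: s IH => [|b s] IH; first by exists a; rewrite ?mem_head // => y; rewrite inE => /eqP ->.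
have [x xs mx] := IH b (mem_head _ _).
have [ax|xa] := tot a x.
  exists x; first by rewrite inE xs orbT.
  by move=> y; rewrite inE => /orP[/eqP ->|/mx].
exists a; first exact: mem_head.
by move=> y; rewrite inE => /orP[/eqP ->//|/mx yx]; exact: tr xa.
Qed.

Lemma cnt_shift (P Q : nat -> Prop) d N : (forall t, P (t + d)%N -> Q t) ->
  (cnt P N <= d + cnt Q N)%N.
Proof.
move=> PQ; apply: (@leq_trans (cnt P (N + d))); first by apply: cnt_le; rewrite leq_addr.
elim: N => [|N IH].
  by rewrite add0n (leq_trans (count_size _ _)) // size_iota leq_addr.
rewrite addSn !cntS addnA leq_add //.
by case: asboolP => // /PQ h; rewrite (asboolT h).
Qed.

Definition Gam_vect (F : fieldType) (Gam : set F) (h : nat) : set 'cV[F]_h :=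
  [set x | forall i, Gam (x i 0)].

Definition short_vector (F : fieldType) (u : F -> int) (Gam : set F) (m n : nat)
    (r : 'I_m -> nat) (s : 'I_n -> nat) (A : 'M[F]_(m, n)) (a l : nat) : Prop :=
  exists x p, [/\ Gam_vect Gam x, Gam_vect Gam p, x != 0,
    forall i, val_ge u (- (l%:Z * (s i)%:Z)) (x i 0)
    & forall i, val_ge u ((l + a)%:Z * (r i)%:Z) ((p - A *m x) i 0)].

Section GeometryOfNumbers.
Variables (F : fieldType) (u : F -> int).
Hypothesis hu : normalized_valuation u.
Variables (q : nat) (rho : 'I_q -> F).
Hypothesis hrho : residue_system u rho.
Variable Gam : set F.
Local Notation Gam_vect := (Gam_vect Gam).
Hypothesis Gam1 : Gam 1.
Hypothesis GamB : forall x y, Gam x -> Gam y -> Gam (x - y).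
Hypothesis GamM : forall x y, Gam x -> Gam y -> Gam (x * y).
Hypothesis Gam_small : forall x, Gam x -> val_ge u 1 x -> x = 0.
Variable c0 : nat.
Hypothesis Gam_many : forall a : nat,
  atleast (q ^ a)%N [set x | Gam x /\ val_ge u (- (a + c0)%:Z) x].

Definition box h (g : 'I_h -> int) : set 'cV[F]_h :=
  [set x | forall i, val_ge u (g i) (x i 0)].

Let q_gt1 : (1 < q)%N := residue_system_gt1 hu hrho.

Lemma Gam0 : Gam 0. Proof. by rewrite -(subrr 1); apply: GamB. Qed.

Lemma GamN x : Gam x -> Gam (- x).
Proof. by move=> ?; rewrite -sub0r; apply: GamB => //; exact: Gam0. Qed.

Lemma GamD x y : Gam x -> Gam y -> Gam (x + y).
Proof. by move=> ? ?; rewrite -[y]opprK; apply: GamB => //; exact: GamN. Qed.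

Lemma Gam_sum (I : Type) (s : seq I) (P : pred I) (f : I -> F) :
  (forall i, P i -> Gam (f i)) -> Gam (\sum_(i <- s | P i) f i).
Proof. by move=> fN; elim/big_ind: _ => [|x y|//]; [exact: Gam0 | exact: GamD]. Qed.

Lemma Gam_box (z : int) (e : nat) : (e = 0%N) \/ (e%:Z + c0%:Z + z <= 0) ->
  atleast (q ^ e)%N [set x | Gam x /\ val_ge u z x].
Proof.
case=> [->|ez]; first by apply: (@atleast_singleton _ _ 0); split; [exact: Gam0 | left].
by apply: atleast_sub (Gam_many e) => x [gx vx]; split=> //; apply: val_ge_le vx; lia.
Qed.

Lemma Gam_vect0 h : Gam_vect (0 : 'cV[F]_h).
Proof. by move=> i; rewrite mxE; exact: Gam0. Qed.

Lemma Gam_vectB h (x y : 'cV[F]_h) : Gam_vect x -> Gam_vect y -> Gam_vect (x - y).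
Proof. by move=> hx hy i; rewrite !mxE; apply: GamB. Qed.

Lemma Gam_vect_eq0 h (x : 'cV[F]_h) : Gam_vect x -> (forall i, val_ge u 1 (x i 0)) -> x = 0.
Proof. by move=> hx x1; apply/colP => i; rewrite mxE; apply: Gam_small. Qed.

Lemma vector_classes h (a : 'I_h -> int) (n : 'I_h -> nat) :
  exists (X : finType) (cl : 'cV[F]_h -> X), #|X| = (q ^ \sum_i n i)%N /\
    forall x y, box a x -> box a y -> cl x = cl y -> box (fun i => a i + (n i)%:Z) (x - y).
Proof.
have [p p0 up] := nval_unif hu.
pose f i := projT1 (cid (class_map hu p0 up (a i) (n i) hrho)).
exists {ffun {i : 'I_h & 'I_(n i)} -> 'I_q},
  (fun x => [ffun l => f (tag l) (x (tag l) 0) (tagged l)]); split.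
  rewrite card_ffun card_ord card_tagged sumnE big_map big_enum /=.
  by congr (_ ^ _)%N; apply: eq_bigr => i _; rewrite card_ord.
move=> x y ax ay xy i; rewrite !mxE.
apply: (projT2 (cid (class_map hu p0 up (a i) (n i) hrho))) => //.
apply/ffunP => l; have := congr1 (fun g : {ffun _} => g (Tagged (fun i => 'I_(n i)) l)) xy.
by rewrite !ffunE.
Qed.

(** Minkowski's theorem for [L] in counting form: a box has at least as many points as its volume
    predicts, up to the factor [q ^ C]. *)
Definition lattice_dense h (L : set 'cV[F]_h) (C : nat) : Prop :=
  forall (g : 'I_h -> int) (e : nat), e%:Z + C%:Z + \sum_i g i <= 0 ->
    atleast (q ^ e)%N [set x | L x /\ box g x].

Definition graph_lattice m n (B : 'M[F]_(n, m)) : set 'cV[F]_(m + n) :=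
  [set x | exists z w, [/\ Gam_vect (z : 'cV_m), Gam_vect (w : 'cV_n) & x = col_mx z (w - B *m z)]].

Lemma graph_latticeB m n (B : 'M[F]_(n, m)) x y :
  graph_lattice B x -> graph_lattice B y -> graph_lattice B (x - y).
Proof.
move=> [z [w [hz hw ->]]] [z' [w' [hz' hw' ->]]]; exists (z - z'), (w - w').
split; [exact: Gam_vectB | exact: Gam_vectB |].
rewrite opp_col_mx add_col_mx mulmxBr; congr col_mx.
by rewrite !opprB addrACA [RHS]addrACA [- _ + _]addrC.
Qed.

(** Riemann's inequality loses [c0] in each coordinate, whence the constant. The vectors [z] fill
    their box and the [w] a box of size [q ^ G] that contains every [B *m z]; the pigeonhole
    principle on [w - B *m z] then brings the second block into its box. *)
Lemma graph_lattice_dense m n (B : 'M[F]_(n, m)) : lattice_dense (graph_lattice B) ((m + n) * c0).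
Proof.
move=> g e eg.
pose g1 (j : 'I_m) := g (lshift n j); pose g2 (i : 'I_n) := g (rshift m i).
have [Bb HBb] := uniform_bound u (fun p : 'I_n * 'I_m => B p.1 p.2).
have [G [Gg1 Gc0 Gg2]] : exists G : nat, [/\ forall j, (Bb + `|g1 j| <= G)%N, (c0 <= G)%N &
    forall i, (`|g2 i| <= G)%N].
  exists (Bb + \sum_j `|g1 j| + c0 + \sum_i `|g2 i|)%N; split=> [j||i].
  - by rewrite (bigD1 j) //=; lia.
  - by lia.
  - by rewrite [X in (_ <= _ + X)%N](bigD1 i) //=; lia.
pose e1 j := `|(Num.max 0 (- g1 j - c0%:Z))%R|%N.
have aZ : atleast (q ^ \sum_j e1 j)%N [set z | Gam_vect (z : 'cV_m) /\ box g1 z].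
  rewrite expn_sum; apply: atleast_sub (@atleast_col F m (fun j => q ^ e1 j)%N
      (fun j => [set x | Gam x /\ val_ge u (g1 j) x]) _).
    by move=> z h; split=> j; case: (h j).
  by move=> j; apply: Gam_box; rewrite /e1; lia.
have aW : atleast (q ^ \sum_(i < n) (G - c0))%N [set w | Gam_vect (w : 'cV_n) /\ box (fun=> - G%:Z) w].
  rewrite expn_sum; apply: atleast_sub (@atleast_col F n (fun j => q ^ (G - c0))%N
      (fun j => [set x | Gam x /\ val_ge u (- G%:Z) x]) _).
    by move=> z h; split=> j; case: (h j).
  by move=> j; apply: Gam_box; lia.
have [X [cl [cX clP]]] := vector_classes (fun=> - G%:Z) (fun i => `|(G%:Z + g2 i)%R|%N).
pose P := [set x : 'cV[F]_(m + n) | exists z w, [/\ Gam_vect z /\ box g1 z,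
   Gam_vect w /\ box (fun=> - G%:Z) w & x = col_mx z (w - B *m z)]].
have aP : atleast (#|X| * q ^ e)%N P.
  apply: (@atleast_le _ _ ((q ^ \sum_j e1 j) * (q ^ \sum_(i < n) (G - c0)))%N).
    rewrite cX -!expnD leq_exp2l // -lez_nat !PoszD !Posz_sum.
    have -> : \sum_i `|(G%:Z + g2 i)%R|%N%:Z = \sum_(i < n) (G - c0)%N%:Z + n%:Z * c0%:Z + \sum_i g2 i.
      have -> : n%:Z * c0%:Z = \sum_(i < n) c0%:Z.
        by rewrite sumr_const card_ord -mulr_natl; lia.
      rewrite -!big_split /=; apply: eq_bigr => i _.
      by have := Gg2 i; lia.
    have : \sum_j (- g1 j - c0%:Z) <= \sum_j (e1 j)%:Z.
      by apply: ler_sum => j _; rewrite /e1; lia.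
    have -> : \sum_j (- g1 j - c0%:Z) = - \sum_j g1 j - m%:Z * c0%:Z.
      rewrite sumrB sumrN; congr (_ - _).
      by rewrite sumr_const card_ord -mulr_natl; lia.
    move: eg; rewrite big_split_ord /= -/(g1 _) -/(g2 _) PoszM PoszD.
    rewrite (_ : \sum_(i < m) g (lshift n i) = \sum_j g1 j) //.
    rewrite (_ : \sum_(i < n) g (rshift m i) = \sum_j g2 j) //.
    move: (\sum_i g1 i) (\sum_i g2 i) (\sum_i (e1 i)%:Z) (\sum_(i < n) (G - c0)%N%:Z) => a1 a2 a3 a4.
    lia.
  apply: (atleast_image (f := fun p : 'cV[F]_m * 'cV[F]_n => col_mx p.1 (p.2 - B *m p.1))) (atleast_prod aZ aW).
    move=> [z w] [z' w'] _ _ /eq_col_mx[/= -> /addIr ->] //.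
  by move=> [z w] [hz hw]; exists z, w.
have BzG z : box g1 z -> box (fun=> - G%:Z) (B *m z).
  move=> hz i; rewrite mxE; apply: (val_ge_sum hu) => j _.
  apply: val_ge_le (val_geM hu (HBb (i, j)) (hz j)).
  by have := Gg1 j; lia.
apply: (atleast_pigeonhole_sub (f := fun x => cl (dsubmx x))) (leqnn _) _ _ _ aP.
- by rewrite expn_gt0 (ltnW q_gt1).
- by rewrite cX expn_gt0 (ltnW q_gt1).
move=> _ _ [z [w [[gz bz] [gw bw] ->]]] [z' [w' [[gz' bz'] [gw' bw'] ->]]].
rewrite !col_mxKd => clE.
split; first by apply: graph_latticeB; [exists z, w | exists z', w'].
move=> l; case: (split_ordP l) => j ->.
  by rewrite opp_col_mx add_col_mx col_mxEu !mxE; exact: (val_geB hu (bz j) (bz' j)).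
rewrite opp_col_mx add_col_mx col_mxEd.
have bwz z0 w0 : box g1 z0 -> box (fun=> - G%:Z) w0 -> box (fun=> - G%:Z) (w0 - B *m z0).
  move=> hz hw i; rewrite mxE [X in _ + X]mxE; apply: (val_geB hu); [exact: hw | exact: BzG].
have := clP _ _ (bwz _ _ bz bw) (bwz _ _ bz' bw') clE j.
by apply: val_ge_le; have := Gg2 j; rewrite -/(g2 j); lia.
Qed.

Lemma atleast2_neq0 h (P : set 'cV[F]_h) : atleast 2 P -> exists2 x, P x & x != 0.
Proof.
move=> [s [us s2 sP]]; case: s us s2 sP => [|x [|y s]] //= /andP[].
rewrite inE negb_or => /andP[xy _] _ _ sP.
have [x0|x0] := eqVneq x 0; last by exists x => //; apply: sP; rewrite inE eqxx.
exists y; first by apply: sP; rewrite !inE eqxx orbT.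
by rewrite -x0 eq_sym.
Qed.

(* Mahler's transference by pigeonhole: the dual box is shrunk in all directions
   but the one in which [x] is largest; there it is bounded afterwards by means
   of [x . y = 0]. *)
Lemma transference h (L L' : set 'cV[F]_h) (E : 'I_h -> int) (C kap a : nat) x :
  lattice_dense L' C ->
  (forall x y, L x -> L' y -> Gam (\sum_i x i 0 * y i 0)) ->
  \sum_i E i = 0 -> (h.-1 * a + C + 2 <= kap)%N ->
  L x -> x != 0 -> box (fun i => E i + kap%:Z) x ->
  exists y, [/\ L' y, y != 0 & box (fun i => - E i + a%:Z) y].
Proof.
move=> dL' pair E0 kapP Lx x0 bx.
have [i0 xi0] := nonzero_coord x0.
have [c xc cmin] := @arg_minP _ _ _ i0 (fun i => x i 0 != 0) (fun i => u (x i 0) - E i) xi0.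
(* The exponent at [c] gives [x c * y c] valuation at least 1. Raising the other exponents by [a] is
   paid for by [kap >= h.-1 * a + C + 2]. *)
pose g i := if i == c then - E c - kap%:Z + 1 else - E i + a%:Z.
have gsum : \sum_i g i = (h.-1 * a)%N%:Z - kap%:Z + 1.
  have -> : \sum_i g i = \sum_i (a%:Z - E i) + (1 - kap%:Z - a%:Z).
    rewrite (bigD1 c) //= [in RHS](bigD1 c) //= /g eqxx.
    under eq_bigr => i /negPf -> do rewrite addrC.
    by ring.
  rewrite sumrB E0 sumr_const card_ord -mulr_natl natz.
  by case: h c {x x0 bx i0 xi0 xc cmin E E0 L L' dL' pair Lx g} kapP => [[]//|h] _ _ /=; nia.
have : atleast (q ^ 1)%N [set y | L' y /\ box g y] by apply: dL'; rewrite gsum; lia.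
rewrite expn1 => /(atleast_le q_gt1)/atleast2_neq0[y [L'y gy] y0].
have gother i : i != c -> val_ge u (- E i + a%:Z) (y i 0).
  by move=> ic; have := gy i; rewrite /g (negPf ic).
have gc : val_ge u (- E c - kap%:Z + 1) (y c 0) by have := gy c; rewrite /g eqxx.
have pair0 : \sum_i x i 0 * y i 0 = 0.
  apply: Gam_small; first exact: pair.
  apply: (val_ge_sum hu) => i _; have [->|ic] := eqVneq i c.
    by apply: val_ge_le (val_geM hu (bx c) gc); lia.
  by apply: val_ge_le (val_geM hu (bx i) (gother i ic)); lia.
exists y; split=> // i; have [->|ic] := eqVneq i c; last exact: gother.
have -> : y c 0 = - (\sum_(i | i != c) x i 0 * y i 0) / x c 0.
  apply: (mulfI xc); rewrite mulrC mulrA [RHS]mulrC mulrA mulVf // mul1r.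
  apply/eqP; rewrite -addr_eq0 mulrC; apply/eqP.
  by rewrite -[RHS]pair0 [RHS](bigD1 c).
have xcV : val_ge u (- u (x c 0)) (x c 0)^-1 by right; rewrite (nvalV hu).
rewrite (_ : - E c + a%:Z = (u (x c 0) - E c + a%:Z) - u (x c 0)); last by ring.
apply: (val_geM hu) => //; apply/(val_geN hu); apply: (val_ge_sum hu) => l lc.
have [xl|xl] := eqVneq (x l 0) 0; first by rewrite xl mul0r; left.
have xlg : val_ge u (u (x l 0)) (x l 0) by right.
by apply: val_ge_le (val_geM hu xlg (gother l lc)); have := cmin l xl; lia.
Qed.

(** A family incongruent modulo [Gam] and valuation 1 has at most [q ^ c0.+1] members, as its
    translates by the many small points of [Gam] remain distinct modulo valuation 1. A family of
    maximal size meets all classes, and its poles determine [g]. *)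
Lemma cocompact : exists g : nat, forall x, exists2 y, Gam y & val_ge u (- g%:Z) (x - y).
Proof.
pose incong M := `[< exists f : 'I_M -> F, forall i j y, Gam y -> val_ge u 1 (f i - f j - y) -> i = j >].
have [p p0 up] := nval_unif hu.
have [] := @ex_maxnP incong (q ^ c0.+1)%N.
- by exists 0%N; apply/asboolP; exists (fun=> 0); case.
- move=> M /asboolP[f finc]; rewrite leqNgt; apply/negP => bigM.
  have [A HA] := uniform_bound u f.
  pose B := (A + c0)%N.
  have aN := atleast_prod (Gam_many A) (@atleast_fin _ _ id [set: 'I_M] (@inj_id _) (fun=> I)).
  rewrite card_ord in aN.
  have [cl clP] := class_map hu p0 up (- B%:Z) B.+1 hrho.
  have card : (#|{ffun 'I_B.+1 -> 'I_q}| < q ^ A * M)%N.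
    rewrite card_ffun !card_ord; apply: (@leq_ltn_trans (q ^ A * q ^ c0.+1)%N).
      by rewrite -expnD addnS.
    by rewrite ltn_mul2l expn_gt0 (ltnW q_gt1).
  have [[x i] [[x' i'] [[[/= gx bx] _] [[/= gx' bx'] _] ne clE]]] :=
    atleast_collision (fun p => cl (p.1 + f p.2)) card aN.
  have H y j : val_ge u (- (A + c0)%N%:Z) y -> val_ge u (- B%:Z) (y + f j).
    by move=> hy; apply: (val_geD hu) => //; apply: val_ge_le (HA j); lia.
  have := clP _ _ (H x i bx) (H x' i' bx') clE.
  rewrite (_ : - B%:Z + B.+1%:Z = 1); last by lia.
  move=> small.
  have ii' : i = i'.
    apply: (finc i i' (x' - x)); first exact: GamB.
    by rewrite (_ : _ - _ - _ = x + f i - (x' + f i')) //; ring.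
  case/eqP: ne; congr (_, _) => //; apply/eqP; rewrite -subr_eq0; apply/eqP.
  apply: Gam_small; first exact: GamB.
  by move: small; rewrite ii' opprD addrACA subrr addr0.
move=> M /asboolP[f finc] Mmax.
have [A HA] := uniform_bound u f.
exists A => x.
have nM : ~ incong M.+1 by move=> /Mmax; rewrite ltnn.
have [[i [y gy xi]]|N] := pselect (exists i, exists2 y, Gam y & val_ge u 1 (x - f i - y)).
  exists y => //; rewrite (_ : x - y = (x - f i - y) + f i); last by ring.
  by apply: (val_geD hu) => //; apply: val_ge_le xi; lia.
exfalso; apply: nM; apply/asboolP.
exists (fun i => if unlift ord_max i is Some i' then f i' else x) => i j y gy.
case: unliftP => [i' ->|->]; case: unliftP => [j' ->|->] // h.
- by rewrite (finc i' j' y).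
- exfalso; apply: N; exists i', (- y); first exact: GamN.
  by apply/(val_geN hu); rewrite (_ : - _ = f i' - x - y) //; ring.
- by exfalso; apply: N; exists j', y.
Qed.

(* If the vectors of [L] in the box enlarged by [b] only spanned a proper subspace, then
   replacing the dominant coordinate by the value of a linear form vanishing on them and
   applying the pigeonhole principle would give a vector contradicting shortness. *)
Lemma covering h (L : set 'cV[F]_h) (E : 'I_h -> int) (C a0 g : nat) :
  lattice_dense L C -> L 0 -> (forall x y, L x -> L y -> L (x - y)) ->
  (forall a x, Gam a -> L x -> L (a *: x)) ->
  \sum_i E i = 0 ->
  (forall x, L x -> box (fun i => E i + a0%:Z) x -> x = 0) ->
  (forall x, exists2 y, Gam y & val_ge u (- g%:Z) (x - y)) ->
  forall tau, exists2 x, L x &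
    box (fun i => E i - (h.-1 * a0 + C + 1 + g)%N%:Z) (tau - x).
Proof.
move=> dL L0 LB LZ E0 short coc.
pose b := (h.-1 * a0 + C + 1)%N.
pose T := [set x | L x /\ box (fun i => E i - b%:Z) x].
pose P r := `[< exists n (M : 'M[F]_(n, h)), (forall i, T (row i M)^T) /\ \rank M = r >].
have [] := @ex_maxnP P h.
- by exists 0%N; apply/asboolP; exists 0%N, 0; split; [case | rewrite mxrank0].
- by move=> r /asboolP[n [M [_ <-]]]; exact: rank_leq_col.
move=> r /asboolP[n [M [MT Mr]]] rmax.
have TM x : T x -> (x^T <= M)%MS.
  move=> Tx; have sM : (M <= col_mx M x^T)%MS by rewrite -addsmxE addsmxSl.
  have := mxrank_leqif_sup sM => /leqifP; case: ifP => [h0 _|_].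
    by apply: submx_trans h0; rewrite -addsmxE addsmxSr.
  rewrite Mr ltnNge => /negP[]; apply: rmax; apply/asboolP.
  exists (n + 1)%N, (col_mx M x^T); split=> // i; case: (split_ordP i) => l ->.
    by rewrite rowKu.
  by rewrite rowKd ord1 row_id trmxK.
have [rh|] := leqP h r.
  have full : row_full M by rewrite /row_full eqn_leq rank_leq_col Mr.
  (* When [T] spans, [tau] is a combination of vectors of [T]; rounding the coefficients to [Gam]
     leaves errors of size at most [q ^ g], which accounts for [g] in the final bound. *)
  move=> tau; have [B BM] := row_fullP full.
  pose t := tau^T *m B.
  have H (i : 'I_n) : exists y, Gam y /\ val_ge u (- g%:Z) (t 0 i - y).
    by have [y gy hy] := coc (t 0 i); exists y.
  have [y yP] := choice H.
  exists (\sum_i y i *: (row i M)^T).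
    apply: (big_ind (fun x => L x)) => [|x x' Lx Lx'|i _].
    - exact: L0.
    - by rewrite -[x']opprK; apply: (LB _ _ Lx); rewrite -sub0r; apply: LB.
    - by apply: LZ; [case: (yP i) | case: (MT i)].
  move=> i; have -> : (tau - \sum_l y l *: (row l M)^T) i 0 = \sum_l (t 0 l - y l) * M l i.
    have {1}-> : tau = (t *m M)^T by rewrite /t -mulmxA BM mulmx1 trmxK.
    rewrite !mxE summxE -sumrB; apply: eq_bigr => l _; rewrite !mxE; ring.
  apply: (val_ge_sum hu) => l _; have [_ h1] := yP l; have [_ h2] := MT l.
  have {}h2 := h2 i; rewrite !mxE in h2.
  by apply: val_ge_le (val_geM hu h1 h2); rewrite /b; lia.
move=> rh; exfalso.
have [f f0 Tf] : exists2 f : 'cV[F]_h, f != 0 & forall x, T x -> \sum_i f i 0 * x i 0 = 0.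
  have [j cj] : exists j, col j (cokermx M) != 0.
    apply: contrapT => N; have : \rank (cokermx M) = 0%N.
      apply/eqP; rewrite mxrank_eq0; apply/eqP/matrixP => i j; rewrite mxE.
      apply/eqP; apply: contraT => ij; exfalso; apply: N; exists j.
      by apply: contra ij => /eqP/colP/(_ i); rewrite !mxE => ->.
    by rewrite mxrank_coker Mr; lia.
  exists (col j (cokermx M)) => // x /TM/submxP[D xD].
  transitivity ((x^T *m cokermx M) 0 j).
    by rewrite mxE; apply: eq_bigr => i _; rewrite !mxE mulrC.
  by rewrite xD -mulmxA mulmx_coker mulmx0 mxE.
have [i0 fi0] := nonzero_coord f0.
have [c fc cmin] := @arg_minP _ _ _ i0 (fun i => f i 0 != 0) (fun i => u (f i 0) + E i) fi0.
pose f' i := f i 0 / f c 0.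
have f'c : f' c = 1 by rewrite /f' mulfV.
have f'E i : val_ge u (E c - E i) (f' i).
  rewrite /f'; have [->|fi] := eqVneq (f i 0) 0; first by rewrite mul0r; left.
  by right; rewrite (nvalM hu) ?invr_eq0 // (nvalV hu); have := cmin i fi; lia.
have Tf' x : T x -> \sum_i f' i * x i 0 = 0.
  move=> /Tf fx; transitivity ((\sum_i f i 0 * x i 0) / f c 0); last by rewrite fx mul0r.
  by rewrite mulr_suml; apply: eq_bigr => i _; rewrite /f' mulrAC.
pose phi (x : 'cV[F]_h) : 'cV[F]_h := \col_i (if i == c then \sum_l f' l * x l 0 else x i 0).
have h0 : (0 < h)%N by case: (h) (c) => [[]|].
pose A := (b + C)%N.
(* There are [q ^ (h * A - C - 1)] classes for [q ^ (h * A - C)] points of [L]: the coordinates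
   other than [c] gain [a0] each, and the linear form gives up [b = h.-1 * a0 + C + 1] in
   exchange. *)
have [X [cl [cX clP]]] := vector_classes (fun i => E i - A%:Z)
  (fun i => if i == c then (A - b)%N else (A + a0)%N).
have phibox x : box (fun i => E i - A%:Z) x -> box (fun i => E i - A%:Z) (phi x).
  move=> bx i; rewrite mxE; case: eqP => [->|_]; last exact: bx.
  apply: (val_ge_sum hu) => l _; apply: val_ge_le (val_geM hu (f'E l) (bx l)); lia.
have aN : atleast (q ^ (h * A - C))%N [set x | L x /\ box (fun i => E i - A%:Z) x].
  apply: dL; rewrite sumrB E0 sumr_const card_ord -mulr_natl natz.
  by have : (C <= h * A)%N; [rewrite /A; nia | lia].
have nsum : (\sum_i (if i == c then (A - b)%N else (A + a0)%N) = h * A - C - 1)%N.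
  rewrite (bigD1 c) //= eqxx (eq_bigr (fun=> (A + a0)%N)); last by move=> i /negPf ->.
  rewrite sum_nat_const cardC1 card_ord /A /b.
  by case: (h) h0 => //= h' _; nia.
have card : (#|X| < q ^ (h * A - C))%N.
  rewrite cX nsum ltn_exp2l //; have : (C < h * A)%N; last by lia.
  by rewrite /A /b; nia.
have [x [x' [[Lx bx] [Lx' bx'] xx' clE]]] := atleast_collision (fun x => cl (phi x)) card aN.
have := clP _ _ (phibox x bx) (phibox x' bx') clE.
have phiB : phi x - phi x' = phi (x - x').
  apply/colP => i; rewrite !mxE; case: eqP => // _; rewrite -sumrB.
  by apply: eq_bigr => l _; rewrite !mxE mulrBr.
rewrite phiB; set d := x - x' => bd.
have bdother i : i != c -> val_ge u (E i + a0%:Z) (d i 0).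
  move=> ic; have := bd i; rewrite mxE (negPf ic) => hd.
  by apply: val_ge_le hd; lia.
have bdc : val_ge u (E c - b%:Z) (\sum_l f' l * d l 0).
  have := bd c; rewrite mxE eqxx => hd.
  by apply: val_ge_le hd; rewrite /A; lia.
have dcE : d c 0 = \sum_l f' l * d l 0 - \sum_(l | l != c) f' l * d l 0.
  by rewrite (bigD1 c) //= f'c mul1r addrK.
have rest : val_ge u (E c + a0%:Z) (\sum_(l | l != c) f' l * d l 0).
  apply: (val_ge_sum hu) => l lc.
  by apply: val_ge_le (val_geM hu (f'E l) (bdother l lc)); lia.
have Ld : L d by apply: LB.
have Td : T d.
  split=> // i; have [->|ic] := eqVneq i c; last by apply: val_ge_le (bdother i ic); lia.
  by rewrite dcE; apply: (val_geB hu) => //; apply: val_ge_le rest; lia.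
case/eqP: xx'; apply/eqP; rewrite -subr_eq0; apply/eqP; apply: short => // i.
have [->|ic] := eqVneq i c; last exact: bdother.
by rewrite -/d dcE Tf' // sub0r; apply/(val_geN hu).
Qed.

Variables (m n : nat) (r : 'I_m -> nat) (s : 'I_n -> nat).
Hypotheses (hm : (0 < m)%N) (hr : forall i, (0 < r i)%N) (hs : forall i, (0 < s i)%N).
Hypothesis hrs : (\sum_i r i = \sum_i s i)%N.
Variable A : 'M[F]_(m, n).

(** The signs are such that pairing with [(x, p - A *m x)] gives [x . w - p . z], from which [A] has
    disappeared. *)
Definition dual_lattice : set 'cV[F]_(n + m) :=
  [set y | exists z w, [/\ Gam_vect (z : 'cV_m), Gam_vect (w : 'cV_n)
    & y = col_mx (w - A^T *m z) (- z)]].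

Lemma dual_lattice_dense : lattice_dense dual_lattice ((m + n) * c0).
Proof.
move=> g e eg.
pose g' (i : 'I_(m + n)) :=
  match fintype.split i with inl l => g (rshift n l) | inr l => g (lshift m l) end.
have g'l l : g' (lshift n l) = g (rshift n l) by rewrite /g' (unsplitK (inl _)).
have g'r l : g' (rshift m l) = g (lshift m l) by rewrite /g' (unsplitK (inr _)).
have sum_g' : \sum_i g' i = \sum_i g i.
  rewrite !big_split_ord /= addrC; congr (_ + _); apply: eq_bigr => l _; by rewrite ?g'l ?g'r.
have aN := @graph_lattice_dense _ _ A^T g' e.
rewrite sum_g' in aN; have {}aN := aN eg.
apply: (atleast_image (f := fun x => col_mx (dsubmx x) (- usubmx x))) aN.
- by move=> x y _ _ /eq_col_mx[h1 /oppr_inj h2]; rewrite -[x]vsubmxK -[y]vsubmxK h1 h2.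
- move=> _ [[z [w [hz hw ->]]] bx]; rewrite col_mxKu col_mxKd; split; first by exists z, w.
  move=> i; case: (split_ordP i) => l ->.
    by rewrite col_mxEu -g'r; have := bx (rshift m l); rewrite col_mxEd.
  rewrite col_mxEd mxE; apply/(val_geN hu); rewrite -g'l.
  by have := bx (lshift n l); rewrite col_mxEu.
Qed.

Lemma dual_pairing x y : graph_lattice A x -> dual_lattice y ->
  Gam (\sum_i x i 0 * y i 0).
Proof.
move=> [x' [p [hx hp ->]]] [z [w [hz hw ->]]].
have -> : \sum_i (col_mx x' (p - A *m x')) i 0 * (col_mx (w - A^T *m z) (- z)) i 0 =
    \sum_i x' i 0 * w i 0 - \sum_i p i 0 * z i 0.
  have e h (a b : 'cV[F]_h) : \sum_i a i 0 * b i 0 = (a^T *m b) 0 0.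
    by rewrite mxE; apply: eq_bigr => i _; rewrite mxE.
  rewrite big_split_ord /=.
  under eq_bigr do rewrite !col_mxEu.
  under [X in _ + X]eq_bigr do rewrite !col_mxEd.
  rewrite !e mulmxBr mulmxN linearB /= mulmxBl trmx_mul !mulmxA opprB !mxE.
  by rewrite addrCA addrA subrKC addrC.
by apply: GamB; apply: Gam_sum => i _; apply: GamM.
Qed.

(** Since all weights are at least 1, passing from time [l] to [l + kap] turns the gain [2 * kap] in
    the error into a gain of at least [kap] in every coordinate, as [transference] requires. *)
Lemma dual_short a l kap : kap = ((n + m).-1 * a + (m + n) * c0 + 2)%N ->
  short_vector u Gam r s A (2 * kap) l -> (0 < a)%N ->
  exists z w, [/\ Gam_vect z, Gam_vect w, z != 0,
    forall i, val_ge u (a%:Z - (l + kap)%:Z * (r i)%:Z) (z i 0)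
    & forall i, val_ge u (a%:Z + (l + kap)%:Z * (s i)%:Z) ((w - A^T *m z) i 0)].
Proof.
move=> kapE [x [p [hx hp x0 xs pr]]] a0.
pose E := weights r s (l + kap).
have El i : E (lshift m i) = - ((l + kap)%:Z * (s i)%:Z) := weightsl r s (l + kap) i.
have Er i : E (rshift n i) = (l + kap)%:Z * (r i)%:Z := weightsr r s (l + kap) i.
have E0 : \sum_i E i = 0 := sum_weights (l + kap) hrs.
have Lx : graph_lattice A (col_mx x (p - A *m x)) by exists x, p.
have nz : col_mx x (p - A *m x) != 0.
  by apply: contra x0; rewrite -[0]vsubmxK => /eqP/eq_col_mx[-> _]; rewrite linear0.
have bx : box (fun i => E i + kap%:Z) (col_mx x (p - A *m x)).
  move=> i; case: (split_ordP i) => i' ->.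
    rewrite col_mxEu El; apply: val_ge_le (xs i').
    by have := hs i'; move: (s i') => si; nia.
  rewrite col_mxEd Er; apply: val_ge_le (pr i').
  by have := hr i'; move: (r i') => ri; nia.
have kapP : ((n + m).-1 * a + (m + n) * c0 + 2 <= kap)%N by rewrite kapE.
have [_ [[z [w [hz hw ->]]] y0 yb]] :=
  transference dual_lattice_dense dual_pairing E0 kapP Lx nz bx.
have wb i : val_ge u (a%:Z + (l + kap)%:Z * (s i)%:Z) ((w - A^T *m z) i 0).
  by have := yb (lshift m i); rewrite col_mxEu El opprK addrC.
exists z, w; split=> //; last first.
  move=> i; have := yb (rshift n i); rewrite col_mxEd Er mxE => /(val_geN hu).
  by rewrite addrC.
apply: contra y0 => /eqP z0; rewrite z0 mulmx0 subr0 oppr0.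
have -> : w = 0.
  apply: Gam_vect_eq0 => // i; have := wb i; rewrite z0 mulmx0 subr0.
  by apply: val_ge_le; nia.
by rewrite col_mx0.
Qed.

(** The delay for which the box of [size_ok] and [alive] has volume large enough to contain a
    nonzero dual vector at every time beyond [Ca]. *)
Definition Ca : nat := ((m + n) * c0 + m + 1)%N.

(** The [1] makes the size bound strict, so that by discreteness no vector is [size_ok] at time
    0. *)
Definition size_ok (t : nat) (z : 'cV[F]_m) : Prop :=
  [/\ Gam_vect z, z != 0 & forall i, val_ge u (1 - t%:Z * (r i)%:Z) (z i 0)].

Definition alive (t : nat) (z : 'cV[F]_m) : Prop := exists2 w, Gam_vect w &
  forall i, val_ge u ((t%:Z - Ca%:Z) * (s i)%:Z) ((w - A^T *m z) i 0).

Lemma size_ok_mono t t' z : (t <= t')%N -> size_ok t z -> size_ok t' z.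
Proof.
move=> tt' [hz z0 hb]; split=> // i; apply: val_ge_le (hb i).
by move: (r i) => ri; nia.
Qed.

Lemma alive_mono t t' z : (t <= t')%N -> alive t' z -> alive t z.
Proof.
move=> tt' [w hw hb]; exists w => // i; apply: val_ge_le (hb i).
by move: (s i) => si; nia.
Qed.

Lemma size_ok0 z : ~ size_ok 0 z.
Proof.
by move=> [hz /eqP z0 hb]; apply/z0/Gam_vect_eq0.
Qed.

Lemma size_alive_exists t : (Ca < t)%N -> exists2 z, size_ok t z & alive t z.
Proof.
move=> Ct.
pose g (i : 'I_(n + m)) : int := match fintype.split i with
  | inl i => (t%:Z - Ca%:Z) * (s i)%:Z | inr i => 1 - t%:Z * (r i)%:Z end.
have gl i : g (lshift m i) = (t%:Z - Ca%:Z) * (s i)%:Z by rewrite /g (unsplitK (inl _)).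
have gr i : g (rshift n i) = 1 - t%:Z * (r i)%:Z by rewrite /g (unsplitK (inr _)).
have rpos : (0 < \sum_i r i)%N by rewrite (bigD1 (Ordinal hm)) //= addn_gt0 hr.
have gsum : 1%:Z + ((m + n) * c0)%N%:Z + \sum_i g i <= 0.
  rewrite big_split_ord /=; under eq_bigr do rewrite gl.
  under [X in _ + (_ + X)]eq_bigr do rewrite gr.
  rewrite sumrB (_ : \sum_(i < m) (1 : int) = m%:Z); last by rewrite sumr_const card_ord natz.
  rewrite -!mulr_sumr -!Posz_sum -hrs.
  by rewrite /Ca; move: rpos Ct; rewrite /Ca; move: (\sum_i r i)%N => S; nia.
have := dual_lattice_dense gsum; rewrite expn1 => /(atleast_le q_gt1)/(atleast2_neq0).
move=> [_ [[z [w [hz hw ->]]] yb] y0].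
have wb i : val_ge u ((t%:Z - Ca%:Z) * (s i)%:Z) ((w - A^T *m z) i 0).
  by have := yb (lshift m i); rewrite col_mxEu gl.
exists z; last by exists w.
split=> //; last first.
  by move=> i; have := yb (rshift n i); rewrite col_mxEd gr mxE => /(val_geN hu).
apply: contra y0 => /eqP z0; rewrite z0 mulmx0 subr0 oppr0.
have -> : w = 0; last by rewrite col_mx0.
apply: Gam_vect_eq0 => // i; have := wb i; rewrite z0 mulmx0 subr0.
by apply: val_ge_le; have := hs i; move: (s i) => si; nia.
Qed.

(** The candidates are finitely many because [Gam] is discrete, and their lifetimes, being initial
    segments, are totally ordered by inclusion. *)
Lemma longest_lived_exists t : (Ca < t)%N -> exists z, longest_lived size_ok alive t z.
Proof.
move=> Ct; have [z0 sz0 az0] := size_alive_exists Ct.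
have [X [cl [_ clP]]] := vector_classes (fun i => 1 - t%:Z * (r i)%:Z) (fun i => t * r i)%N.
pose P N := `[< atleast N [set z | size_ok t z /\ alive t z] >].
have [] := @ex_maxnP P #|X|.
- by exists 1%N; apply/asboolP; apply: (@atleast_singleton _ _ z0).
- move=> N /asboolP aN; rewrite leqNgt; apply/negP => lt.
  have [x [y [[[hx _ bx] _] [[hy _ b_y] _] xy clE]]] := atleast_collision cl lt aN.
  case/eqP: xy; apply/eqP; rewrite -subr_eq0; apply/eqP/Gam_vect_eq0.
    exact: Gam_vectB.
  move=> i; have := clP _ _ bx b_y clE i; congr val_ge.
  by rewrite PoszM; ring.
move=> N /asboolP[S [uS NS SP]] Nmax.
have Sall z : size_ok t z -> alive t z -> z \in S.
  move=> sz az; apply: contraT => zS; have := Nmax N.+1; rewrite ltnn => H.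
  apply: H; apply/asboolP; exists (z :: S); split=> //=; first by rewrite zS.
  by move=> y; rewrite inE => /orP[/eqP ->|/SP].
have [||z zS mx] := @total_max _ (fun z z' => forall t', alive t' z -> alive t' z') S z0 _ _ (Sall _ sz0 az0).
- move=> x y; have [h|nh] := pselect (forall t', alive t' x -> alive t' y); first by left.
  right=> t2 ay; apply: contrapT => nax; apply: nh => t1 ax.
  apply: contrapT => nay; have [t12|t21] := leqP t1 t2; first by apply: nay; exact: alive_mono ay.
  by apply: nax; apply: alive_mono ax; exact: ltnW.
- by move=> x y z h1 h2 t' /h1/h2.
have [sz az] := SP _ zS.
by exists z; split=> // z' sz' az' t' at'; apply: mx at'; exact: Sall.
Qed.

Hypothesis SA : forall a, sublinear (cnt (fun l => ~ short_vector u Gam r s A a l)).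

Lemma long_lived L : sublinear
  (cnt (fun t => ~ exists z, [/\ size_ok t z, alive t z & alive (t + L) z])).
Proof.
(* The slack [a] exceeds every [L * s i], hence keeps a dual vector alive for [L] further units of
   time. *)
move=> M; pose a := (1 + L * \sum_i s i)%N.
pose kap := ((n + m).-1 * a + (m + n) * c0 + 2)%N.
have [N0 HN0] := SA (2 * kap)%N (2 * M)%N.
exists (maxn N0 (2 * M * kap)) => N; rewrite geq_max => /andP[/HN0 h1 h2].
have h3 : (cnt (fun t => ~ exists z, [/\ size_ok t z, alive t z & alive (t + L) z]) N <=
    kap + cnt (fun l => ~ short_vector u Gam r s A (2 * kap) l) N)%N.
  apply: cnt_shift => t nz /(dual_short erefl) [//|z [w [hz hw z0 bz bw]]].
  apply: nz; exists z; split.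
  - by split=> // i; apply: val_ge_le (bz i); rewrite /a; nia.
  - exists w => // i; apply: val_ge_le (bw i).
    by move: (s i) => si; rewrite /a; nia.
  - exists w => // i; apply: val_ge_le (bw i).
    have : (L * s i <= a)%N by rewrite /a (bigD1 i) //=; nia.
    by move: (s i) => si; nia.
by move: h1 h2 h3; move: (cnt _ N) (cnt _ N) => c1 c2; nia.
Qed.

Lemma fcount_rounds (P : nat -> Prop) S w : (0 < S)%N ->
  fcount (fun k => `[< P (k %/ S)%N >]) (S * w) = (S * cnt P w)%N.
Proof.
move=> S0; elim: w => [|w IH]; first by rewrite !muln0 /fcount big_nil.
rewrite mulnS addnC /fcount (big_cat_nat (n := (S * w)%N)) ?leq_addr //= -/(fcount _ _) IH.
rewrite cntS mulnDr; congr (_ + _)%N.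
rewrite -{1}(add0n (S * w)%N) big_addn addKn.
transitivity (\sum_(0 <= i < S) `[< P w >])%N.
  rewrite !big_nat; apply: eq_bigr => i /andP[_ iS].
  by rewrite addnC mulnC divnMDl // divn_small // addn0.
by rewrite big_const_nat subn0 iter_addn_0 mulnC.
Qed.

Theorem avoiding_targets (R : realType) : complete_valuation u ->
  exists (bd : nat) (Kf : nat -> nat), sublinear Kf /\
  forall (c : nat -> 'cV[F]_m) (w : nat -> nat),
    (\sum_(0 <= i <oo) ((q%:R : R) ^+ Kf (w i) * q%:R ^- (m * w i))%:E < 1)%E ->
    exists th : 'cV[F]_m, (forall i, ~ forall l, val_ge u (w i)%:Z (th l 0 - c i l 0)) /\
      forall t, (Ca < t)%N -> exists z, [/\ size_ok t z, alive t z &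
        forall y, Gam y -> ~ val_ge u bd%:Z (\sum_l z l 0 * th l 0 - y)].
Proof.
move=> hcomp.
have [Con [Con_birth Con_uniq Con_cover Con_rare]] :=
  greedy size_ok_mono alive_mono size_ok0 longest_lived_exists long_lived.
have [p p0 up] := nval_unif hu.
have [e eS] := periodic_visits hm hr.
set S := (\sum_j r j)%N in eS.
have rS i : (r i <= S)%N by rewrite /S (bigD1 i) //= leq_addr.
have S0 : (0 < S)%N := leq_trans (hr (Ordinal hm)) (rS (Ordinal hm)).
(* [I k g z] expresses that the digits of theta chosen from step [k] on change [z . theta] by
   elements of valuation at least [g] only. *)
pose I k (g : nat) (z : 'cV[F]_m) := forall i, val_ge u (g%:Z - (visits e k i)%:Z) (z i 0).
have I_le k k' g g' z : (k <= k')%N -> (g' <= g)%N -> I k g z -> I k' g' z.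
  move=> kk' gg' h i; apply: val_ge_le (h i).
  have : (visits e k i <= visits e k' i)%N.
    rewrite -(subnKC kk'); elim: (k' - k)%N => [|d IH]; first by rewrite addn0.
    by rewrite addnS; apply: leq_trans IH (visits_le _ _ _).
  by lia.
(* As [z] is in [I k g] and not in [I k g.+1] but in [I k.+1 g.+1], the digit chosen at
   step [k] changes [z . th] by an element of valuation exactly [g]: one digit at most
   brings it within valuation [g.+1] of [Gam]. *)
pose Forb k (th : 'cV[F]_m) (d : 'I_q) := exists z g, [/\ Con (k %/ S)%N z, (0 < g)%N,
  I k g z, ~ I k g.+1 z & I k.+1 g.+1 z /\
  exists2 y, Gam y & val_ge u g.+1%:Z (\sum_l z l 0 * (child rho p e k th d) l 0 - y)].
pose fb k := `[< exists z, Con (k %/ S)%N z >].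
have Forb_fb k th d : Forb k th d -> fb k.
  by move=> [z [g [Cz _ _ _ _]]]; apply/asboolP; exists z.
have Forb1 k th d d' : Forb k th d -> Forb k th d' -> d = d'.
  move=> [z [g [Cz g0 Ig nIg [IgS [y gy hy]]]]] [z' [g' [Cz' g'0 Ig' nIg' [IgS' [y' gy' hy']]]]].
  have zz' := Con_uniq _ _ _ Cz Cz'; rewrite -{z' Cz'}zz' in Ig' nIg' IgS' hy'.
  have gg' : g' = g.
    apply/eqP; rewrite eqn_leq; apply/andP; split; rewrite leqNgt; apply/negP => lt.
      exact: (nIg (I_le k k g' g.+1 z (leqnn k) lt Ig')).
    exact: (nIg' (I_le k k g g'.+1 z (leqnn k) lt Ig)).
  rewrite gg' in hy'.
  have nz : ~ val_ge u (g.+1%:Z - (visits e k (e k))%:Z) (z (e k) 0).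
    move=> h; apply: nIg => i; have [->//|ie] := eqVneq i (e k).
    by have := IgS i; rewrite visitsS eq_sym (negPf ie) addn0.
  have [z0 uz] := val_geNP nz.
  set V := visits e k (e k) in nz uz *.
  pose D := z (e k) 0 * ((rho d - rho d') * p ^+ V).
  have DE : \sum_l z l 0 * (child rho p e k th d) l 0 - y -
      (\sum_l z l 0 * (child rho p e k th d') l 0 - y') = D - (y - y').
    have -> : \sum_l z l 0 * (child rho p e k th d) l 0 =
        \sum_l z l 0 * (child rho p e k th d') l 0 + D.
      rewrite (bigD1 (e k)) //= [in RHS](bigD1 (e k)) //= !mxE eqxx.
      rewrite (eq_bigr (fun l => z l 0 * (child rho p e k th d') l 0)).
        by rewrite /D -/V; ring.
      by move=> l /negPf lk; rewrite !mxE lk.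
    ring.
  have small : val_ge u g.+1%:Z (D - (y - y')) by rewrite -DE; apply: (val_geB hu).
  have Dg : val_ge u g%:Z D.
    have [[r0 _] _] := hrho.
    have h := val_geM hu (Ig (e k)) (val_geM hu (val_geB hu (r0 d) (r0 d')) (val_ge_pX hu p0 up V)).
    by apply: val_ge_le h; rewrite -/V; lia.
  (* Here [0 < g] matters: [D] and [D - (y - y')] both have positive valuation, so discreteness
     kills [y - y'], and [D] itself has valuation at least [g.+1]. *)
  have yy' : y - y' = 0.
    apply: Gam_small; first exact: GamB.
    rewrite -(subKr D (y - y')); apply: (val_geB hu).
      by apply: val_ge_le Dg; lia.
    by apply: val_ge_le small; lia.
  rewrite yy' subr0 in small.
  have [[_ inj] _] := hrho; apply: inj.
  have -> : rho d - rho d' = D * (z (e k) 0)^-1 * p ^ (- V%:Z).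
    by rewrite /D -exprnN; field; rewrite z0 expf_neq0.
  have zV : val_ge u (- u (z (e k) 0)) (z (e k) 0)^-1 by right; rewrite (nvalV hu).
  by apply: val_ge_le (val_geM hu (val_geM hu small zV) (val_ge_pXz hu up (- V%:Z))); lia.
(* A vector not [size_ok] at [t'.-1] fails [I (S * t') S.+1], so the level [g] met below is at most
   [S]; each birth burdens the [S] steps of its round. *)
exists S.+1, (fun w => S * cnt (fun t => exists z, Con t z) w)%N; split.
  move=> M; have [N0 HN0] := Con_rare (M * S)%N.
  by exists N0 => N /HN0; rewrite mulnA.
move=> c w small.
have start : (potential R u q r e fb c w 0 0%R < 1)%E.
  apply: le_lt_trans small; apply: lee_nneseries => [i _ _|i _].
    by rewrite lee_fin mulr_ge0 ?exprn_ge0 ?overlap_ge0 //; exact: hrho.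
  rewrite lee_fin (fcount_rounds (fun t => exists z, Con t z)) // ler_wpM2l ?exprn_ge0 //.
  rewrite /overlap; case: ifP => _; last by rewrite invr_ge0 exprn_ge0.
  rewrite (eq_bigr (fun=> w i)); last by move=> l _; rewrite /visits big_nil maxn0.
  by rewrite sum_nat_const card_ord exprVn.
have [th [l [path lim out]]] := avoiding_point hu hcomp hrho p0 up hr eS Forb1 Forb_fb start.
exists l; split=> // t Ct; have [t' [z [Cz sz az]]] := Con_cover t Ct.
exists z; split=> // y gy near_y.
have [t'0 [sz' nsz']] := Con_birth _ _ Cz.
have I1 : I (S * t')%N 1%N z.
  by move=> i; have [_ _ /(_ i)] := sz'; rewrite eS PoszM mulrC.
have nI : ~ I (S * t')%N S.+1 z.
  move=> h; apply: nsz'; have [gz z0 _] := sz'; split=> // i.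
  apply: val_ge_le (h i); rewrite eS; have := rS i.
  by have := hr i; move: t'0; clear; case: t' => // t'' _; move: (r i) => ri /=; nia.
(* Let [g] be the precision of [z . theta] when the round of its birth begins. During the round
   every coordinate receives a digit, so some step [k] raises the precision to [g.+1], and the digit
   chosen there was not forbidden. *)
have [] := @ex_maxnP (fun g => `[< I (S * t')%N g z >]) S.
- by exists 1%N; apply/asboolP.
- by move=> g /asboolP h; rewrite leqNgt; apply/negP => Sg; exact: (nI (I_le _ _ _ _ z (leqnn _) Sg h)).
move=> g /asboolP Ig gmax.
have g0 : (0 < g)%N by apply: gmax; apply/asboolP.
have nIg : ~ I (S * t')%N g.+1 z by move=> /asboolP/gmax; rewrite ltnn.
have ex : exists d, `[< I (S * t' + d)%N g.+1 z >].
  exists S; apply/asboolP => i; apply: val_ge_le (Ig i).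
  rewrite (_ : S * t' + S = S * t'.+1)%N; last by rewrite mulnS addnC.
  by rewrite !eS; have := hr i; nia.
have [d /asboolP Id dmin] := ex_minnP ex.
have dS : (d <= S)%N.
  apply: dmin; apply/asboolP => i; apply: val_ge_le (Ig i).
  rewrite (_ : S * t' + S = S * t'.+1)%N; last by rewrite mulnS addnC.
  by rewrite !eS; have := hr i; nia.
case: d => [|d] in Id dmin dS *; first by apply: nIg; rewrite addn0 in Id.
set k := (S * t' + d)%N.
have kS : (k %/ S = t')%N by rewrite /k mulnC divnMDl // divn_small // addn0.
have [dd [thE nF]] := path k.
apply: nF; exists z, g; split=> //.
- by rewrite kS.
- exact: (I_le (S * t')%N k g g z (leq_addr _ _) (leqnn g) Ig).
- by move=> /asboolP/dmin; rewrite ltnn.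
split; first by rewrite /k -addnS.
exists y => //; rewrite -thE.
have -> : \sum_l0 z l0 0 * th k.+1 l0 0 - y = (\sum_l0 z l0 0 * l l0 0 - y)
   - \sum_l0 z l0 0 * (l l0 0 - th k.+1 l0 0).
  under [X in _ = _ - X]eq_bigr do rewrite mulrBr.
  by rewrite sumrB; ring.
apply: (val_geB hu).
  apply: val_ge_le near_y; have : (g <= S)%N; last by lia.
  rewrite leqNgt; apply/negP => Sg; exact: (nI (I_le _ _ _ _ z (leqnn _) Sg Ig)).
apply: (val_ge_sum hu) => i _; rewrite /k -addnS.
by apply: val_ge_le (val_geM hu (Id i) (lim _ i)); lia.
Qed.

End GeometryOfNumbers.

(** * Box counting and upper bounds for the dimension *)

Lemma geometric_small (R : realType) (l c eta : R) : 0 <= l -> l < 1 -> 0 < eta ->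
  exists N1, forall N, (N1 <= N)%N -> c * l ^+ N <= eta.
Proof.
move=> l0 l1 eta0.
have /cvgrPdist_lt/(_ eta eta0)[N1 _ HN] : (fun N => c * l ^+ N) @ \oo --> (c * 0 : R).
  by apply: cvgMr; apply: cvg_expr; rewrite ger0_norm.
exists N1 => N /HN /=; rewrite mulr0 sub0r normrN => h.
exact: le_trans (ler_norm _) (ltW h).
Qed.

Lemma box_representatives (F : fieldType) (u : F -> int) (q : nat) (rho : 'I_q -> F)
    (h : nat) (a : 'I_h -> int) (n : 'I_h -> nat) :
  normalized_valuation u -> residue_system u rho ->
  exists L : seq 'cV[F]_h, size L = (q ^ \sum_i n i)%N /\
    forall x, box u a x -> exists2 c, c \in L & box u (fun i => a i + (n i)%:Z) (x - c).
Proof.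
move=> hu hrho; have [X [cl [cX clP]]] := vector_classes hu hrho a n.
have H y : exists x, (exists2 x', box u a x' & cl x' = y) -> box u a x /\ cl x = y.
  have [[x' h1 h2]|nx] := pselect (exists2 x', box u a x' & cl x' = y); last by exists 0 => /nx.
  by exists x'.
have [f fP] := choice H.
exists [seq f y | y <- enum X]; split; first by rewrite size_map -cardE.
move=> x bx; exists (f (cl x)); first by apply: map_f; rewrite mem_enum.
have [b1 b2] := fP (cl x) (ex_intro2 _ _ x bx erefl).
exact: clP.
Qed.

(** The part of [X] of norm at most [q ^ k] is covered by [q ^ (m * (k + N))] balls of radius
    [q ^ -N], whose [s]-sum decays like [q ^ ((m - s) * N)]. *)
Lemma measure_above_dimension (R : realType) (F : fieldType) (u : F -> int) (q : nat)
    (rho : 'I_q -> F) (m : nat) (X : set 'cV[F]_m) (s : R) :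
  normalized_valuation u -> residue_system u rho -> m%:R < s ->
  hausdorff_measure (fun x y : 'cV[F]_m => max_norm R u q (x - y)) s X = 0%E.
Proof.
move=> hu hrho ms; have q1 := residue_system_gt1 hu hrho.
have Q0 := Q_gt0 R q1.
have s0 : 0 < s by apply: le_lt_trans ms.
apply: (@hausdorff_measure_eq0 R F u q hu q1 m X (fun k => X `&` box u (fun=> - k%:Z))) => //.
  move=> x Xx; have [B HB] := uniform_bound u (fun i => x i 0).
  by exists B.
move=> k eta N0 eta0.
pose l : R := q%:R `^ (m%:R - s).
have l1 : l < 1.
  rewrite /l -[m%:R - s]opprB powRN invf_lt1 ?powR_gt0 //.
  have := @gt0_ltr_powR R (s - m%:R); rewrite subr_gt0 => /(_ ms) /(_ 1 q%:R).
  by rewrite powR1; apply; rewrite ?nnegrE ?Q_gt1.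
have [N1 HN1] := geometric_small (q%:R ^+ (m * k)) (powR_ge0 _ _ : 0 <= l) l1 eta0.
exists (maxn N0 N1).
have [L [sL LP]] := box_representatives (fun=> - k%:Z) (fun _ : 'I_m => (k + maxn N0 N1)%N) hu hrho.
exists L; split; first by rewrite leq_maxl.
  move=> x [_ /LP[c cL cx]]; exists c => // i; have := cx i; rewrite !mxE.
  by apply: val_ge_le; lia.
apply: le_trans (HN1 _ (leq_maxr N0 N1)).
rewrite sL sum_nat_const card_ord natrX mulnDr exprD -mulrA ler_wpM2l ?exprn_ge0 //.
set N := maxn N0 N1.
have -> : l ^+ N = q%:R `^ ((m%:R - s) * N%:R) by rewrite -powR_mulrn ?powR_ge0 // -powRrM.
have -> : (q%:R ^- N : R) `^ s = q%:R `^ (- (N%:R * s)).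
  by rewrite -powR_invn ?(ltW Q0) // -powRrM mulNr.
rewrite -powR_mulrn ?(ltW Q0) // -powRD ?(lt0r_neq0 Q0) ?implybT //.
by rewrite ler_powR ?(ltW (Q_gt1 R q1)) // natrM mulrBl [s * _]mulrC.
Qed.

Lemma cnt_addn (P : nat -> Prop) a b : (cnt P (a + b) <= b + cnt P a)%N.
Proof.
elim: b => [|b IH]; first by rewrite addn0.
by rewrite addnS cntS; case: `[< P _ >] => /=; lia.
Qed.

Lemma cnt_tail (P : nat -> Prop) d N :
  (cnt P N <= d + cnt (fun l => P l /\ (d <= l)%N) N)%N.
Proof.
elim: N => [//|N IH]; rewrite !cntS addnA; have [dN|Nd] := leqP d N.
  apply: leq_add IH _; by case: asboolP => // PN; rewrite asboolT.
rewrite -cntS -addnA; apply: leq_trans (leq_addr _ _).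
by apply: leq_trans (count_size _ _) _; rewrite size_iota.
Qed.

Section BoxCounting.
Variables (F : fieldType) (u : F -> int).
Hypothesis hu : normalized_valuation u.
Variables (q : nat) (rho : 'I_q -> F).
Hypothesis hrho : residue_system u rho.
Variables (m : nat) (r : 'I_m -> nat).
Local Notation S := (\sum_i r i)%N.

Definition level_box (t : nat) (c : 'cV[F]_m) : set 'cV[F]_m :=
  [set x | forall i, val_ge u (t * r i)%:Z (x i 0 - c i 0)].

Definition covered (X : set 'cV[F]_m) (t : nat) (cs : seq 'cV[F]_m) : Prop :=
  X `<=` [set x | exists2 c, c \in cs & level_box t c x].

Lemma level_refinement t d : exists L : seq 'cV[F]_m, size L = (q ^ (S * d))%N /\
  forall c x, level_box t c x -> exists2 l, l \in L & level_box (t + d) (c + l) x.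
Proof.
have [L [sL LP]] := box_representatives (fun i => (t * r i)%N%:Z) (fun i => d * r i)%N hu hrho.
exists L; split; first by rewrite sL -big_distrr /= mulnC.
move=> c x bx; have [|l lL bl] := LP (x - c).
  by move=> i; have := bx i; rewrite !mxE.
exists l => // i; have := bl i; rewrite !mxE opprD addrA; apply: val_ge_le.
by rewrite mulnDl PoszD.
Qed.

Lemma covered_next X t cs : covered X t cs ->
  exists2 cs', covered X t.+1 cs' & size cs' = (size cs * q ^ S)%N.
Proof.
move=> cov; have [L [sL LP]] := level_refinement t 1.
exists [seq c + l | c <- cs, l <- L]; last by rewrite size_allpairs sL muln1.
move=> x /cov[c cin /LP[l lL h]]; exists (c + l); last by rewrite -addn1.
by apply: allpairs_f.
Qed.

Lemma covered_hole X t d cs : covered X t cs ->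
  (forall c, exists y, level_box t c y /\ forall x, level_box (t + d) y x -> ~ X x) ->
  exists2 cs', covered X (t + d) cs' & size cs' = (size cs * (q ^ (S * d)).-1)%N.
Proof.
move=> cov holes; have [L [sL LP]] := level_refinement t d.
have H c : exists l, l \in L /\ forall x, level_box (t + d) (c + l) x -> ~ X x.
  have [y [yc hole]] := holes c; have [l lL ly] := LP c y yc.
  exists l; split=> // x lx; apply: hole => i.
  exact: (val_ge_trans hu (lx i) (val_geBC hu (ly i))).
have [f fP] := choice H.
exists (flatten [seq [seq c + l | l <- rem (f c) L] | c <- cs]).
  move=> x Xx; have [c cin cx] := cov x Xx; have [l lL lx] := LP c x cx.
  have lf : l != f c.
    by apply/eqP => E; have [_ /(_ x)] := fP c; rewrite -E => /(_ lx).
  exists (c + l) => //; apply/flatten_mapP; exists c => //.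
  by apply: map_f; rewrite rem_mem.
rewrite size_flatten /shape -map_comp.
rewrite (eq_map (g := fun=> (q ^ (S * d)).-1)); last first.
  by move=> c /=; rewrite size_map size_rem ?sL //; case: (fP c).
by rewrite sumnE big_map big_const_seq count_predT iter_addn_0 mulnC.
Qed.

Variables (R : realType).
Variables (X : set 'cV[F]_m) (k0 kap l0 : nat) (good : nat -> Prop) (lam : R) (M : nat).
Hypotheses (kap0 : (0 < kap)%N) (lam0 : 0 < lam) (lam1 : lam < 1).
(* A hole spares one of the [q ^ (2 kap S)] boxes into which a box is divided; [lam] spreads
   this gain over the [2 kap] levels and the density [1 / M] of the good levels, twice. *)
Hypothesis lamE : lam ^+ (2 * M * (2 * kap)) = 1 - q%:R ^- (S * (2 * kap)).
Hypothesis good_ge : forall l, good l -> (kap <= l)%N.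
Hypothesis Xbound : X `<=` box u (fun=> - k0%:Z).
Hypothesis holes : forall l, good l -> forall c, exists y, level_box (l - kap) c y /\
  forall x, level_box (l + kap) y x -> ~ X x.

(** The windows of radius [kap] around good times may overlap, so not every hole can be used. A used
    hole saves [lam ^+ (2 * M)] for each of the [2 * kap] levels it spans, which pays for all good
    times that are skipped. *)
Lemma box_count t : exists2 cs, covered X t cs &
  (size cs)%:R <= q%:R ^+ (m * k0) * q%:R ^+ (S * t) * (lam ^+ (2 * M)) ^+ cnt good (t.+1 - kap).
Proof.
have q1 := residue_system_gt1 hu hrho; have Q0 := Q_gt0 R q1.
elim/ltn_ind: t => -[_|t IH].
  have [L [sL LP]] := box_representatives (fun=> - k0%:Z) (fun _ : 'I_m => k0) hu hrho.
  exists L.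
    move=> x /Xbound/LP[c cL cx]; exists c => // i; have := cx i; rewrite !mxE.
    by rewrite addNr mul0n.
  rewrite sL sum_nat_const card_ord muln0 expr0 mulr1 natrX.
  by have -> : (1 - kap = 0)%N; [lia | rewrite expr0 mulr1].
have [/andP[kt /asboolP gt]|/negP ngt] := boolP ((kap <= t.+1)%N && `[< good (t.+1 - kap) >]).
  set l := (t.+1 - kap)%N in gt.
  have kl := good_ge gt.
  have [|cs cov sz] := IH (l - kap)%N _; first by rewrite /l; lia.
  have tE : (l - kap + 2 * kap = t.+1)%N by rewrite /l; move: kl; rewrite /l; lia.
  have [|cs' cov' sz'] := covered_hole (d := (2 * kap)%N) cov.
    move=> c; have [y [h1 h2]] := holes gt c; exists y; split=> // x.
    rewrite tE; have -> : t.+1 = (l + kap)%N by rewrite /l; lia.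
    exact: h2.
  rewrite tE in cov'; exists cs' => //.
  have qpos : (0 < q ^ (S * (2 * kap)))%N by rewrite expn_gt0 (ltnW q1).
  rewrite sz' natrM.
  have -> : ((q ^ (S * (2 * kap))).-1)%:R = q%:R ^+ (S * (2 * kap)) * lam ^+ (2 * M * (2 * kap)) :> R.
    by rewrite lamE mulrBr mulr1 mulfV ?expf_neq0 ?lt0r_neq0 // -natrX -subn1 natrB.
  apply: (@le_trans _ _ (q%:R ^+ (m * k0) * q%:R ^+ (S * (l - kap)) *
     (lam ^+ (2 * M)) ^+ cnt good ((l - kap).+1 - kap) *
     (q%:R ^+ (S * (2 * kap)) * lam ^+ (2 * M * (2 * kap))))).
    by rewrite ler_wpM2r // mulr_ge0 ?exprn_ge0 // ltW.
  have -> : q%:R ^+ (m * k0) * q%:R ^+ (S * (l - kap)) *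
     (lam ^+ (2 * M)) ^+ cnt good ((l - kap).+1 - kap) *
     (q%:R ^+ (S * (2 * kap)) * lam ^+ (2 * M * (2 * kap))) =
     q%:R ^+ (m * k0) * q%:R ^+ (S * t.+1) *
     (lam ^+ (2 * M)) ^+ (2 * kap + cnt good ((l - kap).+1 - kap)) :> R.
    by rewrite -tE mulnDr exprD [lam ^+ (2 * M * (2 * kap))]exprM [(lam ^+ (2 * M)) ^+ (_ + _)]exprD; ring.
  rewrite ler_wpM2l ?mulr_ge0 ?exprn_ge0 ?(ltW Q0) //.
  rewrite ler_wiXn2l ?exprn_ge0 ?exprn_ile1 ?(ltW lam0) ?(ltW lam1) //.
  apply: leq_trans (cnt_addn good _ _); apply: cnt_le.
  by rewrite /l; move: kl; rewrite /l; lia.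
have [cs cov sz] := IH t (ltnSn t).
have [cs' cov' sz'] := covered_next cov; exists cs' => //.
have -> : cnt good (t.+2 - kap) = cnt good (t.+1 - kap).
  have [kt|kt] := leqP kap t.+1; last by congr cnt; lia.
  rewrite subSn // cntS asboolF ?addn0 // => g; apply: ngt; rewrite kt; exact/asboolP.
rewrite sz' natrM natrX mulnS addnC exprD.
rewrite [q%:R ^+ (m * k0) * _]mulrA mulrAC ler_wpM2r ?exprn_ge0 ?(ltW Q0) //.
Qed.

End BoxCounting.

(** * Application to [Rv] in the completion, and the two implications *)

Section Setting.
Variables (R : realType) (k : finFieldType) (K : fieldType) (iota : {rmorphism k -> K}).
Hypothesis hK : function_field iota.
Variable v : K -> int.
Hypothesis hv : normalized_valuation v.
Variables (Kv : fieldType) (j : {rmorphism K -> Kv}) (vh : Kv -> int).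
Hypothesis hKv : is_completion v j vh.

Definition completed_Rv : set Kv := [set j x | x in Rv v].

Local Notation Gam := completed_Rv.

Lemma val_ge_completion N x : val_ge v N x <-> val_ge vh N (j x).
Proof.
have [->|x0] := eqVneq x 0; first by rewrite rmorph0; split; left.
by rewrite (val_ge_nz v N x0) (val_ge_nz vh N _) ?fmorph_eq0 // (compl_ext hKv).
Qed.

Lemma residue_system_completion q (rho : 'I_q -> Kv) : residue_system vh rho ->
  exists rho' : 'I_q -> K, residue_system v rho'.
Proof.
move=> [[r0 r1] r2]; have hvh := compl_val hKv.
have [rho' rhoP] := choice (fun d => compl_dense hKv (rho d) 1).
have E N d : N <= 1 -> val_ge vh N (rho d - j (rho' d)) by move=> N1; apply: val_ge_le (rhoP d).
exists rho'; split; first split.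
- move=> d; apply/val_ge_completion.
  rewrite -[j _](subKr (rho d)); apply: (val_geB hvh) => //; exact: E.
- move=> d d' /val_ge_completion; rewrite rmorphB => h; apply: r1.
  apply: (val_ge_trans hvh (rhoP d)); apply: (val_ge_trans hvh h).
  exact/(val_geBC hvh).
- move=> x /val_ge_completion /r2[d hd]; exists d; apply/val_ge_completion.
  by rewrite rmorphB; apply: (val_ge_trans hvh hd).
Qed.

Lemma Gam1 : Gam 1.
Proof. by exists 1; rewrite ?rmorph1 // => w hw _; exact: val_ge1. Qed.

Lemma GamB x y : Gam x -> Gam y -> Gam (x - y).
Proof.
move=> [x' hx <-] [y' hy <-]; exists (x' - y'); rewrite ?rmorphB // => w hw wv.
by apply: (val_geB hw); [exact: hx | exact: hy].
Qed.

Lemma GamM x y : Gam x -> Gam y -> Gam (x * y).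
Proof.
move=> [x' hx <-] [y' hy <-]; exists (x' * y'); rewrite ?rmorphM // => w hw wv.
by rewrite -[0]addr0; apply: (val_geM hw); [exact: hx | exact: hy].
Qed.

Lemma Gam_small x : Gam x -> val_ge vh 1 x -> x = 0.
Proof.
move=> [x' hx <-] /val_ge_completion hx1.
by rewrite (Rv_small_eq0 hK hv hx hx1) rmorph0.
Qed.

Lemma Gam_many q (rho : 'I_q -> Kv) : residue_system vh rho ->
  exists c0 : nat, forall a : nat,
    atleast (q ^ a)%N [set x | Gam x /\ val_ge vh (- (a + c0)%:Z) x].
Proof.
move=> /residue_system_completion[rho' hrho'].
have [c0 Hc0] := riemann_inequality hK hv hrho'.
exists c0 => a; apply: atleast_image (Hc0 a) => [x y _ _|x [Rx vx]]; first exact: fmorph_inj.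
by split; [exists x | apply/val_ge_completion].
Qed.

Lemma Gam_vectP n (x : 'cV[Kv]_n) :
  Gam_vect Gam x <-> exists2 y, Rv_vect v y & x = map_mx j y.
Proof.
split=> [h|[y hy -> i]]; last by rewrite mxE; exists (y i 0).
have H i : exists y, Rv v y /\ j y = x i 0 by have [y] := h i; exists y.
have [y yP] := choice H; exists (\col_i y i) => [i|]; first by rewrite mxE; case: (yP i).
by apply/colP => i; rewrite !mxE; case: (yP i).
Qed.

Variables (q : nat) (rho : 'I_q -> Kv).
Hypothesis hrho : residue_system vh rho.
Let hvh := compl_val hKv.
Let q1 : (1 < q)%N := residue_system_gt1 hvh hrho.
Local Notation Q := (q%:R : R).

Section Wdist.
Variables (m : nat) (r : 'I_m -> nat) (xi : 'cV[Kv]_m).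

Lemma wdist_le p : Gam_vect Gam p -> wdist R v j vh q r xi <= wnorm R vh q r (xi - p).
Proof.
move=> /Gam_vectP[y hy ->]; apply: ge_inf; last by exists y.
by exists 0 => _ [y' _ <-]; exact: wnorm_ge0.
Qed.

Lemma wdist_lt (c : R) : wdist R v j vh q r xi < c ->
  exists2 p, Gam_vect Gam p & wnorm R vh q r (xi - p) < c.
Proof.
move=> /inf_lt H; have [|_ [y hy <-] lt] := H.
  by exists (wnorm R vh q r (xi - map_mx j 0)); exists 0 => // i; rewrite mxE => w hw _; left.
by exists (map_mx j y) => //; apply/Gam_vectP; exists y.
Qed.

Lemma wdist_ge (c : R) : (forall p, Gam_vect Gam p -> c <= wnorm R vh q r (xi - p)) ->
  c <= wdist R v j vh q r xi.
Proof.
move=> H; apply: lb_le_inf.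
  by exists (wnorm R vh q r (xi - map_mx j 0)); exists 0 => // i; rewrite mxE => w hw _; left.
by move=> _ [y hy <-]; apply: H; apply/Gam_vectP; exists y.
Qed.

End Wdist.

Variables (m n : nat) (r : 'I_m -> nat) (s : 'I_n -> nat).
Hypotheses (hm : (0 < m)%N) (hn : (0 < n)%N).
Hypotheses (hr : forall i, (0 < r i)%N) (hs : forall i, (0 < s i)%N).
Hypothesis hrs : (\sum_i r i = \sum_i s i)%N.
Variable A : 'M[Kv]_(m, n).

Local Notation short := (short_vector vh Gam r s A).

Definition singular_at (eps : R) (l : nat) : Prop := exists y : 'cV[K]_n,
  [/\ Rv_vect v y, y != 0, wdist R v j vh q r (A *m map_mx j y) <= eps * (Q ^- l)
    & wnorm R vh q s (map_mx j y) <= Q ^+ l].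

Lemma short_singular_at a l (eps : R) : Q ^- a <= eps -> short a l -> singular_at eps l.
Proof.
move=> ae [_ [p [/Gam_vectP[y hy ->] hp y0 hx hxp]]]; exists y; split=> //.
- by apply: contraNneq y0 => ->; rewrite map_mx0.
- apply: le_trans (wdist_le _ _ hp) _.
  apply: (@le_trans _ _ (Q ^ (- (l + a)%:Z))).
    apply/(wnorm_le R vh q1 _ _ hr) => i; rewrite mulNr opprK.
    by rewrite -opprB mxE; apply/(val_geN hvh).
  rewrite PoszD opprD expfzDr ?lt0r_neq0 ?Q_gt0 // mulrC -!exprnN ler_pM2r //.
  by rewrite QV_gt0.
- by rewrite exprnP; apply/(wnorm_le R vh q1 _ _ hs).
Qed.

Lemma singular_at_short a l (eps : R) : eps < Q ^- a -> singular_at eps l -> short a l.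
Proof.
move=> ae [y [hy y0 hd wn]].
have [|p hp lt] := @wdist_lt _ r (A *m map_mx j y) (Q ^ (- (l + a)%:Z)).
  apply: le_lt_trans hd _.
  rewrite PoszD opprD expfzDr ?lt0r_neq0 ?Q_gt0 // mulrC -!exprnN ltr_pM2l //.
  by rewrite QV_gt0.
exists (map_mx j y), p; split=> //.
- by apply/Gam_vectP; exists y.
- by rewrite map_mx_eq0.
- by apply/(wnorm_le R vh q1 _ _ hs); rewrite -exprnP.
- move=> i; have /(wnorm_le R vh q1 _ _ hr) := ltW lt => /(_ i).
  by rewrite mulNr opprK -opprB mxE => /(val_geN hvh).
Qed.

Definition rarely_not_short : Prop := forall a, sublinear (cnt (fun l => ~ short a l)).

(** [cnt] includes time 0, which the definition of singularity on average omits; the discrepancy is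
    at most one. *)
Lemma count_iota1 (P : nat -> Prop) N :
  (count (fun l => `[< P l >]) (seq.iota 1 N) + cnt (fun l => ~ P l) N.+1 <= N.+1)%N /\
  (N <= count (fun l => `[< P l >]) (seq.iota 1 N) + cnt (fun l => ~ P l) N.+1)%N.
Proof.
have e : (count (fun l => `[< P l >]) (seq.iota 1 N) +
   count (fun l => `[< ~ P l >]) (seq.iota 1 N) = N)%N.
  rewrite -[RHS](size_iota 1 N) -(count_predC (fun l => `[< P l >])); congr (_ + _)%N.
  by apply: eq_count => l /=; rewrite asbool_neg.
rewrite /cnt -[N.+1]add1n iotaD add0n count_cat /=.
by move: e; case: `[< ~ P 0%N >] => /=; lia.
Qed.

Lemma singular_on_averageP : singular_on_average R v j vh q r s A <-> rarely_not_short.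
Proof.
split=> [SA a M|RN eps eps0].
  (* One unit beyond [a], because [singular_at_short] asks for a strict inequality. *)
  have e0 : 0 < Q ^- a.+1 by rewrite QV_gt0.
  have ea : Q ^- a.+1 < Q ^- a.
    rewrite ltf_pV2 ?posrE ?exprn_gt0 ?Q_gt0 // exprS ltr_pMl ?Q_gt1 //.
    by rewrite exprn_gt0 // Q_gt0.
  have [->|M0] := posnP M; first by exists 0%N.
  have /cvgrPdist_lt/(_ ((2 * M)%:R^-1)) := SA _ e0.
  rewrite invr_gt0 ltr0n muln_gt0 M0 => /(_ isT)[N1 _ HN1].
  exists (maxn N1.+1 (4 * M)) => N; rewrite geq_max => /andP[NN1 NM].
  have N0 : (0 < N)%N by apply: leq_trans NN1.
  have := HN1 N (ltnW NN1); rewrite /= -/(singular_at _ _).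
  set c := count _ _ => Hc.
  have cN : (c <= N)%N by apply: leq_trans (count_size _ _) _; rewrite size_iota.
  have Hc2 : ((2 * M) * (N - c) < N)%N.
    have NR : 0 < N%:R :> R by rewrite ltr0n.
    rewrite -(ltr_nat R) natrM natrB //.
    move: Hc; rewrite ltr_norml => /andP[_].
    have -> : 1 - N%:R^-1 * c%:R = (N%:R - c%:R) / N%:R :> R by field; rewrite lt0r_neq0.
    rewrite ltr_pdivrMr // mulrC ltr_pdivlMr ?ltr0n ?muln_gt0 // mulrC; exact.
  have [h1 h2] := count_iota1 (singular_at (Q ^- a.+1)) N.
  have h3 : (cnt (fun l => ~ short a l) N <= cnt (fun l => ~ singular_at (Q ^- a.+1) l) N.+1)%N.
    apply: leq_trans (cnt_le _ (leqnSn N)) _; apply: cnt_sub => l ns /singular_at_short sh.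
    by apply: ns; exact: sh.
  rewrite -/c in h1 h2.
  by move: h1 h3 Hc2 NM cN; move: (cnt _ N) (cnt _ N.+1) => c1 c2; nia.
have [a ha] := Q_small q1 eps0.
apply/cvgrPdist_le => e e0.
have [M hM] : exists M : nat, 2 * e^-1 < M%:R.
  by exists (Num.bound (2 * e^-1)); apply: archi_boundP; rewrite mulr_ge0 // invr_ge0 ltW.
have [N0 HN0] := RN a M.
exists N0.+1 => // N /= N0N; rewrite -/(singular_at _ _); set c := count _ _.
have N1 : (0 < N)%N by apply: leq_trans N0N.
have NR : 0 < N%:R :> R by rewrite ltr0n.
have cN : (c <= N)%N by apply: leq_trans (count_size _ _) _; rewrite size_iota.
have -> : 1 - N%:R^-1 * c%:R = (N%:R - c%:R) / N%:R :> R by field; rewrite lt0r_neq0.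
have [h1 h2] := count_iota1 (singular_at eps) N; rewrite -/c in h1 h2.
have h3 : (cnt (fun l => ~ singular_at eps l) N.+1 <= cnt (fun l => ~ short a l) N.+1)%N.
  by apply: cnt_sub => l ns sh; apply: ns; exact: short_singular_at sh.
have h4 := HN0 N.+1 (leq_trans (leqnSn _) (leqW N0N)).
have h5 : (M * (N - c) <= 2 * N)%N.
  by move: h1 h2 h3 h4 cN N1; move: (cnt _ N.+1) (cnt _ N.+1) => c1 c2; nia.
rewrite ger0_norm; last by rewrite divr_ge0 // subr_ge0 ler_nat.
rewrite ler_pdivrMr //.
have M0 : 0 < M%:R :> R by apply: lt_trans hM; rewrite mulr_gt0 // invr_gt0.
rewrite -(ler_pM2l M0) -natrB // -natrM.
apply: (@le_trans _ _ (2 * N)%:R); first by rewrite ler_nat.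
rewrite natrM mulrA ler_pM2r //.
by move: hM; rewrite ltr_pdivrMr // => /ltW.
Qed.

Local Notation dist := (fun x y : 'cV[Kv]_m => max_norm R vh q (x - y)).
Local Notation S := (\sum_i r i)%N.

(** For given [x], take the first [t] at which the size of [x] makes [(w - A^T *m z) . x] of
    valuation at least [bd]. If [A *m x - th] were closer than [Q ^ - (t + bd)] to [p], then
    [z . th] would be too close to [Gam]. Minimality of [t] gives the norm of [x] at least
    [Q ^ (t - 1 - C - bd)], and the product of both bounds is the constant. *)
Lemma Bad_of_targets (C bd : nat) (th : 'cV[Kv]_m) :
  (forall t, (C < t)%N -> exists z w, [/\ Gam_vect Gam z, Gam_vect Gam w,
     forall i, val_ge vh (1 - t%:Z * (r i)%:Z) (z i 0),
     forall i, val_ge vh ((t%:Z - C%:Z) * (s i)%:Z) ((w - A^T *m z) i 0)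
   & forall y, Gam y -> ~ val_ge vh bd%:Z (\sum_l z l 0 * th l 0 - y)]) ->
  Bad v j vh q r s A (Q ^- (1 + C + 2 * bd)) th.
Proof.
move=> targets; have Q0 := Q_gt0 R q1; rewrite /Bad /= /bad_liminf.
(* The threshold [Q] for the norm of [x] forces [C < t] below, where targets are available. *)
apply: le_trans (ereal_sup_ubound _); last by exists (Q ^ 1%:Z).
apply: le_ereal_inf_tmp => _ [x0 [hx0 xT] <-]; rewrite lee_fin.
set x := map_mx j x0 in xT *.
have hx : Gam_vect Gam x by apply/Gam_vectP; exists x0.
pose P t := `[< forall i, val_ge vh (bd%:Z - (t%:Z - C%:Z) * (s i)%:Z) (x i 0) >].
have exP : exists t, P t.
  have [B HB] := uniform_bound vh (fun i => x i 0).
  exists (C + bd + B)%N; apply/asboolP => i; apply: val_ge_le (HB i).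
  by have := hs i; move: (s i) => si; nia.
have [t /asboolP Pt tmin] := ex_minnP exP.
have Ct : (C < t)%N.
  rewrite ltnNge; apply/negP => tC.
  have : wnorm R vh q s x <= Q ^ 0%:Z.
    apply/(wnorm_le R vh q1 _ _ hs) => i; rewrite mul0r oppr0.
    by apply: val_ge_le (Pt i); have := hs i; move: (s i) => si; nia.
  by move=> /(le_trans xT); rewrite ler_eXz2l ?Q_gt1.
have [z [w [hz hw zb wb avoid]]] := targets t Ct.
have xlow : Q ^ (t%:Z - 1 - C%:Z - bd%:Z) <= wnorm R vh q s x.
  rewrite leNgt; apply/negP => /ltW /(wnorm_le R vh q1 _ _ hs) h.
  have : P t.-1.
    apply/asboolP => i; apply: val_ge_le (h i).
    by have := hs i; move: (s i) => si; nia.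
  by move=> /tmin; lia.
have dlow : Q ^ (- (t%:Z + bd%:Z)) <= wdist R v j vh q r (A *m x - th).
  apply: wdist_ge => p hp; rewrite leNgt; apply/negP => /ltW /(wnorm_le R vh q1 _ _ hr) h.
  apply: (avoid (\sum_i w i 0 * x i 0 - \sum_l z l 0 * p l 0)).
    by apply: GamB; apply: (Gam_sum Gam1 GamB) => i _; apply: GamM.
  have -> : \sum_l z l 0 * th l 0 - (\sum_i w i 0 * x i 0 - \sum_l z l 0 * p l 0) =
      - \sum_i (w - A^T *m z) i 0 * x i 0 - \sum_l z l 0 * (A *m x - th - p) l 0.
    have e h' (a b : 'cV[Kv]_h') : \sum_i a i 0 * b i 0 = (a^T *m b) 0 0.
      by rewrite mxE; apply: eq_bigr => i _; rewrite mxE.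
    rewrite !e linearB /= trmx_mul trmxK mulmxBl !mulmxBr !mulmxA.
    have sub (a b : 'M[Kv]_1) : (a - b) 0 0 = a 0 0 - b 0 0 by rewrite !mxE.
    rewrite !sub.
    move: ((z^T *m th) 0 0) ((w^T *m x) 0 0) ((z^T *m p) 0 0) ((z^T *m A *m x) 0 0) => e1 e2 e3 e4.
    ring.
  apply: (val_geB hvh).
    apply/(val_geN hvh); apply: (val_ge_sum hvh) => i _.
    by apply: val_ge_le (val_geM hvh (wb i) (Pt i)); lia.
  apply: (val_ge_sum hvh) => i _; apply: val_ge_le (val_geM hvh (zb i) (h i)).
  by have := hr i; move: (r i) => ri; nia.
have -> : Q ^- (1 + C + 2 * bd) = Q ^ (t%:Z - 1 - C%:Z - bd%:Z) * Q ^ (- (t%:Z + bd%:Z)).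
  by rewrite -expfzDr ?lt0r_neq0 // exprnN; congr (_ ^ _); lia.
by apply: ler_pM => //; rewrite exprz_ge0 // ltW.
Qed.

Lemma full_dimension : rarely_not_short ->
  exists eps : R, 0 < eps /\ hausdorff_dim dist (Bad v j vh q r s A eps) = (m%:R)%:E.
Proof.
move=> SA; have [c0 Gmany] := Gam_many hrho.
have [bd [Kf [slow avoid]]] := avoiding_targets hvh hrho Gam1 GamB GamM
  Gam_small Gmany hm hr hs hrs SA R (compl_complete hKv).
set C := Ca c0 m n in avoid.
pose eps : R := Q ^- (1 + C + 2 * bd).
have eps0 : 0 < eps by rewrite QV_gt0.
exists eps; split=> //.
have lower t : 0 < t -> t < m%:R -> hausdorff_measure dist t (Bad v j vh q r s A eps) <> 0%E.
  move=> t0 tm; apply: (@hausdorff_measure_neq0 R Kv vh q q1 m _ Kf) => // c w small.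
  have [th [out targets]] := avoid c w small; exists th; last exact: out.
  apply: (@Bad_of_targets C bd th) => t' /targets[z [[gz _ bz] [w' gw bw] av]].
  by exists z, w'.
apply/eqP; rewrite eq_le; apply/andP; split.
  apply/lee_addgt0Pr => e e0; apply: ereal_inf_lbound; exists (m%:R + e) => //; split.
    by rewrite ltr_wpDl.
  by apply: (measure_above_dimension _ hvh hrho); rewrite ltrDl.
apply: le_ereal_inf_tmp => _ [t [t0 meas0] <-]; rewrite lee_fin leNgt; apply/negP => tm.
exact: (lower t t0 tm meas0).
Qed.

Lemma approximation_at_good_times a : exists c1 : nat, forall l, (0 < l)%N ->
  ~ short_vector vh Gam r s A a l -> forall (tx : 'cV[Kv]_n) (th : 'cV[Kv]_m),
  exists x p, [/\ Gam_vect Gam x, Gam_vect Gam p,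
    forall i, val_ge vh (- (l%:Z * (s i)%:Z) - c1%:Z) ((tx - x) i 0)
  & forall i, val_ge vh (l%:Z * (r i)%:Z - c1%:Z) ((th - (A *m x - p)) i 0)].
Proof.
have [c0 Gmany] := Gam_many hrho.
have [g Hg] := cocompact hvh hrho Gam1 GamB
  Gam_small Gmany.
(* A gain [a0 >= a * r i] in every coordinate implies the weighted gain of [short_vector]. Thus at a
   time without short vectors [x] vanishes, and then, as [l > 0], so does [p]. *)
pose a0 := (a * \sum_i r i)%N.
exists ((n + m).-1 * a0 + (n + m) * c0 + 1 + g)%N => l l0 nsh tx th.
pose E := weights r s l.
have El i : E (lshift m i) = - (l%:Z * (s i)%:Z) := weightsl r s l i.
have Er i : E (rshift n i) = l%:Z * (r i)%:Z := weightsr r s l i.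
have E0 : \sum_i E i = 0 := sum_weights l hrs.
have dL := graph_lattice_dense hvh hrho Gam1 GamB Gmany A.
have L0 : graph_lattice Gam A 0.
  have G0 h := Gam_vect0 Gam1 GamB h.
  exists 0, 0; split; [exact: G0 | exact: G0 |].
  by rewrite mulmx0 subr0 col_mx0.
have LZ b x : Gam b -> graph_lattice Gam A x -> graph_lattice Gam A (b *: x).
  move=> gb [x1 [p1 [hx1 hp1 ->]]]; exists (b *: x1), (b *: p1); split.
  - by move=> i; rewrite mxE; apply: GamM.
  - by move=> i; rewrite mxE; apply: GamM.
  - by rewrite scale_col_mx scalerBr scalemxAr.
have ra0 i : (a * r i <= a0)%N by rewrite /a0 leq_mul2l (bigD1 i) //= leq_addr orbT.
have nshort x : graph_lattice Gam A x -> box vh (fun i => E i + a0%:Z) x -> x = 0.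
  move=> [x1 [p1 [hx1 hp1 ->]]] bx.
  have bx1 i : val_ge vh (- (l%:Z * (s i)%:Z) + a0%:Z) (x1 i 0).
    by have := bx (lshift m i); rewrite col_mxEu El.
  have bp1 i : val_ge vh (l%:Z * (r i)%:Z + a0%:Z) ((p1 - A *m x1) i 0).
    by have := bx (rshift n i); rewrite col_mxEd Er.
  have [x10|x1n] := eqVneq x1 0; last first.
    exfalso; apply: nsh; exists x1, p1; split=> // i.
      by apply: val_ge_le (bx1 i); lia.
    by apply: val_ge_le (bp1 i); have := ra0 i; move: (r i) => ri; nia.
  rewrite x10 mulmx0 subr0 in bp1 *.
  rewrite (_ : p1 = 0) ?col_mx0 //; apply: (Gam_vect_eq0 Gam_small) => // i.
  by apply: val_ge_le (bp1 i); have := hr i; move: (r i) => ri; nia.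
have [x [x1 [p1 [hx1 hp1 ->]]] bx] := covering hvh hrho dL L0 (graph_latticeB GamB (B := A)) LZ E0 nshort Hg (col_mx tx (- th)).
exists x1, p1; split=> // i.
  by have := bx (lshift m i); rewrite opp_col_mx add_col_mx col_mxEu El.
apply/(val_geN hvh); have := bx (rshift n i); rewrite opp_col_mx add_col_mx col_mxEd Er.
by congr val_ge; rewrite !mxE; ring.
Qed.

(** Thresholds are powers of [Q], so countably many of these sets suffice to cover [Bad]. A liminf
    at least [eps] gives eventual bounds only below [eps], whence [eps / 2] in [Bad_sub]. *)
Definition uniformly_bad (eps : R) (T : nat) : set 'cV[Kv]_m :=
  [set th | forall x, Gam_vect Gam x -> Q ^+ T <= wnorm R vh q s x ->
    eps <= wnorm R vh q s x * wdist R v j vh q r (A *m x - th)].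

Lemma Bad_sub eps : 0 < eps ->
  Bad v j vh q r s A eps `<=` \bigcup_T uniformly_bad (eps / 2) T.
Proof.
move=> eps0 th; rewrite /Bad /= /bad_liminf => hb.
have half : ((eps / 2)%:E < eps%:E)%E by rewrite lte_fin ltr_pdivrMr // ltr_pMr // ltr1n.
have /ereal_sup_gt[_ [T _ <-] hT] := lt_le_trans half hb.
have [T' hT'] : exists T' : nat, T <= Q ^+ T'.
  exists (Num.bound `|T|); apply: le_trans (ler_norm T) _.
  apply: (@le_trans _ _ (Num.bound `|T|)%:R); first by rewrite ltW // archi_boundP.
  by rewrite -natrX ler_nat ltnW // ltn_expl.
exists T' => // x /Gam_vectP[y hy ->] hx; rewrite -lee_fin; apply/ltW/(lt_le_trans hT).
by apply: ereal_inf_lbound; exists y => //; split=> //; exact: le_trans hx.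
Qed.

(** The hole is the box around [A *m x - y]: for theta in it the product of the norm of [x] and the
    distance is at most [Q ^ (l + c1.+1) * Q ^ - (l + kap)], which is smaller than [eps] by the
    choice of [kap]. *)
Lemma bad_hole a c1 : (forall l, (0 < l)%N ->
  ~ short_vector vh Gam r s A a l -> forall (tx : 'cV[Kv]_n) (th : 'cV[Kv]_m),
  exists x p, [/\ Gam_vect Gam x, Gam_vect Gam p,
    forall i, val_ge vh (- (l%:Z * (s i)%:Z) - c1%:Z) ((tx - x) i 0)
  & forall i, val_ge vh (l%:Z * (r i)%:Z - c1%:Z) ((th - (A *m x - p)) i 0)]) ->
  forall (eps : R) (kap T l : nat), (c1 <= kap)%N -> Q ^+ c1.+1 * Q ^- kap < eps ->
  (T <= l)%N -> (kap <= l)%N -> (0 < l)%N -> ~ short_vector vh Gam r s A a l ->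
  forall c, exists y, level_box vh r (l - kap) c y /\
    forall th, level_box vh r (l + kap) y th -> ~ uniformly_bad eps T th.
Proof.
move=> approx eps kap T l ck small Tl kl l0 nsh c.
have Q0 := Q_gt0 R q1.
have [p p0 vp] := nval_unif hvh.
(* The entries of [tx] exceed the approximation error by one power of [q], so [x] inherits their
   valuations exactly and its norm is bounded from both sides. *)
pose tx : 'cV[Kv]_n := \col_i p ^ (- (l%:Z * (s i)%:Z) - c1%:Z - 1).
have [x [y [hx hy xb yb]]] := approx l l0 nsh tx c.
have xE i : x i 0 != 0 /\ vh (x i 0) = - (l%:Z * (s i)%:Z) - c1%:Z - 1.
  have txE : vh (tx i 0) = - (l%:Z * (s i)%:Z) - c1%:Z - 1.
    by rewrite mxE (nvalXz hvh) vp mul1r.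
  rewrite -txE -[x i 0](subKr (tx i 0)).
  apply: (@nval_add_lt _ _ hvh _ _ (- (l%:Z * (s i)%:Z) - c1%:Z)).
  - by rewrite mxE expfz_neq0.
  - by rewrite txE; lia.
  - by apply/(val_geN hvh); have := xb i; rewrite !mxE.
have xlarge : Q ^+ T <= wnorm R vh q s x.
  rewrite leNgt; apply/negP => lt.
  have : wnorm R vh q s x <= Q ^ l%:Z.
    apply/ltW/(lt_le_trans lt); rewrite -exprnP; apply: ler_weXn2l => //.
    by rewrite ltW // Q_gt1.
  move=> /(wnorm_le R vh q1 _ _ hs)/(_ (Ordinal hn)); have [x0 ux] := xE (Ordinal hn).
  by move=> /(val_ge_nz _ _ x0); rewrite ux; lia.
have xsmall : wnorm R vh q s x <= Q ^ (l + c1.+1)%:Z.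
  apply/(wnorm_le R vh q1 _ _ hs) => i; right; have [_ ->] := xE i.
  by have := hs i; move: (s i) => si; nia.
exists (A *m x - y); split.
  move=> i; apply: (val_geBC hvh); have := yb i; rewrite !mxE; apply: val_ge_le.
  by have := hr i; move: (r i) => ri; nia.
move=> th thb /(_ x hx xlarge); apply/negP; rewrite -ltNge.
have dle : wdist R v j vh q r (A *m x - th) <= Q ^ (- (l + kap)%:Z).
  apply: le_trans (wdist_le _ _ hy) _; apply/(wnorm_le R vh q1 _ _ hr) => i.
  rewrite mulNr opprK; have := thb i; rewrite PoszM => /(val_geBC hvh); congr val_ge.
  by rewrite !mxE; ring.
have d0 : 0 <= wdist R v j vh q r (A *m x - th).
  by apply: wdist_ge => p' _; exact: wnorm_ge0.
apply: le_lt_trans (ler_pM (wnorm_ge0 _ _ _ _ _) d0 xsmall dle) _.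
apply: le_lt_trans small; rewrite -expfzDr ?lt0r_neq0 //.
by rewrite exprnP exprnN -expfzDr ?lt0r_neq0 // ler_eXz2l ?Q_gt1 //; lia.
Qed.

Theorem dimension_drop : ~ rarely_not_short -> forall eps : R, 0 < eps ->
  exists t : R, [/\ 0 < t, t < m%:R &
    hausdorff_measure dist t (Bad v j vh q r s A eps) = 0%E].
Proof.
move=> nr eps eps0; have Q0 := Q_gt0 R q1.
have [a [M HM]] : exists a M, forall N0, exists2 N, (N0 <= N)%N &
    (N < M * cnt (fun l => ~ short_vector vh Gam r s A a l) N)%N.
  apply: contrapT => H; apply: nr => a M; apply: contrapT => H2; apply: H.
  exists a, M => N0; apply: contrapT => H3; apply: H2; exists N0 => N hN.
  by rewrite leqNgt; apply/negP => lt; apply: H3; exists N.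
have M0 : (0 < M)%N by have [N _] := HM 0%N; case: M {HM}.
have [c1 approx] := approximation_at_good_times a.
have half0 : 0 < eps / 2 by rewrite divr_gt0.
have [kap [kap0 ck small]] : exists kap : nat,
    [/\ (0 < kap)%N, (c1 <= kap)%N & Q ^+ c1.+1 * Q ^- kap < eps / 2].
  have [|d hd] := @Q_small R q q1 (eps / 4 / Q ^+ c1.+1); first by rewrite !divr_gt0 ?exprn_gt0.
  exists (d + c1.+1)%N; split; [lia | lia |].
  apply: (@le_lt_trans _ _ (Q ^+ c1.+1 * Q ^- d)).
    rewrite ler_pM2l ?exprn_gt0 // lef_pV2 ?posrE ?exprn_gt0 // ler_eXn2l ?Q_gt1 //; lia.
  have : Q ^+ c1.+1 * Q ^- d <= eps / 4 by rewrite mulrC -ler_pdivlMr ?exprn_gt0.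
  by move=> /le_lt_trans; apply; lra.
have S0 : (0 < S)%N by rewrite (bigD1 (Ordinal hm)) //= addn_gt0 hr.
pose E := (2 * M * (2 * kap))%N.
have E0 : (0 < E)%N by rewrite /E !muln_gt0 M0 kap0.
pose rho1 : R := 1 - Q ^- (S * (2 * kap)).
have rho1_gt0 : 0 < rho1.
  rewrite subr_gt0 invf_lt1 ?exprn_gt0 // exprn_egt1 ?Q_gt1 //; lia.
have rho1_lt1 : rho1 < 1 by rewrite ltrBlDr ltrDl invr_gt0 exprn_gt0.
pose lam := rho1 `^ (E%:R^-1).
have lam0 : 0 < lam by rewrite powR_gt0.
have lamE : lam ^+ E = rho1.
  by rewrite -powR_mulrn ?(ltW lam0) // -powRrM mulVf ?powRr1 ?(ltW rho1_gt0) // pnatr_eq0 -lt0n.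
have lam1 : lam < 1.
  by rewrite ltNge; apply/negP => /(exprn_ege1 E); rewrite lamE leNgt rho1_lt1.
have [D0 HD0] := geometric_small (Q ^+ S) (ltW lam0) lam1 ltr01.
(* [1 / D] will be the drop in dimension: [D >= 2] keeps [t] positive, and [Q ^+ S * lam ^+ D <= 1]
   is the [D]-th power of [mu * lam <= 1]. *)
have [D [D2 HD]] : exists D, (2 <= D)%N /\ Q ^+ S * lam ^+ D <= 1.
  by exists (maxn D0 2); rewrite leq_maxr HD0 // leq_maxl.
have Dn0 : (0 < D)%N := ltnW D2.
have Dgt0 : 0 < D%:R :> R by rewrite ltr0n.
pose delta : R := D%:R^-1.
have delta0 : 0 < delta by rewrite invr_gt0.
have delta1 : delta < 1 by rewrite invf_lt1 ?ltr1n.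
have m1 : 1 <= m%:R :> R by rewrite ler1n.
pose t : R := m%:R - delta.
have t0 : 0 < t by rewrite subr_gt0; apply: lt_le_trans m1.
exists t; split=> //; first by rewrite ltrBlDr ltrDl.
(* Lowering the exponent from [m] to [t] multiplies the sum over balls of radius [Q ^ - (S * t1)] by
   [mu ^+ t1]. Against this the holes give [lam ^+ N * lam ^+ N]: one factor offsets [mu ^+ N], the
   other makes the sum tend to 0. *)
pose mu : R := Q `^ (delta * S%:R).
have mu0 : 0 < mu by rewrite powR_gt0.
have mulam : mu * lam <= 1.
  have mulam0 : 0 <= mu * lam by rewrite mulr_ge0 ?ltW.
  rewrite -(expr_le1 Dn0 mulam0).
  rewrite exprMn -[mu ^+ _]powR_mulrn ?(ltW mu0) // -powRrM mulrAC mulVf ?lt0r_neq0 // mul1r.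
  by rewrite powR_mulrn ?(ltW Q0).
pose Xk k := uniformly_bad (eps / 2) k `&` box vh (fun=> - k%:Z).
apply: (@hausdorff_measure_eq0 R Kv vh q hvh q1 m _ Xk) => //.
  move=> th /(Bad_sub eps0)[T _ hT]; have [B HB] := uniform_bound vh (fun i => th i 0).
  exists (maxn T B) => //; split=> [x hx xT|i]; last first.
    by apply: val_ge_le (HB i); rewrite lerN2 lez_nat leq_maxr.
  by apply: hT => //; apply: le_trans xT; rewrite ler_eXn2l ?Q_gt1 // leq_maxl.
move=> k0 eta N0 eta0.
pose good l := ~ short_vector vh Gam r s A a l /\ (k0 + kap <= l)%N.
have holes l : good l -> forall c, exists y, level_box vh r (l - kap) c y /\
    forall x, level_box vh r (l + kap) y x -> ~ Xk k0 x.
  move=> [nsh hl] c; have [|||y [h1 h2]] := bad_hole approx ck small (T := k0) _ _ _ nsh c.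
  - exact: leq_trans (leq_addr _ _) hl.
  - exact: leq_trans (leq_addl _ _) hl.
  - exact: leq_trans kap0 (leq_trans (leq_addl _ _) hl).
  by exists y; split=> // x /h2 nb [].
pose C0 := Q ^+ (m * k0) * mu ^+ kap * (lam ^- (2 * M * (k0 + kap))).
have [N1 HN1] := geometric_small C0 (ltW lam0) lam1 eta0.
have [N NN NM] := HM (maxn N0 N1).
have {}HN1 := HN1 N (leq_trans (leq_maxr _ _) NN).
have {NN} NN0 := leq_trans (leq_maxl N0 N1) NN.
pose t1 := (N + kap)%N.
have good_ge l : good l -> (kap <= l)%N by move=> [_]; apply: leq_trans; exact: leq_addl.
have Xb : Xk k0 `<=` box vh (fun=> - k0%:Z) by move=> x [].
have [cs cov sz] := box_count hvh hrho kap0 lam0 lam1 lamE good_ge Xb holes t1.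
have [L [sL LP]] := box_representatives (fun i => (t1 * r i)%N%:Z)
  (fun i => S * t1 - t1 * r i)%N hvh hrho.
have rS i : (t1 * r i <= S * t1)%N by rewrite mulnC leq_mul2r (bigD1 i) //= leq_addr orbT.
(* Level boxes have exponents [t1 * r i] depending on the coordinate, whereas Hausdorff measure uses
   balls: each box is cut into balls of the common exponent [S * t1], which dominates all of
   them. *)
exists (S * t1)%N, [seq c + l | c <- cs, l <- L]; split.
- by apply: leq_trans NN0 (leq_trans (leq_addr kap N) _); rewrite leq_pmull.
- move=> x /cov[c cin cx]; have [|l lL lx] := LP (x - c).
    by move=> i; have := cx i; rewrite !mxE.
  exists (c + l); first exact: allpairs_f.
  move=> i; have := lx i; rewrite !mxE opprD addrA; apply: val_ge_le.
  by rewrite -PoszD lez_nat subnKC.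
have sumE : (\sum_i (S * t1 - t1 * r i) + S * t1 = m * (S * t1))%N.
  rewrite [X in (_ + X)%N]mulnC big_distrr /= -big_split /=.
  rewrite (eq_bigr (fun=> (S * t1)%N)); last by move=> i _; rewrite subnK.
  by rewrite sum_nat_const card_ord.
rewrite size_allpairs sL natrM natrX.
have -> : (Q ^- (S * t1)) `^ t = Q ^- (m * (S * t1)) * mu ^+ t1.
  rewrite -[mu ^+ _]powR_mulrn ?(ltW mu0) // -powRrM.
  rewrite -!powR_invn ?(ltW Q0) // -powRrM -powRD ?(lt0r_neq0 Q0) ?implybT //.
  by congr (_ `^ _); rewrite /t !natrM; ring.
set G := cnt good _ in sz.
have cntG : (N <= M * (k0 + kap + G))%N.
  apply: leq_trans (ltnW NM) _; rewrite leq_mul2l; apply/orP; right.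
  apply: leq_trans (cnt_tail _ (k0 + kap) _) _; rewrite leq_add2l cnt_le //.
  by rewrite /t1 subSn ?leq_addl // addnK.
have lamG : (lam ^+ (2 * M)) ^+ G <= lam ^- (2 * M * (k0 + kap)) * (lam ^+ N * lam ^+ N).
  rewrite ler_pdivlMl ?exprn_gt0 // -!exprM -!exprD ler_wiXn2l ?(ltW lam0) ?(ltW lam1) //.
  by rewrite -mulnDr addnn -mul2n -mulnA leq_mul2l.
have QE : Q ^+ (m * (S * t1)) = Q ^+ (\sum_i (S * t1 - t1 * r i)) * Q ^+ (S * t1).
  by rewrite -exprD sumE.
have muN : mu ^+ N * lam ^+ N <= 1 by rewrite -exprMn exprn_ile1 // mulr_ge0 ?ltW.
apply: le_trans HN1.
apply: (@le_trans _ _ (Q ^+ (m * k0) * mu ^+ t1 * (lam ^+ (2 * M)) ^+ G)).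
  rewrite QE; set w := (\sum_i _)%N.
  have cancel (x y z w0 b : R) : w0 != 0 -> b != 0 ->
    x * y * z = x * b * z * w0 * ((w0 * b)^-1 * y).
    by move=> w0n bn; field; rewrite w0n bn.
  rewrite (cancel (Q ^+ (m * k0)) _ _ (Q ^+ w) (Q ^+ (S * t1))) ?expf_neq0 ?lt0r_neq0 //.
  rewrite !ler_wpM2r ?exprn_ge0 ?(ltW Q0) // mulr_ge0 ?invr_ge0 ?mulr_ge0 ?exprn_ge0 ?ltW //.
apply: (@le_trans _ _ (Q ^+ (m * k0) * mu ^+ t1 *
    (lam ^- (2 * M * (k0 + kap)) * (lam ^+ N * lam ^+ N)))).
  by rewrite ler_wpM2l // mulr_ge0 ?exprn_ge0 // ltW.
have -> : Q ^+ (m * k0) * mu ^+ t1 * (lam ^- (2 * M * (k0 + kap)) * (lam ^+ N * lam ^+ N)) =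
    C0 * lam ^+ N * (mu ^+ N * lam ^+ N).
  by rewrite /C0 exprD; ring.
rewrite ler_piMr // mulr_ge0 ?exprn_ge0 ?(ltW lam0) //.
by rewrite /C0 !mulr_ge0 ?invr_ge0 ?exprn_ge0 ?ltW.
Qed.

End Setting.

Theorem theorem1p1 (R : realType)
    (k : finFieldType) (K : fieldType) (iota : {rmorphism k -> K})
    (hK : function_field iota)
    (v : K -> int) (hv : normalized_valuation v)
    (Kv : fieldType) (j : {rmorphism K -> Kv}) (vh : Kv -> int)
    (hKv : is_completion v j vh)
    (qv : nat) (hqv : (residue_field vh #= `I_qv)%card)
    (m n : nat) (hm : (0 < m)%N) (hn : (0 < n)%N)
    (r : 'I_m -> nat) (s : 'I_n -> nat)
    (hr : forall i, (0 < r i)%N) (hs : forall i, (0 < s i)%N)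
    (hrs : (\sum_(i < m) r i = \sum_(i < n) s i)%N)
    (A : 'M[Kv]_(m, n)) :
  (exists eps : R, 0 < eps /\
     hausdorff_dim (fun x y : 'cV[Kv]_m => max_norm R vh qv (x - y))
       (Bad v j vh qv r s A eps) = (m%:R)%:E)
  <-> singular_on_average R v j vh qv r s A.
Proof.
have hvh := compl_val hKv; have [rho hrho] := residue_system_of_card hvh hqv.
rewrite (singular_on_averageP R hKv hrho hm hn hr hs hrs A).
split=> [[eps [eps0 dimE]]|]; last exact: (full_dimension R hK hv hKv hrho hm hn hr hs hrs).
apply: contrapT => nr.
have [t [t0 tm meas0]] := dimension_drop hK hv hKv hrho hm hn hr hs hrs nr eps0.
suff : ((m%:R)%:E <= t%:E :> \bar R)%E by rewrite lee_fin leNgt tm.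
by rewrite -dimE; apply: ereal_inf_lbound; exists t.
Qed.
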